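(* Let $(X,d,p)$ be a metric space with a marked point $p$. Suppose that every pretangent space $\Omega_{p,\tilde r}^{X}$ to $X$ at $p$ (for every normalizing sequence $\tilde r$) is separable and tangent. Then the following statements are equivalent. (i) Every $\Omega_{p,\tilde r}^{X}$ is a CAT(0)-space. (ii) $X$ is Busemann convex at the point $p$ and $$\liminf_{w,x,y,z\to p}A_{3}(w,x,y,z)\ge 0,$$ where $A_3:X^4\to\mathbb R$ is defined by $$A_3 (w,x,y,z)=\frac{d(x,w)d(y,z)+d(x,z)d(y,w)-d(x,y)d(w,z)}{\bigl(\max\{d(w,p),d(x,p),d(y,p),d(z,p)\}\bigr)^{2}}$$ for $(w,x,y,z)\ne (p,p,p,p)$ and $A_{3}(p,p,p,p)=0$.
   Context: Pretangent and tangent spaces. Let $(X,d,p)$ be a metric space with marked point $p$. A normalizing sequence is a sequence $\tilde r=\{r_n\}_{n\in\mathbb N}$ of positive reals with $r_n\to 0$. Let $\tilde X$ be the set of all sequences of points of $X$. Two sequences $\tilde x=\{x_n\},\tilde y=\{y_n\}\in\tilde X$ are mutually stable with respect to $\tilde r$ if the finite limit $\tilde d_{\tilde r}(\tilde x,\tilde y):=\lim_{n\to\infty} d(x_n,y_n)/r_n$ exists. A family $\tilde F\subseteq\tilde X$ is self-stable if any two of its elements are mutually stable; it is maximal self-stable if moreover for every $\tilde z\in\tilde X\setminus\tilde F$ there is $\tilde x\in\tilde F$ such that $\tilde x,\tilde z$ are not mutually stable. Let $\tilde X_{p,\tilde r}$ denote a maximal self-stable family (with respect to $\tilde r$) containing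 the constant sequence $\tilde p=(p,p,\dots)$. Then $(\tilde X_{p,\tilde r},\tilde d_{\tilde r})$ is a pseudometric space; the metric space $(\Omega_{p,\tilde r}^{X},\rho)$ obtained from it by identifying $\tilde x,\tilde y$ whenever $\tilde d_{\tilde r}(\tilde x,\tilde y)=0$, with $\rho$ induced by $\tilde d_{\tilde r}$, is called a pretangent space to $X$ at $p$ with respect to $\tilde r$. (There may be several pretangent spaces for one $\tilde r$, depending on the choice of $\tilde X_{p,\tilde r}$.) For a strictly increasing sequence $\{n_k\}$ of natural numbers put $\tilde r'=\{r_{n_k}\}_{k}$ and $\tilde x'=\{x_{n_k}\}_k$ for $\tilde x\in\tilde X$. For every maximal self-stable (with respect to $\tilde r'$) family $\tilde X_{p,\tilde r'}\supseteq\{\tilde x':\tilde x\in\tilde X_{p,\tilde r}\}$ the map $\tilde x\mapsto\tilde x'$ induces an isometric embedding $em':\Omega_{p,\tilde r}^{X}\to\Omega_{p,\tilde r'}^{X}$. The pretangent space $\Omega_{p,\tilde r}^{X}$ is called tangent if $em'$ is bijective for every such $\{n_k\}$ and every such $\tilde X_{p,\tilde r'}$. Midpoint convexity at $p$. $X$ is midpoint convex at $p$ if for any two sequences $\tilde x=\{x_n\}$, $\tilde y=\{y_n\}$ in $X$ converging to $p$ there is a sequence $\tilde z=\{z_n\}$ in $X$ (called an infinitesimal midpoint of $\tilde x,\tilde y$) such that, with $\delta_p(x,y):=\max\{d(x,p),d(y,p)\}$, $$\lim_{n\to\infty}\frac{|d(x_n,z_n)-\frac12 d(x_n,y_n)|}{\delta_p(x_n,y_n)}=\lim_{n\to\infty}\frac{|d(y_n,z_n)-\frac12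 d(x_n,y_n)|}{\delta_p(x_n,y_n)}=0,$$ where, when $x_n=y_n=p$, the quotients are understood as $0$ if $z_n=p$ and as $+\infty$ if $z_n\ne p$. Busemann convexity at $p$. $X$ is Busemann convex at $p$ if it is midpoint convex at $p$ and for any sequences $\tilde x^0=\{x_n^0\}$, $\tilde x^1=\{x_n^1\}$, $\tilde y=\{y_n\}$ in $X$ converging to $p$ and any infinitesimal midpoint $\tilde m^x=\{m_n^x\}$ of $\tilde x^0,\tilde x^1$, $$\Bigl(d(m_n^x,y_n)-\tfrac12\bigl(d(x_n^0,y_n)+d(x_n^1,y_n)\bigr)\Bigr)_+=o\bigl(\delta_p(x_n^0,y_n,x_n^1)\bigr),$$ where $(t)_+=\frac{|t|+t}{2}$ and $\delta_p(x_n^0,y_n,x_n^1)=\max\{d(x_n^0,p),d(y_n,p),d(x_n^1,p)\}$. CAT(0)-space has its usual global meaning: a geodesic metric space of nonpositive curvature in the sense of Aleksandrov, i.e. geodesic triangles are not thicker than their Euclidean comparison triangles. *)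

(* Defs.v *)
From HB Require Import structures.
From mathcomp Require Import all_boot all_order all_algebra.
From mathcomp Require Import all_classical all_reals all_analysis.

Set Implicit Arguments.
Unset Strict Implicit.
Unset Printing Implicit Defensive.

Import Order.TTheory GRing.Theory Num.Def Num.Theory.
Import numFieldNormedType.Exports.

Local Open Scope classical_set_scope.
Local Open Scope ring_scope.
Local Open Scope quotient_scope.

Record normalizing (R : realType) := Normalizing {
  nseqr :> nat -> R ;
  nseqr_gt0 : forall n, 0 < nseqr n ;
  nseqr_cvg : nseqr n @[n --> \oo] --> 0
}.

Section Subsequence.
Context {R : realType} (r : normalizing R) (k : nat -> nat)
  (k_incr : {homo k : m n / (m < n)%N}).

Lemma incr_cvg : k n @[n --> \oo] --> \oo.
Proof.
have kge n : (n <= k n)%N.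
  by elim: n => // n IH; apply: leq_ltn_trans IH _; exact: k_incr.
move=> A [N _ NA]; exists N => // n /= Nn; apply: NA => /=.
exact: leq_trans Nn (kge n).
Qed.

Lemma subnormalizing_gt0 n : 0 < (r \o k) n.
Proof. exact: nseqr_gt0. Qed.

Lemma subnormalizing_cvg : (r \o k) n @[n --> \oo] --> 0.
Proof. exact: (cvg_comp _ _ incr_cvg (@nseqr_cvg _ r)). Qed.

Definition subnormalizing : normalizing R :=
  Normalizing subnormalizing_gt0 subnormalizing_cvg.

End Subsequence.

Section Stability.
Context {R : realType} {X : metricType R}.
Implicit Types (r : nat -> R) (x y z : nat -> X) (F : set (nat -> X)).

Definition mutually_stable r x y : Prop :=
  cvgn (fun n => mdist (x n) (y n) / r n).

(* Only meaningful when [x] and [y] are mutually stable. *)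
Definition dtilde r x y : R := limn (fun n => mdist (x n) (y n) / r n).

Definition self_stable r F : Prop :=
  forall x y, F x -> F y -> mutually_stable r x y.

Definition maximal_self_stable r F : Prop :=
  self_stable r F /\
  forall z, ~ F z -> exists2 x, F x & ~ mutually_stable r x z.

End Stability.

Record stable_family (R : realType) (X : metricType R) (p : X)
    (r : normalizing R) := StableFamily {
  sfam :> set (nat -> X) ;
  sfam_max : maximal_self_stable r sfam ;
  sfam_pt : sfam (fun=> p)
}.

Section Pretangent.
Context {R : realType} {X : metricType R} {p : X} {r : normalizing R}.
Variable F : stable_family p r.

Lemma sfam_cvg (x y : set_type F) : mutually_stable r (val x) (val y).
Proof.
by apply: (sfam_max F).1; [have := valP x|have := valP y]; rewrite inE.
Qed.

Definition sdist (x y : set_type F) : R := dtilde r (val x) (val y).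

Lemma sdistxx x : sdist x x = 0.
Proof.
rewrite /sdist /dtilde (_ : (fun n => _) = fun=> 0); first exact: lim_cst.
by apply/funext => n; rewrite mdistxx mul0r.
Qed.

Lemma sdistC x y : sdist x y = sdist y x.
Proof.
rewrite /sdist /dtilde; congr (limn _).
by apply/funext => n; rewrite metric_sym.
Qed.

Lemma sdist_ge0 x y : 0 <= sdist x y.
Proof.
apply: limr_ge; first exact: sfam_cvg.
by apply: nearW => n; rewrite divr_ge0 ?mdist_ge0// ltW// nseqr_gt0.
Qed.

Lemma sdist_triangle y x z : sdist x z <= sdist x y + sdist y z.
Proof.
rewrite /sdist /dtilde -limD; [|exact: sfam_cvg|exact: sfam_cvg].
apply: ler_lim; [exact: sfam_cvg|by apply: is_cvgD; exact: sfam_cvg|].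
apply: nearW => n /=; rewrite -mulrDl ler_wpM2r ?metric_triangle//.
by rewrite invr_ge0 ltW// nseqr_gt0.
Qed.

Definition indist : rel (set_type F) := fun x y => sdist x y == 0.

Lemma indist_refl : reflexive indist.
Proof. by move=> x; apply/eqP; exact: sdistxx. Qed.

Lemma indist_sym : symmetric indist.
Proof. by move=> x y; rewrite /indist sdistC. Qed.

Lemma indist_trans : transitive indist.
Proof.
move=> y x z /eqP xy /eqP yz; apply/eqP/le_anti; rewrite sdist_ge0 andbT.
by rewrite (le_trans (sdist_triangle y _ _))// xy yz addr0.
Qed.

Canonical indist_equiv := EquivRel indist indist_refl indist_sym indist_trans.

Definition pretangent := {eq_quot indist}.

HB.instance Definition _ := Choice.on pretangent.
HB.instance Definition _ := EqQuotient.on pretangent.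

Lemma pi_pretangentP (x y : set_type F) :
  reflect (\pi_pretangent x = \pi_pretangent y) (sdist x y == 0).
Proof. exact: (eqquotP pretangent). Qed.

Definition pdist (a b : pretangent) : R := sdist (repr a) (repr b).

Lemma repr_pi_sdist (x : set_type F) : sdist (repr (\pi_pretangent x)) x = 0.
Proof. by apply/eqP/pi_pretangentP; rewrite reprK. Qed.

Lemma pdist_pi (x y : set_type F) :
  pdist (\pi_pretangent x) (\pi_pretangent y) = sdist x y.
Proof.
have hx := repr_pi_sdist x; have hy := repr_pi_sdist y.
apply/le_anti/andP; split.
  apply: le_trans (sdist_triangle x _ _) _; rewrite hx add0r.
  by apply: le_trans (sdist_triangle y _ _) _; rewrite (sdistC y) hy addr0.
apply: le_trans (sdist_triangle (repr (\pi_pretangent x)) _ _) _.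
rewrite sdistC hx add0r.
apply: le_trans (sdist_triangle (repr (\pi_pretangent y)) _ _) _.
by rewrite hy addr0.
Qed.

Lemma pdistxx a : pdist a a = 0. Proof. exact: sdistxx. Qed.

Lemma pdist_positivity a b : pdist a b = 0 -> a = b.
Proof.
by move=> /eqP/pi_pretangentP; rewrite !reprK.
Qed.

Lemma pdistC a b : pdist a b = pdist b a. Proof. exact: sdistC. Qed.

Lemma pdist_triangle b a c : pdist a c <= pdist a b + pdist b c.
Proof. exact: sdist_triangle. Qed.

HB.instance Definition _ :=
  isMetric.Build R pretangent pdistxx pdist_positivity pdistC pdist_triangle.

End Pretangent.

Section Tangent.
Context {R : realType} {X : metricType R} {p : X} {r : normalizing R}.

Section Embedding.
Variables (F : stable_family p r) (k : nat -> nat)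
  (k_incr : {homo k : m n / (m < n)%N})
  (F' : stable_family p (subnormalizing r k_incr))
  (FF' : [set x \o k | x in F] `<=` F').

Lemma subseq_mem (x : set_type F) : val x \o k \in (F' : set (nat -> X)).
Proof.
rewrite inE; apply: FF'; exists (val x) => //.
by have := valP x; rewrite inE.
Qed.

Definition subseq_fam (x : set_type F) : set_type F' := SigSub (subseq_mem x).

Definition em (a : pretangent F) : pretangent F' :=
  \pi_(pretangent F') (subseq_fam (repr a)).

Lemma sdist_subseq (x y : set_type F) :
  sdist (subseq_fam x) (subseq_fam y) = sdist x y.
Proof.
apply/cvg_lim => //.
have xy : mdist (val x n) (val y n) / r n @[n --> \oo] --> sdist x y.
  exact: sfam_cvg.
exact: (cvg_comp _ _ (incr_cvg k_incr) xy).
Qed.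

Lemma em_pi (x : set_type F) :
  em (\pi_(pretangent F) x) = \pi_(pretangent F') (subseq_fam x).
Proof.
apply: pdist_positivity; rewrite pdist_pi sdist_subseq.
exact: repr_pi_sdist.
Qed.

Lemma em_isometry (a b : pretangent F) : mdist (em a) (em b) = mdist a b.
Proof. by rewrite [LHS]pdist_pi sdist_subseq. Qed.

End Embedding.

Definition tangent (F : stable_family p r) : Prop :=
  forall (k : nat -> nat) (k_incr : {homo k : m n / (m < n)%N})
    (F' : stable_family p (subnormalizing r k_incr))
    (FF' : [set x \o k | x in F] `<=` F'),
    bijective (em FF').

End Tangent.

Definition separable (T : topologicalType) : Prop :=
  exists2 A : set T, countable A & dense A.

Section CAT0.
Context {R : realType}.

(* The library norm on ['rV[R]_2] is the sup norm. *)
Definition edist (u v : 'rV[R]_2) : R :=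
  Num.sqrt (\sum_(i < 2) (u 0 i - v 0 i) ^+ 2).

Context (M : metricType R).

(* [c], restricted to [[0, mdist x y]], is a geodesic from [x] to [y]. *)
Definition geodesic (x y : M) (c : R -> M) : Prop :=
  [/\ c 0 = x, c (mdist x y) = y &
      forall s t, s \in `[0, mdist x y] -> t \in `[0, mdist x y] ->
        mdist (c s) (c t) = `|s - t|].

Definition geodesic_space : Prop :=
  forall x y : M, exists c, geodesic x y c.

(* [q] is the point of the segment [[u, v]] at distance [s] from [u]. *)
Definition comparison_point (u v : 'rV[R]_2) (s : R) (q : 'rV[R]_2) : Prop :=
  (exists2 l : R, l \in `[0, 1] & q = (1 - l) *: u + l *: v) /\ edist u q = s.

(* A geodesic triangle has vertices [v 0], [v 1], [v 2]; its side [i] is a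
   geodesic [c i] from [v i] to the cyclically next vertex [v (ordS i)]. *)
Definition CAT0 : Prop :=
  geodesic_space /\
  forall (v : 'I_3 -> M) (c : 'I_3 -> R -> M) (a : 'I_3 -> 'rV[R]_2),
    (forall i, geodesic (v i) (v (ordS i)) (c i)) ->
    (forall i j, edist (a i) (a j) = mdist (v i) (v j)) ->
    forall (i j : 'I_3) (s t : R) (q q' : 'rV[R]_2),
      s \in `[0, mdist (v i) (v (ordS i))] ->
      t \in `[0, mdist (v j) (v (ordS j))] ->
      comparison_point (a i) (a (ordS i)) s q ->
      comparison_point (a j) (a (ordS j)) t q' ->
      mdist (c i s) (c j t) <= edist q q'.

End CAT0.

Section InfinitesimalConvexity.
Context {R : realType} {X : metricType R} (p : X).

Definition delta2 (x y : X) : R := Num.max (mdist x p) (mdist y p).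

Definition delta3 (x y z : X) : R :=
  Num.max (Num.max (mdist x p) (mdist y p)) (mdist z p).

(* The quotient [`|d(a, z) - d(x, y) / 2| / delta2 x y], where [a] is [x] or
   [y], with its convention for [x = y = p]. *)
Definition midpoint_quotient (x y z a : X) : \bar R :=
  if (x == p) && (y == p) then (if z == p then 0%E else +oo%E)
  else (`|mdist a z - mdist x y / 2| / delta2 x y)%:E.

Definition infinitesimal_midpoint (x y z : nat -> X) : Prop :=
  (midpoint_quotient (x n) (y n) (z n) (x n) @[n --> \oo] --> 0%E) /\
  (midpoint_quotient (x n) (y n) (z n) (y n) @[n --> \oo] --> 0%E).

Definition midpoint_convex : Prop :=
  forall x y : nat -> X, x n @[n --> \oo] --> p -> y n @[n --> \oo] --> p ->
    exists z, infinitesimal_midpoint x y z.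

Definition pospart (t : R) : R := (`|t| + t) / 2.

Definition Busemann_convex : Prop :=
  midpoint_convex /\
  forall x0 x1 y m : nat -> X,
    x0 n @[n --> \oo] --> p -> x1 n @[n --> \oo] --> p ->
    y n @[n --> \oo] --> p -> infinitesimal_midpoint x0 x1 m ->
    (fun n => pospart (mdist (m n) (y n)
                - (mdist (x0 n) (y n) + mdist (x1 n) (y n)) / 2) : R^o)
      =o_\oo (fun n => delta3 (x0 n) (y n) (x1 n) : R^o).

Definition A3 (u : X * X * X * X) : R :=
  let: (w, x, y, z) := u in
  if u == (p, p, p, p) then 0 else
  (mdist x w * mdist y z + mdist x z * mdist y w - mdist x y * mdist w z) /
  Num.max (Num.max (mdist w p) (mdist x p))
          (Num.max (mdist y p) (mdist z p)) ^+ 2.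

End InfinitesimalConvexity.

(* Main.v *)
Require Import Defs.
From HB Require Import structures.
From mathcomp Require Import all_boot all_order all_algebra.
From mathcomp Require Import all_classical all_reals all_analysis.
From mathcomp Require Import ring lra.

Set Implicit Arguments.
Unset Strict Implicit.
Unset Printing Implicit Defensive.

Import Order.TTheory GRing.Theory Num.Def Num.Theory.
Import numFieldNormedType.Exports.

Local Open Scope classical_set_scope.
Local Open Scope ring_scope.

(* The Busemann condition adds to Ptolemy's inequality only the existence of
   midpoints, so nonpositive curvature has to come from the hypothesis on all the
   pretangent spaces. By a diagonal extraction, separability and tangency make each
   pretangent space [M] proper and homogeneous: every finite partial similarity of [M]
   fixing the base point [o] extends to any further point.

   Suppose that [M] is moreover Ptolemaic and has midpoints. Distance functions are then
   convex along geodesics. Two points at the same position on geodesics from [o] to one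
   end would, by homogeneity, generate infinitely many equidistant ones, so these
   geodesics are unique; and the contraction of the unit sphere to radius [s] multiplies
   distances by [s], since it preserves the packing numbers of balls. Hence [M] is a cone,
   and Ptolemy's inequality for trapezoids whose parallel sides lie on two rays, together
   with convexity, gives the Euclidean cone law
   [d(ax, by)^2 = (a - b)^2 + a b d(x, y)^2] for unit vectors [x] and [y]. Convexity of the
   distance from a point going to infinity on a ray makes [ip z], the inner product, concave
   along geodesics, and the first variation of the distance bounds the norm of an
   intermediate point; together these give the Bruhat-Tits inequality, hence CAT(0).

   Conversely a CAT(0) space satisfies Ptolemy's inequality and convexity, and a failure of
   (ii) along sequences tending to [p] persists in the pretangent space obtained by
   rescaling with the distance of these sequences to [p]. *)

(** * Ptolemy's inequality, points between two points, convexity of distance functions *)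

Section MetricPreliminaries.
Context {R : realType} {M : metricType R}.
Implicit Types (x y z u v w : M) (s t : R).
Local Notation d := (@mdist R M).

(** Homogeneity comes from interleaving the scales [r n] and [l * r n] in one normalizing sequence:
    a point realized along one half leaves a trace along the other half, and this trace is the value
    of the extended similarity. Extensions exist only for finitely many points at a time, with no
    coherence between them, so each use has to be a finite configuration or a count that properness
    keeps finite.

    Trapezoids give only the upper half of the cone law. For the lower half, convexity first gives a
    bound of the right order; then Ptolemy's inequality is applied to a second figure, a small
    quadrilateral with one diagonal on a ray and the other joining two unit vectors. Its planar
    model is cyclic with perpendicular diagonals, so Ptolemy's inequality is an equality there, and
    the relative error is of the order of the size of the figure. Subdividing a segment makes the
    error vanish, and a triangle inequality for the planar distances puts the pieces together. *)

Definition ptolemaic : Prop :=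
  forall w x y z, d x y * d w z <= d x w * d y z + d x z * d y w.

Definition btw t x y u : Prop := d x u = t * d x y /\ d u y = (1 - t) * d x y.

Lemma btw_le t x y u :
  d x u <= t * d x y -> d u y <= (1 - t) * d x y -> btw t x y u.
Proof. by move=> h1 h2; have := metric_triangle x u y; split; lra. Qed.

Definition has_points : Prop :=
  forall x y t, 0 <= t <= 1 -> exists u, btw t x y u.

Definition bruhat_tits : Prop :=
  forall x y z u t, 0 <= t <= 1 -> btw t x y u ->
  d z u ^+ 2 <= (1 - t) * d z x ^+ 2 + t * d z y ^+ 2 - t * (1 - t) * d x y ^+ 2.

(** Ptolemy's inequality with diagonals [x y] and [u z], divided by [d x y]. *)
Lemma ptolemaic_convex (pt : ptolemaic) t x y u z : 0 <= t <= 1 -> btw t x y u ->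
  d z u <= (1 - t) * d z x + t * d z y.
Proof.
move=> /andP[t0 t1] [h1 h2].
have := mdist_ge0 x y; rewrite le_eqVlt => /orP[/eqP xy|xy].
  have xu : x = u by apply: mdist_positivity; rewrite h1 -xy mulr0.
  have uy : u = y by apply: mdist_positivity; rewrite h2 -xy mulr0.
  by rewrite -uy -xu; lra.
have := pt u x y z.
rewrite (metric_sym y z) (metric_sym y u) (metric_sym x z) (metric_sym u z) h1 h2.
by move=> H; rewrite -(ler_pM2l xy); lra.
Qed.

End MetricPreliminaries.

(** * Homogeneous proper spaces and the uniqueness of geodesics from the base point *)

Section Homogeneous.
Context {R : realType} {M : metricType R} (p : M).
Implicit Types (x y z u v w : M) (s t a b c e l : R) (q : seq (M * M)).
Local Notation d := (@mdist R M).
Local Notation nm := (@mdist R M p).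

(** Graph of a finite partial similarity of ratio [l]. Pairs with equal first components have second
    components at distance 0, so single-valuedness is automatic. *)
Definition psim l q : Prop :=
  forall f g, f \in q -> g \in q -> d f.2 g.2 = l * d f.1 g.1.

Definition homogeneous : Prop :=
  forall l q x, 0 < l -> (p, p) \in q -> psim l q -> exists y, psim l ((x, y) :: q).

(** Properness in sequential form. *)
Definition bounded_cluster : Prop :=
  forall f : nat -> M, (exists B, forall n, nm (f n) <= B) ->
  exists z, forall e, 0 < e -> forall N, exists2 n, (N <= n)%N & d (f n) z < e.

Lemma psim_cons l q x y : psim l q ->
  (forall f, f \in q -> d y f.2 = l * d x f.1) -> psim l ((x, y) :: q).
Proof.
move=> H1 H2 f g; rewrite !inE => /predU1P[->|fq] /predU1P[->|gq] /=.
- by rewrite !mdistxx mulr0.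
- exact: H2.
- by rewrite metric_sym H2// metric_sym.
- exact: H1.
Qed.

Lemma psim_sub l q q' : {subset q' <= q} -> psim l q -> psim l q'.
Proof. by move=> sub H f g /sub fq /sub gq; exact: H. Qed.

Lemma psim_pp l : psim l [:: (p, p)].
Proof. by move=> f g; rewrite !inE => /eqP -> /eqP -> /=; rewrite mdistxx mulr0. Qed.

Hypotheses (PT : @ptolemaic R M) (HP : @has_points R M).
Hypotheses (BC : bounded_cluster) (HO : homogeneous).

Lemma psim1 l x y : nm y = l * nm x -> psim l [:: (x, y); (p, p)].
Proof.
move=> h; apply: psim_cons; first exact: psim_pp.
by move=> f; rewrite inE => /eqP -> /=; rewrite metric_sym h (metric_sym x).
Qed.

Lemma psim2 l x y u v : nm y = l * nm x -> nm v = l * nm u -> d y v = l * d x u ->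
  psim l [:: (x, y); (u, v); (p, p)].
Proof.
move=> h1 h2 h3; apply: psim_cons; first exact: psim1.
move=> f; rewrite !inE => /orP[|] /eqP -> //=.
by rewrite metric_sym h1 (metric_sym x).
Qed.

Lemma psim3 l x y u v w z : nm y = l * nm x -> nm v = l * nm u -> nm z = l * nm w ->
  d y v = l * d x u -> d y z = l * d x w -> d v z = l * d u w ->
  psim l [:: (x, y); (u, v); (w, z); (p, p)].
Proof.
move=> h1 h2 h3 h4 h5 h6; apply: psim_cons; first exact: psim2.
move=> f; rewrite !inE => /or3P[] /eqP -> //=.
by rewrite metric_sym h1 (metric_sym x).
Qed.

Lemma ext1 l x y u : 0 < l -> nm y = l * nm x ->
  exists v, nm v = l * nm u /\ d y v = l * d x u.
Proof.
move=> l0 /psim1 H; have [|v Hv] := HO u l0 _ H; first by rewrite !inE eqxx ?orbT.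
by exists v; split; [apply: (Hv (p, p) (u, v))|apply: (Hv (x, y) (u, v))];
  rewrite !inE !eqxx ?orbT.
Qed.

Lemma ext2 l x y x' y' u : 0 < l -> nm y = l * nm x -> nm y' = l * nm x' ->
  d y y' = l * d x x' ->
  exists v, [/\ nm v = l * nm u, d y v = l * d x u & d y' v = l * d x' u].
Proof.
move=> l0 h1 h2 h3; have H := psim2 h1 h2 h3.
have [|v Hv] := HO u l0 _ H; first by rewrite !inE eqxx ?orbT.
by exists v; split; [apply: (Hv (p, p) (u, v))|apply: (Hv (x, y) (u, v))|
  apply: (Hv (x', y') (u, v))]; rewrite !inE !eqxx ?orbT.
Qed.

Lemma ext3 l x y x' y' x'' y'' u : 0 < l ->
  nm y = l * nm x -> nm y' = l * nm x' -> nm y'' = l * nm x'' ->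
  d y y' = l * d x x' -> d y y'' = l * d x x'' -> d y' y'' = l * d x' x'' ->
  exists v, [/\ nm v = l * nm u, d y v = l * d x u, d y' v = l * d x' u
     & d y'' v = l * d x'' u].
Proof.
move=> l0 h1 h2 h3 h4 h5 h6; have H := psim3 h1 h2 h3 h4 h5 h6.
have [|v Hv] := HO u l0 _ H; first by rewrite !inE eqxx ?orbT.
by exists v; split; [apply: (Hv (p, p) (u, v))|apply: (Hv (x, y) (u, v))|
  apply: (Hv (x', y') (u, v))|apply: (Hv (x'', y'') (u, v))]; rewrite !inE !eqxx ?orbT.
Qed.

(** Two terms close to a common cluster point. This is what excludes infinite separated families in
    a ball. *)
Lemma bounded_near (f : nat -> M) c : 0 < c -> (exists B, forall n, nm (f n) <= B) ->
  exists m n, (m < n)%N /\ d (f m) (f n) < c.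
Proof.
move=> c0 Bf; have [z Hz] := BC Bf.
have c2 : 0 < c / 2 by rewrite divr_gt0.
have [m _ mz] := Hz _ c2 0%N; have [n mn nz] := Hz _ c2 m.+1.
exists m, n; split => //.
by have := metric_triangle (f m) z (f n); rewrite (metric_sym z); lra.
Qed.

Lemma cluster_dist (f : nat -> M) z x c (g : nat -> R) :
  (forall e, 0 < e -> forall N, exists2 n, (N <= n)%N & d (f n) z < e) ->
  (forall e, 0 < e -> exists N, forall n, (N <= n)%N -> `|g n| < e) ->
  (forall n, `|d x (f n) - c| <= g n) -> d x z = c.
Proof.
move=> Hz Hg H; apply/eqP; rewrite -subr_eq0 -normr_le0; apply/ler_addgt0Pl => e e0.
have e2 : 0 < e / 2 by rewrite divr_gt0.
have [N HN] := Hg _ e2; have [n Nn nz] := Hz _ e2 N.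
have := HN n Nn; have := H n; have := metric_triangle x z (f n).
have := metric_triangle x (f n) z; have := ler_norm (g n).
rewrite (metric_sym z (f n)) addr0 => h1 h2 h3; rewrite ler_norml => /andP[h4 h5] h6.
by rewrite ler_norml; apply/andP; split; lra.
Qed.

Lemma dist_le_of_lt (a c k : R) : 0 <= k -> c - k < a -> a <= c -> `|a - c| <= k.
Proof. by move=> *; rewrite ler_norml; apply/andP; split; lra. Qed.

Lemma invS_small e : 0 < e -> exists N, forall n, (N <= n)%N -> `|n.+1%:R^-1 : R| < e.
Proof.
move=> e0; exists (Num.truncn e^-1) => n Nn.
rewrite ger0_norm ?invr_ge0// invf_plt ?posrE//.
apply: lt_le_trans (truncnS_gt _) _.
by rewrite ler_nat ltnS.
Qed.

Section Uniqueness.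
Variables (s : R) (x : M).
Hypothesis s01 : 0 <= s <= 1.
Let K u := btw s p x u.

(** Convexity of the distances to [p] and to [x] bounds both from above, and upper bounds suffice by
    [btw_le]. *)
Lemma btw_mid u v w : K u -> K v -> btw (1 / 2) u v w -> K w.
Proof.
move=> [u1 u2] [v1 v2] h.
have half : 0 <= (1 / 2 : R) <= 1 by lra.
have hp := ptolemaic_convex PT p half h; have hx := ptolemaic_convex PT x half h.
apply: btw_le; first by rewrite u1 v1 in hp; lra.
by rewrite (metric_sym x u) (metric_sym x v) u2 v2 (metric_sym x w) in hx; lra.
Qed.

(** The partial isometry fixing [p] and [x] and taking [u] to [w] extends to [v]; membership in [K]
    involves only the distances to [p] and [x]. *)
Lemma btw_move u w v : K u -> K w -> K v -> exists2 v', K v' & d w v' = d u v.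
Proof.
move=> [u1 u2] [w1 w2] [v1 v2].
have [|||v' [h1 h2 h3]] := @ext2 1 x x u w v ltr01.
- by rewrite mul1r.
- by rewrite mul1r u1 w1.
- by rewrite mul1r !(metric_sym x) u2 w2.
exists v'; last by rewrite h3 mul1r.
by split; [rewrite h1 mul1r|rewrite metric_sym h2 mul1r metric_sym].
Qed.

(* A nontrivial set of candidates, being homogeneous and midpoint convex, would contain
   an infinite equilateral set whose side is its diameter. *)
Lemma btw_unique u v : K u -> K v -> u = v.
Proof.
move=> Ku Kv; apply: contrapT => uv.
pose A := [set r | exists2 w, K w & d u w = r].
have Kb w : K w -> nm w <= nm x.
  by move=> [-> _]; rewrite ler_piMl ?mdist_ge0//; case/andP: s01.
have A0 : A !=set0 by exists (d u v), v.
have Aub : has_ubound A.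
  exists (nm x + nm x) => r [w Kw <-].
  have := metric_triangle u p w; rewrite (metric_sym u p).
  by have := Kb _ Kw; have := Kb _ Ku; lra.
pose c := sup A.
have Ac w w' : K w -> K w' -> d w w' <= c.
  move=> Kw Kw'; have [v' Kv' <-] := btw_move Kw Ku Kw'.
  by apply: ub_le_sup => //; exists v'.
have c0 : 0 < c.
  by apply: lt_le_trans (Ac _ _ Ku Kv); rewrite mdist_gt0; apply/eqP.
(* The supremum is attained: nearly extremal candidates have a cluster point, which is again a
   candidate. *)
have [v0 Kv0 uv0] : exists2 v0, K v0 & d u v0 = c.
  have /choice[f Hf] : forall n : nat, exists w, K w /\ c - n.+1%:R^-1 < d u w.
    move=> n; rewrite /c; have [|r [w Kw <-] hr] := @sup_adherent _ A n.+1%:R^-1 _ (conj A0 Aub).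
      by rewrite invr_gt0.
    by exists w.
  have [|z Hz] := BC (f := f).
    by exists (nm x) => n; apply: Kb; case: (Hf n).
  have g0 e : 0 < e -> exists N, forall n, (N <= n)%N -> `|(fun=> 0 : R) n| < e.
    by move=> e0; exists 0%N => n _; rewrite normr0.
  exists z; last first.
    apply: (cluster_dist Hz (@invS_small)) => n.
    have [Kn hn] := Hf n; apply: dist_le_of_lt hn (Ac _ _ Ku Kn) => //.
  split.
    apply: (cluster_dist Hz g0) => n; have [[Kn _] hn] := Hf n.
    by rewrite Kn subrr normr0.
  rewrite metric_sym; apply: (cluster_dist Hz g0) => n; have [[_ Kn] hn] := Hf n.
  by rewrite metric_sym Kn subrr normr0.
have /choice[V HV] : forall w, exists w', K w -> K w' /\ d w w' = c.
  move=> w; have [Kw|nKw] := pselect (K w); last by exists w.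
  by have [v' Kv' h] := btw_move Ku Kw Kv0; exists v'; rewrite h.
have /choice[m Hm] : forall w, exists w', btw (1 / 2) w (V w) w'.
  by move=> w; apply: HP; lra.
(* Each point of [W] is midway between the previous one and a candidate farthest from that one. *)
pose W n := iter n m u.
have KW n : K (W n).
  elim: n => //= n IH; apply: btw_mid (Hm _) => //.
  by case: (HV _ IH).
(* A candidate at the maximal distance [c] from a midpoint is, by convexity, at distance [c] from
   both ends. Descending along [W], [V (W j)] is at distance [c] from all earlier [V (W i)]. *)
have HW n m' w : (m' < n)%N -> K w -> d (W n) w = c -> d (V (W m')) w = c.
  elim: n w => // n IH w.
  move=> mn Kw h; have [KV hV] := HV _ (KW n).
  have half : 0 <= (1 / 2 : R) <= 1 by lra.
  have := ptolemaic_convex PT w half (Hm (W n)).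
  have := Ac _ _ Kw (KW n); have := Ac _ _ Kw KV.
  rewrite (metric_sym w (m _)) -/(W n.+1) h => h1 h2 h3.
  have h4 : d (W n) w = c by rewrite metric_sym; lra.
  have h5 : d (V (W n)) w = c by rewrite metric_sym; lra.
  move: mn; rewrite ltnS leq_eqVlt => /orP[/eqP ->//|mn]; exact: IH.
have [|i [j [ij hij]]] := @bounded_near (fun n => V (W n)) c c0.
  by exists (nm x) => n; apply: Kb; case: (HV _ (KW n)).
have [KVj hVj] := HV _ (KW j).
by rewrite (HW _ _ _ ij KVj hVj) ltxx in hij.
Qed.

End Uniqueness.
End Homogeneous.

(** * Contraction towards the base point *)

Lemma lipschitz_ivt (R : realType) (f : R -> R) (a b k : R) : a <= b -> 0 < k ->
  (forall s t, a <= s <= b -> a <= t <= b -> `|f s - f t| <= k * `|s - t|) ->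
  f a <= 0 -> 0 <= f b -> exists2 c, a <= c <= b & f c = 0.
Proof.
move=> ab k0 Hf fa fb.
(* Clamping to [[a, b]] turns the Lipschitz bound on the interval into continuity on the whole
   line. *)
pose cl t := Num.max a (Num.min b t).
have clab t : a <= cl t <= b by rewrite /cl le_max lexx ge_max ab ge_min lexx.
have cl_lip (s t : R) : `|cl s - cl t| <= `|s - t|.
  have mx (c u v : R) : `|Num.max c u - Num.max c v| <= `|u - v|.
    by rewrite ler_norml /Num.max; have := ler_norm (u - v);
      have := ler_norm (- (u - v)); rewrite normrN;
      case: (ltP c u) => ?; case: (ltP c v) => ?; move=> *; apply/andP; split; lra.
  have mn (c u v : R) : `|Num.min c u - Num.min c v| <= `|u - v|.
    by rewrite ler_norml /Num.min; have := ler_norm (u - v);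
      have := ler_norm (- (u - v)); rewrite normrN;
      case: (ltP c u) => ?; case: (ltP c v) => ?; move=> *; apply/andP; split; lra.
  exact: le_trans (mx _ _ _) (mn _ _ _).
have cle t : a <= t <= b -> cl t = t.
  by move=> /andP[at_ tb]; rewrite /cl min_r// max_r.
have cg : continuous (f \o cl).
  move=> t; apply/cvgrPdist_lt => e e0.
  near=> u; apply: le_lt_trans (Hf _ _ (clab _) (clab _)) _.
  rewrite -ltr_pdivlMl//; apply: le_lt_trans (cl_lip _ _) _.
  near: u; apply: cvgr_dist_lt; first exact: cvg_id.
  by rewrite mulr_gt0// invr_gt0.
have [||c] := @IVT R (f \o cl) a b 0 ab.
- by apply: continuous_subspaceT.
- rewrite /= !cle ?lexx ?ab//.
  by rewrite ge_min fa/= le_max fb orbT.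
- rewrite in_itv/= => cab; rewrite cle// => fc.
  by exists c.
Unshelve. all: by end_near. Qed.

Section Contraction.
Context {R : realType} {M : metricType R} (p : M).
Implicit Types (x y z u v w : M) (s t a b c e l : R) (q : seq (M * M)).
Local Notation d := (@mdist R M).
Local Notation nm := (@mdist R M p).
Hypotheses (PT : @ptolemaic R M) (HP : @has_points R M).
Hypotheses (BC : bounded_cluster p) (HO : homogeneous p).

Definition contract s x : M := xget p (btw s p x).

Local Notation sc := contract.

Lemma contractP s x : 0 <= s <= 1 -> btw s p x (sc s x).
Proof. by move=> s01; rewrite /sc; case: xgetP => [_ ->//|]; have [u] := HP p x s01 => + /(_ u). Qed.

Lemma nm_contract s x : 0 <= s <= 1 -> nm (sc s x) = s * nm x.
Proof. by move=> /(@contractP s x)[]. Qed.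

Lemma contract_eq s x u : 0 <= s <= 1 -> nm u = s * nm x -> d u x = (1 - s) * nm x ->
  u = sc s x.
Proof.
by move=> s01 h1 h2; apply: (btw_unique PT HP BC HO s01) (contractP x s01).
Qed.

Lemma contract_le s x u : 0 <= s <= 1 -> nm u <= s * nm x -> d u x <= (1 - s) * nm x ->
  u = sc s x.
Proof. by move=> s01 h1 h2; have [] := btw_le h1 h2; exact: contract_eq. Qed.

Lemma contract1 x : sc 1 x = x.
Proof. by apply/esym/contract_eq; rewrite ?lexx ?ler01 ?mul1r// mdistxx subrr mul0r. Qed.

Lemma contract0 x : sc 0 x = p.
Proof. by apply/esym/contract_eq; rewrite ?lexx ?ler01 ?mul0r ?mdistxx// subr0 mul1r. Qed.

Lemma contract_contract a b x : 0 <= a <= 1 -> 0 <= b <= 1 -> sc a (sc b x) = sc (a * b) x.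
Proof.
move=> a01 b01; have [a1 a2] := contractP (sc b x) a01; have [b1 b2] := contractP x b01.
have [/andP[a0 a_1] /andP[b0 b_1]] := (a01, b01).
apply: contract_le.
- by rewrite mulr_ge0//= mulr_ile1.
- by rewrite a1 b1 mulrA.
- by apply: le_trans (metric_triangle _ (sc b x) _) _; rewrite a2 b1 b2; lra.
Qed.

Lemma dist_contract s t x : 0 <= s <= t -> t <= 1 -> d (sc s x) (sc t x) = (t - s) * nm x.
Proof.
move=> /andP[s0 st] t1; have t0 := le_trans s0 st.
move: t0; rewrite le_eqVlt => /orP[/eqP t0|t0].
  have s_0 : s = 0 by apply/eqP; rewrite eq_le s0 t0 st.
  by rewrite -t0 s_0 mdistxx subrr mul0r.
have r01 : 0 <= s / t <= 1 by rewrite divr_ge0 ?(ltW t0)//= ler_pdivrMr// mul1r.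
have t01 : 0 <= t <= 1 by rewrite (ltW t0).
rewrite -[s](@divfK _ t) ?gt_eqF// -contract_contract//.
have [_ ->] := contractP (sc t x) r01; rewrite nm_contract// mulrA; congr (_ * _).
by rewrite mulrBl mul1r.
Qed.

(** The similarity taking [x], [y] to [x'], [y'] extends to [sc s x] and then to [sc t y]. The
    images lie at the same ratios between [p] and [x'], [y'], and uniqueness identifies them. *)
Lemma contract_sim l s t x y x' y' : 0 < l -> 0 <= s <= 1 -> 0 <= t <= 1 ->
  nm x' = l * nm x -> nm y' = l * nm y -> d x' y' = l * d x y ->
  d (sc s x') (sc t y') = l * d (sc s x) (sc t y).
Proof.
move=> l0 s01 t01 hx hy hxy.
have [u [u1 u2 u3]] := ext2 HO (sc s x) l0 hx hy hxy.
have us : u = sc s x'.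
  apply: contract_eq => //; first by rewrite u1 nm_contract// hx; ring.
  by rewrite metric_sym u2 metric_sym (contractP x s01).2 hx; ring.
have [v [v1 v2 v3 v4]] := ext3 HO (sc t y) l0 hx hy u1 hxy u2 u3.
have vs : v = sc t y'.
  apply: contract_eq => //; first by rewrite v1 nm_contract// hy; ring.
  by rewrite metric_sym v3 metric_sym (contractP y t01).2 hy; ring.
by rewrite -us -vs.
Qed.

(** The similarity of ratio [s^-1] that takes [sc s y] to [y] takes [y] to a preimage of [y]. *)
Lemma contract_onto s y : 0 < s <= 1 -> exists2 x, sc s x = y & nm x = nm y / s.
Proof.
move=> /andP[s0 s1]; have s01 : 0 <= s <= 1 by rewrite (ltW s0).
have l0 : 0 < s^-1 by rewrite invr_gt0.
have h : nm y = s^-1 * nm (sc s y) by rewrite nm_contract// mulKf// gt_eqF.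
have [v [v1 v2]] := ext1 HO y l0 h.
exists v; last by rewrite v1 mulrC.
apply/esym/contract_eq => //; first by rewrite v1 mulVKf// gt_eqF.
rewrite v2 (contractP y s01).2 v1; ring.
Qed.

(* Two pairs whose distances cross at some scale have equal distances below it. *)
Lemma contract_mono s x y x' y' : nm x = 1 -> nm y = 1 -> nm x' = 1 -> nm y' = 1 ->
  0 <= s <= 1 -> d x y <= d x' y' -> d (sc s x) (sc s y) <= d (sc s x') (sc s y').
Proof.
move=> x1 y1 x'1 y'1 s01 h; rewrite leNgt; apply/negP => hs.
have [/andP[s0 s1]] := s01.
pose f t := d (sc t x') (sc t y') - d (sc t x) (sc t y).
have lip1 a b u v : nm u = 1 -> nm v = 1 -> 0 <= a <= b -> b <= 1 ->
    `|d (sc a u) (sc a v) - d (sc b u) (sc b v)| <= 2 * (b - a).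
  move=> u1 v1 ab b1.
  have := dist_contract u ab b1; have := dist_contract v ab b1; rewrite u1 v1 !mulr1.
  have := metric_triangle (sc a u) (sc b u) (sc a v).
  have := metric_triangle (sc b u) (sc b v) (sc a v).
  have := metric_triangle (sc b u) (sc a u) (sc b v).
  have := metric_triangle (sc a u) (sc a v) (sc b v).
  rewrite (metric_sym (sc b v) (sc a v)) (metric_sym (sc b u) (sc a u)) => h1 h2 h3 h4 h5 h6.
  by rewrite ler_norml; apply/andP; split; lra.
have flip a b : 0 <= a <= b -> b <= 1 -> `|f a - f b| <= 4 * (b - a).
  move=> ab b1; rewrite /f.
  have := lip1 a b _ _ x'1 y'1 ab b1; have := lip1 a b _ _ x1 y1 ab b1.
  rewrite !ler_norml => /andP[h1 h2] /andP[h3 h4]; apply/andP; split; lra.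
(* At a scale [c] where the two distances agree, a partial isometry matches the two pairs, and it
   still matches them after contracting from [c] down to [s]. *)
have [||||c /andP[sc_ c1] fc] := @lipschitz_ivt R f s 1 4 s1.
- by [].
- move=> a b /andP[sa a1] /andP[sb b1].
  have [ab|/ltW ba] := leP a b.
    by rewrite (distrC a) (@ger0_norm _ (b - a)) ?subr_ge0//; apply: flip => //; rewrite (le_trans s0 sa).
  by rewrite (distrC (f a)) (@ger0_norm _ (a - b)) ?subr_ge0//; apply: flip => //; rewrite (le_trans s0 sb).
- by rewrite /f; lra.
- by rewrite /f !contract1; lra.
have s_0 : 0 < s.
  rewrite lt_neqAle s0 andbT; apply/negP => /eqP s00.
  by move: hs; rewrite -s00 !contract0 ltxx.
have c0 : 0 < c := lt_le_trans s_0 sc_.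
have c01 : 0 <= c <= 1 by rewrite (ltW c0).
have r01 : 0 <= s / c <= 1 by rewrite divr_ge0 ?(ltW c0)//= ler_pdivrMr// mul1r.
have E z : sc s z = sc (s / c) (sc c z) by rewrite contract_contract// divfK// gt_eqF.
have := @contract_sim 1 (s / c) (s / c) (sc c x) (sc c y) (sc c x') (sc c y') ltr01 r01 r01.
rewrite !nm_contract// x1 y1 x'1 y'1 !mul1r -!E => H.
by move: hs; rewrite H ?ltxx//; move: fc; rewrite /f; lra.
Qed.

End Contraction.

(** * Packing numbers and the homothety law on the unit sphere *)

Section Packing.
Context {R : realType} {M : metricType R} (p : M).
Implicit Types (x y z u v w : M) (s a b c e l : R) (q : seq (M * M)) (t : seq M).
Local Notation d := (@mdist R M).
Local Notation nm := (@mdist R M p).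
Hypotheses (PT : @ptolemaic R M) (HP : @has_points R M).
Hypotheses (BC : bounded_cluster p) (HO : homogeneous p).
Local Notation sc := (@contract R M p).

Definition separated e t : bool := pairwise (fun u v => e <= d u v) t.

Definition on_sphere t : Prop := forall u, u \in t -> nm u = 1.

Lemma separated_in e t x y : separated e t -> x \in t -> y \in t -> x != y -> e <= d x y.
Proof.
elim: t => // a t IH /=; rewrite /separated /= => /andP[/allP h1 h2].
rewrite !inE => /predU1P[->|xt] /predU1P[->|yt] //.
- by rewrite eqxx.
- by move=> _; exact: h1.
- by move=> _; rewrite metric_sym; exact: h1.
- exact: IH.
Qed.

Lemma separated_uniq e t : 0 < e -> separated e t -> uniq t.
Proof.
move=> e0; rewrite uniq_pairwise; apply: sub_pairwise => x y /= exy.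
by rewrite -mdist_gt0; apply: lt_le_trans exy.
Qed.

Lemma separated_map e e' (g : M -> M) t :
  (forall u v, u \in t -> v \in t -> e <= d u v -> e' <= d (g u) (g v)) ->
  separated e t -> separated e' (map g t).
Proof.
move=> H; rewrite /separated pairwise_map.
apply: (@sub_in_pairwise _ (mem t)); last by apply/allP => u.
by move=> u v ut vt; apply: H.
Qed.

(** Finitely many strict inequalities leave a common margin. *)
Lemma pairwise_gap a t : pairwise (fun u v => a < d u v) t ->
  exists2 e, a < e & separated e t.
Proof.
have gap1 x t' : all (fun v => a < d x v) t' -> exists2 e, a < e & all (fun v => e <= d x v) t'.
  elim: t' => [_|v t' IH /= /andP[av /IH[e ae He]]]; first by exists (a + 1); rewrite ?ltrDl.
  exists (Num.min e (d x v)); first by rewrite lt_min ae av.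
  rewrite ge_min lexx orbT /=; apply: sub_all He => w /=; apply: le_trans; rewrite ge_min lexx ?orbT//.
elim: t => [_|x t IH]; first by exists (a + 1); rewrite ?ltrDl.
move=> /= /andP[/gap1[e ae He] /IH[e' ae' He']].
exists (Num.min e e'); first by rewrite lt_min ae ae'.
rewrite /separated /=; apply/andP; split.
  by apply: sub_all He => w /=; apply: le_trans; rewrite ge_min lexx ?orbT//.
by apply: sub_pairwise He' => u v /=; apply: le_trans; rewrite ge_min lexx orbT//.
Qed.

Lemma max_size (P : seq M -> Prop) N : P [::] -> (forall t, P t -> (size t <= N)%N) ->
  exists2 t, P t & forall t', P t' -> (size t' <= size t)%N.
Proof.
move=> P0 PN; pose Q n := `[< exists2 t, P t & size t = n >].
have Q0 : exists n, Q n by exists 0%N; apply/asboolP; exists [::].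
have QN n : Q n -> (n <= N)%N by move=> /asboolP[t /PN + <-].
case: (ex_maxnP Q0 QN) => n /asboolP[t Pt tn] nmax; exists t => // t' Pt'.
by rewrite tn; apply: nmax; apply/asboolP; exists t'.
Qed.

Lemma finite_net e : 0 < e ->
  exists t, forall x, nm x <= 1 -> exists2 y, y \in t & d x y < e.
Proof.
move=> e0; apply: contrapT => /forallNP H.
have /choice[f Hf] : forall t, exists x, nm x <= 1 /\ forall y, y \in t -> e <= d x y.
  move=> t; have /existsNP[x /not_implyP[x1 Hx]] := H t; exists x; split => // y yt.
  by rewrite leNgt; apply/negP => xy; apply: Hx; exists y.
pose T n := iter n (fun t => f t :: t) [::].
have inT m n : (m < n)%N -> f (T m) \in T n.
  elim: n => // n IH; rewrite ltnS leq_eqVlt => /predU1P[->|mn] /=; rewrite inE.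
    by rewrite eqxx.
  by rewrite IH// orbT.
have [|m [n [mn]]] := @bounded_near _ _ _ BC (fun n => f (T n)) e e0.
  by exists 1 => n; case: (Hf (T n)).
by rewrite metric_sym ltNge (Hf (T n)).2// inT.
Qed.

Lemma separated_bounded e : 0 < e ->
  exists N, forall t, on_sphere t -> separated e t -> (size t <= N)%N.
Proof.
move=> e0; have e2 : 0 < e / 2 by rewrite divr_gt0.
have [t0 Ht0] := finite_net e2.
have /choice[g Hg] : forall x, exists y, nm x <= 1 -> y \in t0 /\ d x y < e / 2.
  move=> x; have [x1|x1] := pselect (nm x <= 1); last by exists x.
  by have [y yt xy] := Ht0 x x1; exists y.
exists (size t0) => t tS tsep; rewrite -(size_map g); apply: uniq_leq_size; last first.
  by move=> _ /mapP[x xt ->]; apply: (Hg x _).1; rewrite tS.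
rewrite map_inj_in_uniq ?(separated_uniq e0)// => x y xt yt gxy.
apply/eqP/negPn/negP => xy; have := separated_in tsep xt yt xy.
have [|_ h1] := Hg x; first by rewrite tS.
have [|_ h2] := Hg y; first by rewrite tS.
have := metric_triangle x (g x) y; rewrite {2}gxy (metric_sym (g y)).
by move=> h3 h4; lra.
Qed.

(** The points of [t] are added one at a time; repeated ones are skipped so that [g] remains a
    function. Its values outside [t] carry no information. *)
Lemma transfer l q t : 0 < l -> (p, p) \in q -> psim l q ->
  exists g : M -> M, psim l ([seq (x, g x) | x <- t] ++ q).
Proof.
move=> l0 pq ql; elim: t => [|x t [g Hg]]; first by exists id.
have [xt|xt] := boolP (x \in t).
  exists g; apply: psim_sub Hg => z /=; rewrite inE => /predU1P[->|//].
  by rewrite mem_cat map_f.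
have [|y Hy] := HO x l0 _ Hg; first by rewrite mem_cat pq orbT.
exists (fun z => if z == x then y else g z); rewrite /= eqxx.
have -> // : [seq (z, if z == x then y else g z) | z <- t] = [seq (z, g z) | z <- t].
by apply/eq_in_map => z zt; case: eqP => // zx; rewrite -zx zt in xt.
Qed.

Lemma transferP l q t : 0 < l -> (p, p) \in q -> psim l q -> exists g : M -> M,
  [/\ forall x, x \in t -> nm (g x) = l * nm x,
      forall x y, x \in t -> y \in t -> d (g x) (g y) = l * d x y
    & forall f x, f \in q -> x \in t -> d f.2 (g x) = l * d f.1 x].
Proof.
move=> l0 pq ql; have [g Hg] := transfer t l0 pq ql; exists g.
have gt x : x \in t -> (x, g x) \in [seq (x, g x) | x <- t] ++ q.
  by move=> xt; rewrite mem_cat (map_f (fun x => (x, g x))).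
split=> [x xt|x y xt yt|f x fq xt].
- by apply: (Hg (p, p) (x, g x)); rewrite ?gt// mem_cat pq orbT.
- exact: (Hg (x, g x) (y, g y) (gt _ xt) (gt _ yt)).
- by apply: (Hg f (x, g x)); rewrite ?gt// mem_cat fq orbT.
Qed.

(** The rescaled contraction as a map into the sphere: a similarity of ratio [s^-1] brings the
    contracted points back to norm 1. *)
Lemma push_out s t : 0 < s <= 1 -> on_sphere t -> exists g : M -> M,
  (forall x, x \in t -> nm (g x) = 1) /\
  (forall x y, x \in t -> y \in t -> d (g x) (g y) = d (sc s x) (sc s y) / s).
Proof.
move=> /andP[s0 s1] tS; have s01 : 0 <= s <= 1 by rewrite (ltW s0).
have si0 : 0 < s^-1 by rewrite invr_gt0.
have [|g [g1 g2 _]] := @transferP s^-1 [:: (p, p)] (map (sc s) t) si0 _ (@psim_pp R M p s^-1).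
  by rewrite inE.
exists (g \o sc s); split=> [x xt|x y xt yt] /=.
  by rewrite g1 ?map_f// nm_contract// tS// mulr1 mulVf// gt_eqF.
by rewrite g2 ?map_f// mulrC.
Qed.

(** Opposite to [push_out]: a similarity shrinks the list to norm [s], and preimages under the
    contraction bring it back to the sphere. *)
Lemma lift_in s t : 0 < s <= 1 -> on_sphere t -> exists g : M -> M,
  (forall x, x \in t -> nm (g x) = 1) /\
  (forall x y, x \in t -> y \in t -> d (sc s (g x)) (sc s (g y)) = s * d x y).
Proof.
move=> s01 tS; have /andP[s0 s1] := s01.
have [|g [g1 g2 _]] := @transferP s [:: (p, p)] t s0 _ (@psim_pp R M p s).
  by rewrite inE.
have /choice[h Hh] : forall y, exists x, sc s x = y /\ nm x = nm y / s.
  by move=> y; have [x] := contract_onto PT HP BC HO y s01; exists x.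
exists (h \o g); split=> [x xt|x y xt yt] /=.
  by rewrite (Hh _).2 g1// tS// mulr1 divff// gt_eqF.
by rewrite !(Hh _).1 g2.
Qed.

(** [e] is the supremum of the separations of [K]-point subsets of the sphere. If a pair at distance
    at least [e] were contracted below [e * s], then lifting a nearly optimal [K]-point set would,
    by monotonicity, give a set separated by more than [e]. *)
Lemma pushed_scale s eta x0 y0 : 0 < s <= 1 -> 0 < eta -> nm x0 = 1 -> nm y0 = 1 ->
  eta <= d x0 y0 -> exists e, [/\ 0 < e,
    forall x y, nm x = 1 -> nm y = 1 -> e <= d x y -> e * s <= d (sc s x) (sc s y) &
    forall x y, nm x = 1 -> nm y = 1 -> eta <= d x y -> e <= d x y].
Proof.
move=> s01 eta0 x01 y01 h0; have /andP[s0 s1] := s01.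
have s01' : 0 <= s <= 1 by rewrite (ltW s0).
have [N HN] := separated_bounded eta0.
have [||tm [tmS tmsep] tmax] := @max_size (fun t => on_sphere t /\ separated eta t) N.
- by split.
- by move=> t [tS tsep]; exact: HN.
have k2 : (2 <= size tm)%N.
  apply: (tmax [:: x0; y0]); split; last by rewrite /separated /= h0.
  by move=> u; rewrite !inE => /orP[] /eqP ->.
(* Take one point more than an [eta]-separated set can have: then a set of [K] points is at most
   [eta]-separated. If the sphere has no such number of points, [K] counts the whole sphere, and any
   two distinct points belong to the separated set. *)
have [K [K2 [tK [tKS tKu tKs]] Keta]] : exists K, [/\ (2 <= K)%N,
    exists t, [/\ on_sphere t, uniq t & size t = K] &
    forall e t x y, 0 < e -> on_sphere t -> separated e t -> size t = K ->
      nm x = 1 -> nm y = 1 -> eta <= d x y -> e <= d x y].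
  have [[t [tS tu ts]]|no] := pselect (exists t, [/\ on_sphere t, uniq t & size t = (size tm).+1]).
    exists (size tm).+1; split; [by rewrite ltnW|by exists t|].
    move=> e t' x y e0 t'S t'sep t's x1 y1; apply: le_trans.
    rewrite leNgt; apply/negP => etae.
    have := tmax t'; rewrite t's ltnn => H; suff : false by [].
    apply: H; split => //.
    by apply: sub_pairwise t'sep => u v; apply: le_trans; exact: ltW.
  exists (size tm); split => //; first by exists tm; split => //; exact: separated_uniq tmsep.
  move=> e t x y e0 tS tsep ts x1 y1 xy.
  have inx z : nm z = 1 -> z \in t.
    move=> z1; apply: contrapT => /negP zt; apply: no; exists (z :: t); split.
    - by move=> u; rewrite inE => /predU1P[->//|]; exact: tS.
    - by rewrite /= zt (separated_uniq e0).
    - by rewrite /= ts.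
  apply: (separated_in tsep); rewrite ?inx//.
  by rewrite -mdist_gt0; apply: lt_le_trans xy.
pose A := [set e | 0 < e /\ exists t, [/\ on_sphere t, separated e t & size t = K]].
have A0 : A !=set0.
  have [|e e0 He] := @pairwise_gap 0 tK; last by exists e; split => //; exists tK.
  by rewrite uniq_pairwise in tKu; apply: sub_pairwise tKu => u v /=; rewrite mdist_gt0.
have Aub : has_ubound A.
  exists 2 => e [e0 [t [tS tsep ts]]].
  case: t tS tsep ts => [|x [|y t]] tS tsep ts; [by move: K2; rewrite -ts..|].
  move: tsep; rewrite /separated /= => /andP[/andP[h _] _]; apply: le_trans h _.
  apply: le_trans (metric_triangle x p y) _.
  by rewrite (metric_sym x) !tS ?inE ?eqxx ?orbT//; lra.
exists (sup A); split.
- have [e Ae] := A0; apply: lt_le_trans Ae.1 _.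
  exact: (ub_le_sup Aub).
- move=> x y x1 y1 Exy; rewrite leNgt; apply/negP; rewrite -ltr_pdivrMr// => h.
  have [|e [e0 [t [tS tsep ts]]]] := @sup_adherent _ A (sup A - d (sc s x) (sc s y) / s) _ (conj A0 Aub).
    by rewrite subr_gt0.
  rewrite subKr => he.
  have [g [g1 g2]] := lift_in s01 tS.
  have [|e' e'0 He'] := @pairwise_gap (d x y) (map g t).
    rewrite pairwise_map; apply: (@sub_in_pairwise _ (mem t)) tsep; last by apply/allP => u.
    move=> u v ut vt /= euv; rewrite ltNge; apply/negP => guv.
    have := contract_mono PT HP BC HO (g1 _ ut) (g1 _ vt) x1 y1 s01' guv.
    rewrite g2// leNgt => /negP; apply.
    move: he; rewrite ltr_pdivrMr// => he; apply: lt_le_trans he _.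
    by rewrite mulrC ler_pM2l.
  have : A e'.
    split; first by apply: le_lt_trans e'0; exact: mdist_ge0.
    exists (map g t); split => //; last by rewrite size_map.
    by move=> _ /mapP[u ut ->]; exact: g1.
  move=> /(ub_le_sup Aub); rewrite leNgt => /negP; apply.
  exact: le_lt_trans e'0.
- move=> x y x1 y1 xy; apply: sup_le_ub => // e [e0 [t [tS tsep ts]]].
  exact: Keta tsep ts _ _ _.
Qed.

(* Contraction to radius [s], rescaled, preserves the packing numbers of the ball (or of
   its complement) around a point of the sphere, hence cannot move its boundary. *)
Lemma no_shift s eta x y (B : R -> Prop) : 0 < s <= 1 -> 0 < eta <= d x y ->
  nm x = 1 -> nm y = 1 ->
  (forall z, nm z = 1 -> z = y \/ B (d x z) -> B (d (sc s x) (sc s z) / s)) ->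
  (forall r, B r -> eta <= `|d x y - r|) -> False.
Proof.
move=> s01 /andP[eta0 etaxy] x1 y1 HB Hsep; have /andP[s0 s1] := s01.
have [e [e0 He1 He2]] := pushed_scale s01 eta0 x1 y1 etaxy.
pose P t := [/\ on_sphere t, separated e t & forall z, z \in t -> B (d x z)].
have [N HN] := separated_bounded e0.
(* [t] is a largest packing of the region [B] around [x]. The point [y] is outside the region, far
   enough to be added to [t], yet the rescaled contraction moves it inside: the image of [y :: t] is
   a larger packing. *)
have [||t [tS tsep tB] tmax] := @max_size P N.
- by split.
- by move=> t [tS tsep _]; exact: HN.
have ytS : on_sphere (y :: t) by move=> u; rewrite inE => /predU1P[->//|]; exact: tS.
have xytS : on_sphere (x :: y :: t) by move=> u; rewrite inE => /predU1P[->//|]; exact: ytS.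
have ytsep : separated e (y :: t).
  rewrite /separated /= -/(separated e t) tsep andbT; apply/allP => z zt.
  apply: (He2 _ _ y1 (tS _ zt)); apply: le_trans (Hsep _ (tB _ zt)) _.
  rewrite ler_norml; apply/andP; split.
    by have := metric_triangle x y z; lra.
  by have := metric_triangle x z y; rewrite (metric_sym z); lra.
have [g [g1 g2]] := push_out s01 xytS.
have xin : x \in x :: y :: t by rewrite inE eqxx.
have sub z : z \in y :: t -> z \in x :: y :: t by move=> zt; rewrite inE zt orbT.
have gx : nm x = 1 * nm (g x) by rewrite mul1r x1 g1.
(* The pushed points are placed around [g x]; a partial isometry taking [g x] to [x] moves them into
   the region around [x]. *)
have [|h [h1 h2 h3]] := @transferP 1 [:: (g x, x); (p, p)] (map g (y :: t)) ltr01 _ (psim1 gx).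
  by rewrite !inE eqxx orbT.
suff /tmax : P (map h (map g (y :: t))) by rewrite !size_map /= ltnn.
split.
- move=> u /mapP[v vgt ->]; rewrite h1// mul1r; case/mapP: vgt => z zt ->.
  by rewrite g1// sub.
- apply: (@separated_map e); first by move=> u v ut vt; rewrite h2// mul1r.
  apply: separated_map ytsep => u v ut vt euv; rewrite g2 ?sub// ler_pdivlMr//.
  by apply: He1; rewrite ?ytS.
- move=> u /mapP[v vgt ->]; have /= := h3 (g x, x) v; rewrite mul1r => ->//; last first.
    by rewrite inE eqxx.
  case/mapP: vgt => z zt ->; rewrite g2// ?sub//; apply: HB; first exact: ytS.
  by move: zt; rewrite inE => /predU1P[->|/tB]; [left|right].
Qed.

Lemma contract_homothety1 s x y : 0 < s <= 1 -> nm x = 1 -> nm y = 1 ->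
  d (sc s x) (sc s y) = s * d x y.
Proof.
move=> s01 x1 y1; have /andP[s0 s1] := s01; have s01' : 0 <= s <= 1 by rewrite (ltW s0).
have [->|xy] := eqVneq x y; first by rewrite !mdistxx mulr0.
have t0 : 0 < d x y by rewrite mdist_gt0.
pose T := d (sc s x) (sc s y) / s.
suff : T = d x y by move=> <-; rewrite /T mulrC divfK// gt_eqF.
apply/eqP/negPn/negP => Tt.
pose eta := Num.min `|d x y - T| (d x y).
have eta0 : 0 < eta <= d x y.
  by rewrite /eta lt_min t0 normr_gt0 subr_eq0 eq_sym Tt/= ge_min lexx orbT.
have mono z z' : nm z = 1 -> nm z' = 1 -> d x z <= d x z' ->
    d (sc s x) (sc s z) / s <= d (sc s x) (sc s z') / s.
  move=> z1 z'1 h; rewrite ler_pM2r ?invr_gt0//.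
  exact: (contract_mono PT HP BC HO x1 z1 x1 z'1).
have etaT : eta <= `|d x y - T| by rewrite /eta ge_min lexx.
(* By monotonicity the rescaled contraction preserves the closed ball of radius [T] around [x],
   respectively the closed outside, and moves [y] onto its boundary. *)
move: Tt; rewrite neq_lt => /orP[Tt|Tt].
- apply: (@no_shift s eta x y (fun r => r <= T) s01 eta0 x1 y1).
    move=> z z1 [->//|h]; apply: mono => //; lra.
  move=> r rT; apply: le_trans etaT _; rewrite !ger0_norm; lra.
- apply: (@no_shift s eta x y (fun r => T <= r) s01 eta0 x1 y1).
    move=> z z1 [->//|h]; apply: mono => //; lra.
  move=> r rT; apply: le_trans etaT _; rewrite !ler0_norm; lra.
Qed.

End Packing.

(** * Rays from the base point and the first bounds for distances between them *)

Section Rays.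
Context {R : realType} {M : metricType R} (p : M).
Implicit Types (x y z u v w : M) (s t a b c e l k r : R).
Local Notation d := (@mdist R M).
Local Notation nm := (@mdist R M p).
Hypotheses (PT : @ptolemaic R M) (HP : @has_points R M).
Hypotheses (BC : bounded_cluster p) (HO : homogeneous p).
Local Notation sc := (@contract R M p).

Lemma nm_eq0 x : nm x = 0 -> x = p.
Proof. by move=> /mdist_positivity. Qed.

Lemma contract_homothety s x y : 0 <= s <= 1 -> nm x = nm y ->
  d (sc s x) (sc s y) = s * d x y.
Proof.
move=> /andP[s0 s1] xy; have s01 : 0 <= s <= 1 by rewrite s0.
move: s0; rewrite le_eqVlt => /orP[/eqP <-|s0].
  by rewrite !(contract0 PT HP BC HO) mdistxx mul0r.
have [x0|x0] := eqVneq (nm x) 0.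
  by rewrite (nm_eq0 x0) (@nm_eq0 y) -?xy// !mdistxx mulr0.
have nx : 0 < nm x by rewrite lt_neqAle eq_sym x0 mdist_ge0.
have l0 : 0 < (nm x)^-1 by rewrite invr_gt0.
have [|x' [x'1 _]] := @ext1 _ _ _ HO _ p p x l0; first by rewrite mdistxx mulr0.
have [y' [y'1 x'y']] := ext1 HO y l0 x'1.
have := contract_sim PT HP BC HO l0 s01 s01 x'1 y'1 x'y'.
rewrite (contract_homothety1 PT HP BC HO) ?s0//; last 2 first.
- by rewrite x'1 mulVf.
- by rewrite y'1 -xy mulVf.
rewrite x'y' => h; apply: (@mulfI _ (nm x)^-1); first by rewrite gt_eqF.
by rewrite -h; ring.
Qed.

(* Geodesics from [p] do not branch. *)
Lemma contract_inj s x y : 0 < s <= 1 -> nm x = nm y -> sc s x = sc s y -> x = y.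
Proof.
move=> /andP[s0 s1] xy h; apply: mdist_positivity; apply/eqP.
have := contract_homothety (s := s) _ xy; rewrite h mdistxx (ltW s0) s1 => /(_ isT) /esym/eqP.
by rewrite mulf_eq0 gt_eqF.
Qed.

(* The point at distance [r] from [p] on the ray through the unit vector [x]. *)
Definition ray x r : M := xget p [set v | nm v = r /\ d x v = `|1 - r|].

Section UnitRay.
Variable x : M.
Hypothesis x1 : nm x = 1.

Lemma invr_itv01 r : 1 < r -> 0 < r^-1 <= 1.
Proof. by move=> r1; have r0 := lt_trans ltr01 r1; rewrite invr_gt0 r0 invf_le1// ltW. Qed.

Lemma contract_inv r v : 1 < r -> nm v = r -> d x v = `|1 - r| -> x = sc r^-1 v.
Proof.
move=> r1 h1 h2; have /andP[ri0 ri1] := invr_itv01 r1.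
have rn0 : r != 0 by rewrite gt_eqF// (lt_trans ltr01).
apply: contract_eq => //; first by rewrite (ltW ri0).
  by rewrite h1 mulVf.
by rewrite h2 h1 ler0_norm; [rewrite mulrBl mul1r mulVf// opprB|rewrite subr_le0 ltW].
Qed.

Lemma rayP r : 0 <= r -> nm (ray x r) = r /\ d x (ray x r) = `|1 - r|.
Proof.
move=> r0; rewrite /ray; case: xgetP => [v _ //|].
have [r1|r1] := leP r 1.
  have r01 : 0 <= r <= 1 by rewrite r0.
  have [h1 h2] := contractP p HP x r01.
  move=> /(_ (sc r x)) [] /=; rewrite h1 x1 mulr1; split => //.
  by rewrite metric_sym h2 x1 mulr1 ger0_norm// subr_ge0.
have ri := invr_itv01 r1; have /andP[ri0 ri1] := ri.
have [v v1 v2] := contract_onto PT HP BC HO x ri.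
have rn0 : r != 0 by rewrite gt_eqF// (lt_trans ltr01).
move: v2; rewrite x1 invrK mul1r => v2.
move=> /(_ v) [] /=; split => //; rewrite -{1}v1.
have ri01 : 0 <= r^-1 <= 1 by rewrite (ltW ri0).
have [_ ->] := contractP p HP v ri01.
by rewrite v2 ler0_norm; [rewrite mulrBl mul1r mulVf// opprB|rewrite subr_le0 ltW].
Qed.

Lemma nm_ray r : 0 <= r -> nm (ray x r) = r. Proof. by move/rayP=> []. Qed.

(** Up to radius 1 this is uniqueness of points between. Beyond it, both points contract to [x] by
    the factor [r^-1], and geodesics from [p] do not branch. *)
Lemma ray_eq r v : nm v = r -> d x v = `|1 - r| -> v = ray x r.
Proof.
move=> h1 h2; have r0 : 0 <= r by rewrite -h1 mdist_ge0.
have [g1 g2] := rayP r0; have [r1|r1] := leP r 1.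
  have r01 : 0 <= r <= 1 by rewrite r0.
  have r1' : 0 <= 1 - r by rewrite subr_ge0.
  rewrite (@contract_eq _ _ _ PT HP BC HO r x v)//; last 2 first.
  - by rewrite h1 x1 mulr1.
  - by rewrite metric_sym h2 x1 mulr1 ger0_norm.
  apply/esym/(contract_eq PT HP BC HO) => //; first by rewrite g1 x1 mulr1.
  by rewrite metric_sym g2 x1 mulr1 ger0_norm.
apply: (@contract_inj r^-1); [exact: invr_itv01|by rewrite h1 g1|].
by rewrite -(contract_inv r1 h1 h2) -(contract_inv r1 g1 g2).
Qed.

Lemma ray1 : ray x 1 = x.
Proof. by apply/esym/ray_eq => //; rewrite mdistxx subrr normr0. Qed.

Lemma ray0 : ray x 0 = p.
Proof. by apply: nm_eq0; rewrite nm_ray. Qed.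

Lemma ray_contract r : 0 <= r <= 1 -> sc r x = ray x r.
Proof.
move=> r01; have [h1 h2] := contractP p HP x r01; have /andP[r0 r1] := r01.
apply: ray_eq; first by rewrite h1 x1 mulr1.
by rewrite metric_sym h2 x1 mulr1 ger0_norm// subr_ge0.
Qed.

Lemma contract_ray s a : 0 <= s <= 1 -> 0 <= a -> sc s (ray x a) = ray x (s * a).
Proof.
move=> s01 a0; have /andP[s0 s1] := s01; have [a1|a1] := leP a 1.
  rewrite -(@ray_contract a) ?a0// (contract_contract PT HP BC HO)// ?a0//.
  by rewrite ray_contract// mulr_ge0//= mulr_ile1.
have [ai0 ai1] := andP (invr_itv01 a1); have [h1 h2] := rayP a0.
have xE := contract_inv a1 h1 h2; have an0 : a != 0 by rewrite gt_eqF// (lt_trans ltr01).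
have [sa|sa] := leP (s * a) 1.
  rewrite -(@ray_contract (s * a)) ?mulr_ge0// {2}xE (contract_contract PT HP BC HO) ?mulr_ge0//.
    by rewrite mulfK.
  by rewrite (ltW ai0).
have [g1 g2] := contractP p HP (ray x a) s01.
have [si0 si1] := andP (invr_itv01 sa).
have sn0 : s != 0 by apply: contraTneq sa => ->; rewrite mul0r -leNgt.
apply: ray_eq; first by rewrite g1 h1.
have xE' : x = sc (s * a)^-1 (sc s (ray x a)).
  rewrite (contract_contract PT HP BC HO)// ?(ltW si0)//.
  by rewrite invfM mulrAC mulVf// mul1r.
rewrite {1}xE'.
have si01 : 0 <= (s * a)^-1 <= 1 by rewrite (ltW si0).
have [_ ->] := contractP p HP (sc s (ray x a)) si01.
rewrite g1 h1 ler0_norm; last by rewrite subr_le0 ltW.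
by rewrite mulrBl mul1r mulVf ?opprB// mulf_neq0.
Qed.

Lemma dist_ray a b : 0 <= a -> 0 <= b -> d (ray x a) (ray x b) = `|a - b|.
Proof.
wlog ab : a b / a <= b => [H a0 b0|a0 b0].
  have [ab|/ltW ab] := leP a b; first exact: H.
  by rewrite metric_sym distrC; exact: H.
move: b0; rewrite le_eqVlt => /orP[/eqP b0|b0].
  have -> : a = b by apply/eqP; rewrite eq_le ab -b0 a0.
  by rewrite mdistxx subrr normr0.
have s01 : 0 <= a / b <= 1 by rewrite divr_ge0 ?(ltW b0)//= ler_pdivrMr// mul1r.
rewrite -{1}[a](@divfK _ b) ?gt_eqF// -contract_ray ?(ltW b0)//.
have [_ ->] := contractP p HP (ray x b) s01; rewrite nm_ray ?(ltW b0)//.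
by rewrite ler0_norm ?subr_le0// opprB mulrBl mul1r divfK// gt_eqF.
Qed.

End UnitRay.

Lemma ray_onto v : 0 < nm v -> exists2 x, nm x = 1 & v = ray x (nm v).
Proof.
move=> v0; have [v1|v1] := leP (nm v) 1.
  have v01 : 0 < nm v <= 1 by rewrite v0.
  have [x h1 h2] := contract_onto PT HP BC HO v v01.
  have x1 : nm x = 1 by rewrite h2 divff// gt_eqF.
  by exists x => //; rewrite -ray_contract// v1 ltW.
have [ai0 ai1] := andP (invr_itv01 v1).
have ai01 : 0 <= (nm v)^-1 <= 1 by rewrite (ltW ai0).
have [h1 h2] := contractP p HP v ai01.
have x1 : nm (sc (nm v)^-1 v) = 1 by rewrite h1 mulVf// gt_eqF.
exists (sc (nm v)^-1 v) => //; apply: ray_eq => //; rewrite h2.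
by rewrite mulrBl mul1r mulVf ?gt_eqF// ler0_norm ?opprB// subr_le0 ltW.
Qed.

Section TwoRays.
Variables (x y : M).
Hypotheses (x1 : nm x = 1) (y1 : nm y = 1).

Lemma ray_scale k a b : 0 <= k -> 0 <= a -> 0 <= b ->
  d (ray x (k * a)) (ray y (k * b)) = k * d (ray x a) (ray y b).
Proof.
have H k' a' b' : 0 < k' <= 1 -> 0 <= a' -> 0 <= b' ->
    d (ray x (k' * a')) (ray y (k' * b')) = k' * d (ray x a') (ray y b').
  move=> /andP[k0 k1] a0 b0; have k01 : 0 <= k' <= 1 by rewrite (ltW k0).
  (* Any radius beyond both points would do: they are contractions of the points at radius [c], and
     contractions commute. *)
  pose c := 1 + a' + b'; have c0 : 0 < c by rewrite /c; lra.
  have c0' := ltW c0; have cn0 : c != 0 by rewrite gt_eqF.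
  have a01 : 0 <= a' / c <= 1 by rewrite divr_ge0//= ler_pdivrMr// mul1r /c; lra.
  have b01 : 0 <= b' / c <= 1 by rewrite divr_ge0//= ler_pdivrMr// mul1r /c; lra.
  have E z t : nm z = 1 -> 0 <= t / c <= 1 -> 0 <= t ->
      sc (t / c) (sc k' (ray z c)) = ray z (k' * t) /\ sc (t / c) (ray z c) = ray z t.
    move=> z1 ac t_0; have kc := mulr_ge0 (ltW k0) c0'.
    rewrite (contract_ray z1 k01 c0') (contract_ray z1 ac kc) (contract_ray z1 ac c0').
    by rewrite mulrCA divfK.
  have [xa xa'] := E x a' x1 a01 a0; have [yb yb'] := E y b' y1 b01 b0.
  rewrite -xa -yb -xa' -yb'; apply: (contract_sim PT HP BC HO) => //.
  - by rewrite nm_contract// nm_ray.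
  - by rewrite nm_contract// nm_ray.
  - by rewrite contract_homothety// !nm_ray.
rewrite le_eqVlt => /orP[/eqP <- _ _|k0 a0 b0]; first by rewrite !mul0r !ray0// mdistxx.
have [k1|k1] := leP k 1; first by apply: H => //; rewrite k0.
have [ki0 ki1] := andP (invr_itv01 k1); have kn0 : k != 0 by rewrite gt_eqF.
have := @H k^-1 (k * a) (k * b); rewrite ki0 ki1 !mulr_ge0 ?(ltW k0)// !mulKf// => ->//.
by rewrite mulrA divff// mul1r.
Qed.

Lemma dist_ray_same a : 0 <= a -> d (ray x a) (ray y a) = a * d x y.
Proof. by move=> a0; have := @ray_scale a 1 1 a0 ler01 ler01; rewrite !mulr1 !ray1. Qed.

End TwoRays.

(** Both pairs are contractions of pairs at a common radius [c], which are isometric because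
    distances at equal radii scale. Exchanging [x] and [y] then gives trapezoids with equal
    diagonals. *)
Lemma ray_class x y x' y' a b : nm x = 1 -> nm y = 1 -> nm x' = 1 -> nm y' = 1 ->
  0 <= a -> 0 <= b -> d x y = d x' y' ->
  d (ray x a) (ray y b) = d (ray x' a) (ray y' b).
Proof.
move=> x1 y1 x'1 y'1 a0 b0 h; pose c := 1 + a + b; have c0 : 0 < c by rewrite /c; lra.
have c0' := ltW c0; have cn0 : c != 0 by rewrite gt_eqF.
have a01 : 0 <= a / c <= 1 by rewrite divr_ge0//= ler_pdivrMr// mul1r /c; lra.
have b01 : 0 <= b / c <= 1 by rewrite divr_ge0//= ler_pdivrMr// mul1r /c; lra.
have E z t : nm z = 1 -> 0 <= t / c <= 1 -> ray z t = sc (t / c) (ray z c).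
  by move=> z1 tc; rewrite contract_ray// divfK.
rewrite !(E _ a)// !(E _ b)//.
rewrite -[RHS]mul1r -[RHS](@contract_sim _ _ _ PT HP BC HO 1 _ _ _ _ (ray x c) (ray y c))//.
- by rewrite !nm_ray// mul1r.
- by rewrite !nm_ray// mul1r.
- by rewrite !dist_ray_same// h mul1r.
Qed.

Lemma ray_swap x y a b : nm x = 1 -> nm y = 1 -> 0 <= a -> 0 <= b ->
  d (ray x a) (ray y b) = d (ray y a) (ray x b).
Proof. by move=> *; apply: ray_class => //; rewrite metric_sym. Qed.

(** Ptolemy's inequality in the trapezoid with legs [|a - b|], parallel sides [a * d x y] and
    [b * d x y], and equal diagonals. *)
Lemma ray_upper x y a b : nm x = 1 -> nm y = 1 -> 0 <= a -> 0 <= b ->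
  d (ray x a) (ray y b) ^+ 2 <= (a - b) ^+ 2 + a * b * d x y ^+ 2.
Proof.
move=> x1 y1 a0 b0; have := PT (ray x b) (ray x a) (ray y b) (ray y a).
rewrite (metric_sym (ray x b) (ray y a)) -(@ray_swap x y a b)//.
rewrite (metric_sym (ray y b) (ray x b)) !dist_ray_same// !dist_ray//.
rewrite (distrC b a) -expr2 -expr2 real_normK ?num_real// => h; apply: le_trans h _.
by rewrite le_eqVlt; apply/orP; left; apply/eqP; ring.
Qed.

Lemma sphere_diam x y : nm x = 1 -> nm y = 1 -> d x y <= 2.
Proof. by move=> x1 y1; have := metric_triangle x p y; rewrite (metric_sym x p) x1 y1; lra. Qed.

(* The upper bound is attained at [t = 1], so convexity provides a tangent line. *)
Lemma ray_lower1 x y t : nm x = 1 -> nm y = 1 -> 0 <= t < 1 ->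
  d x y * (1 + t) / 2 <= d x (ray y t).
Proof.
move=> x1 y1 /andP[t0 t1]; rewrite leNgt; apply/negP => h.
set D := d x y in h *; set E := d x _ in h *.
have E0 : 0 <= E := mdist_ge0 _ _.
have D0 : 0 < D by nra.
pose g := D * (1 + t) / 2 - E; have g0 : 0 < g by rewrite /g subr_gt0.
(* This makes the quadratic term of the upper bound equal to [D * g * k], so that [ray y (1 + k)] is
   within [D + D * k / 2 + k * g / 2] of [x]. Convexity at radii [t], [1], [1 + k] then contradicts
   the gap [g]. *)
pose k := g * D; have k0 : 0 < k by rewrite mulr_gt0.
have k0' : 0 <= 1 + k by lra.
pose tau := (1 - t) / (1 + k - t).
have den : 0 < 1 + k - t by lra.
have tau01 : 0 <= tau <= 1.
  have t1' : 0 <= 1 - t by lra.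
  by rewrite /tau (divr_ge0 t1' (ltW den))/= ler_pdivrMr// mul1r; lra.
have B : btw tau (ray y t) (ray y (1 + k)) y.
  rewrite -{3}(ray1 y1); split; rewrite !dist_ray//.
    rewrite !ler0_norm; [|lra..]; rewrite /tau.
    have -> : - (t - (1 + k)) = 1 + k - t by ring.
    by rewrite divfK ?gt_eqF//; ring.
  rewrite !ler0_norm; [|lra..]; rewrite /tau.
  have -> : - (t - (1 + k)) = 1 + k - t by ring.
  by rewrite mulrBl divfK ?gt_eqF// mul1r; ring.
have C := ptolemaic_convex PT x tau01 B; rewrite -/D -/E in C.
have F : d x (ray y (1 + k)) <= D + D * k / 2 + k * g / 2.
  have U := @ray_upper x y 1 (1 + k) x1 y1 ler01 k0'; rewrite ray1// -/D in U.
  rewrite -(@ler_pXn2r _ 2) ?nnegrE ?mdist_ge0//; last by nra.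
  apply: le_trans U _; rewrite -/k.
  have kE : k = g * D by [].
  rewrite -subr_ge0; have -> : (D + D * k / 2 + k * g / 2) ^+ 2 -
    ((1 - (1 + k)) ^+ 2 + 1 * (1 + k) * D ^+ 2) = D * g * k - k ^+ 2 + (D * k / 2 + k * g / 2) ^+ 2.
    by field.
  by rewrite (mulrC D g) -kE -expr2 subrr add0r sqr_ge0.
have C' : D * (1 + k - t) <= k * E + (1 - t) * d x (ray y (1 + k)).
  rewrite -ler_pdivlMr//; apply: le_trans C _.
  rewrite le_eqVlt; apply/orP; left; apply/eqP; rewrite /tau; field.
  by rewrite gt_eqF.
have : k * g <= k * ((1 - t) * g / 2).
  have L : (1 - t) * d x (ray y (1 + k)) <= (1 - t) * (D + D * k / 2 + k * g / 2).
    by apply: ler_wpM2l => //; rewrite subr_ge0 ltW.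
  have -> : k * g = k * (D * (1 + t) / 2 - E) by [].
  move: C' L; move: (d x (ray y (1 + k))) => F'; clearbody k g => C' L; lra.
rewrite ler_pM2l// => G; clearbody g; nra.
Qed.

Lemma ray_lower x y a b : nm x = 1 -> nm y = 1 -> 0 <= a -> 0 <= b ->
  d x y * (a + b) / 2 <= d (ray x a) (ray y b).
Proof.
move=> x1 y1.
have H z w a' b' : nm z = 1 -> nm w = 1 -> 0 <= b' < a' ->
    d z w * (a' + b') / 2 <= d (ray z a') (ray w b').
  move=> z1 w1 /andP[b0 ba]; have a0 : 0 < a' by lra.
  have an0 : a' != 0 by rewrite gt_eqF.
  have -> : d (ray z a') (ray w b') = d z (ray w (b' / a')) * a'.
    have := ray_scale z1 w1 (ltW a0) ler01 (divr_ge0 b0 (ltW a0)).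
    by rewrite mulr1 mulrC divfK// (ray1 z1) mulrC.
  have := @ray_lower1 z w (b' / a') z1 w1.
  rewrite divr_ge0 ?(ltW a0)//= ltr_pdivrMr// mul1r ba => /(_ isT) h.
  apply: le_trans (ler_wpM2r (ltW a0) h).
  by rewrite le_eqVlt; apply/orP; left; apply/eqP; field.
move=> a0 b0; have [ab|ba|->] := ltgtP a b.
- by rewrite (metric_sym x) (metric_sym (ray x a)) (addrC a); apply: H => //; rewrite a0.
- by apply: H => //; rewrite b0.
- by rewrite dist_ray_same//; lra.
Qed.

End Rays.

(** * Plane trigonometry in terms of chords *)

Section PlanarDistance.
Context {R : realType}.
Implicit Types (a b c t D u v : R).

(* The distance in the plane between points at distances [a] and [b] from the origin whose
   directions are at chordal distance [D]. *)
Definition planar a b D : R := Num.sqrt ((a - b) ^+ 2 + a * b * D ^+ 2).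

Lemma planar_sqr a b D : 0 <= a -> 0 <= b -> planar a b D ^+ 2 = (a - b) ^+ 2 + a * b * D ^+ 2.
Proof.
move=> a0 b0; rewrite sqr_sqrtr//; apply: addr_ge0; first exact: sqr_ge0.
by apply: mulr_ge0; [exact: mulr_ge0|exact: sqr_ge0].
Qed.

Lemma planar_ge0 a b D : 0 <= planar a b D.
Proof. exact: sqrtr_ge0. Qed.

Lemma planarC a b D : planar a b D = planar b a D.
Proof. by rewrite /planar; congr Num.sqrt; ring. Qed.

Lemma planar_scale k a b D : 0 <= k -> planar (k * a) (k * b) D = k * planar a b D.
Proof.
move=> k0; rewrite /planar.
have -> : (k * a - k * b) ^+ 2 + k * a * (k * b) * D ^+ 2 =
  k ^+ 2 * ((a - b) ^+ 2 + a * b * D ^+ 2) by ring.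
by rewrite sqrtrM ?sqr_ge0// sqrtr_sqr ger0_norm.
Qed.

Lemma minkowski2 u1 u2 v1 v2 :
  Num.sqrt ((u1 + v1) ^+ 2 + (u2 + v2) ^+ 2) <=
  Num.sqrt (u1 ^+ 2 + u2 ^+ 2) + Num.sqrt (v1 ^+ 2 + v2 ^+ 2).
Proof.
have U0 : 0 <= u1 ^+ 2 + u2 ^+ 2 by rewrite addr_ge0 ?sqr_ge0.
have V0 : 0 <= v1 ^+ 2 + v2 ^+ 2 by rewrite addr_ge0 ?sqr_ge0.
rewrite -(@ler_pXn2r _ 2) ?nnegrE ?sqrtr_ge0 ?addr_ge0 ?sqrtr_ge0//.
rewrite sqr_sqrtr ?addr_ge0 ?sqr_ge0// (sqrrD (Num.sqrt _)) !sqr_sqrtr//.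
suff : u1 * v1 + u2 * v2 <= Num.sqrt (u1 ^+ 2 + u2 ^+ 2) * Num.sqrt (v1 ^+ 2 + v2 ^+ 2) by lra.
rewrite -sqrtrM//; apply: le_trans (ler_norm _) _.
rewrite -sqrtr_sqr ler_sqrt ?mulr_ge0//.
rewrite -subr_ge0; have -> : (u1 ^+ 2 + u2 ^+ 2) * (v1 ^+ 2 + v2 ^+ 2) - (u1 * v1 + u2 * v2) ^+ 2
  = (u1 * v2 - u2 * v1) ^+ 2 by ring.
exact: sqr_ge0.
Qed.

Lemma planarE a t c s D : c = 1 - D ^+ 2 / 2 -> c ^+ 2 + s ^+ 2 = 1 ->
  planar a t D = Num.sqrt ((a * c - t) ^+ 2 + (a * s) ^+ 2).
Proof.
move=> cE cs; rewrite /planar; congr Num.sqrt.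
have -> : (a * c - t) ^+ 2 + (a * s) ^+ 2 = a ^+ 2 * (c ^+ 2 + s ^+ 2) + t ^+ 2 - 2 * a * t * c by ring.
by rewrite cs cE; field.
Qed.

Lemma chord_cos D : 0 <= D <= 2 -> exists2 s, 0 <= s & (1 - D ^+ 2 / 2) ^+ 2 + s ^+ 2 = 1.
Proof.
move=> /andP[D0 D2]; have H : 0 <= 1 - (1 - D ^+ 2 / 2) ^+ 2.
  have -> : 1 - (1 - D ^+ 2 / 2) ^+ 2 = (D ^+ 2 / 4) * ((2 - D) * (2 + D)) by field.
  by rewrite !mulr_ge0 ?sqr_ge0//; lra.
exists (Num.sqrt (1 - (1 - D ^+ 2 / 2) ^+ 2)); first exact: sqrtr_ge0.
by rewrite sqr_sqrtr// addrC subrK.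
Qed.

(** The hypothesis covers only unit outer radii. With the middle ray on the axis, [D1] and [D2]
    become angles with cosines [c1] and [c2]. If together they exceed a half turn, the right-hand
    side is at least [a + b]. Otherwise a suitable [t'] shows that the angle of [D3] is at most
    their sum, and Minkowski's inequality gives all radii. *)
Lemma planar_triangle a t b D1 D2 D3 : 0 <= a -> 0 <= t -> 0 <= b ->
  0 <= D1 <= 2 -> 0 <= D2 <= 2 -> 0 <= D3 <= 2 ->
  (forall t', 0 <= t' -> D3 <= planar 1 t' D1 + planar t' 1 D2) ->
  planar a b D3 <= planar a t D1 + planar t b D2.
Proof.
move=> a0 t0 b0 D1b D2b D3b H.
have [s1 s10 cs1] := chord_cos D1b; have [s2 s20 cs2] := chord_cos D2b.
set c1 := 1 - _ in cs1; set c2 := 1 - _ in cs2.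
pose c3 := 1 - D3 ^+ 2 / 2.
have P1 a' t' : planar a' t' D1 = Num.sqrt ((a' * c1 - t') ^+ 2 + (a' * s1) ^+ 2).
  by apply: planarE.
have P2 a' t' : planar t' a' D2 = Num.sqrt ((t' - a' * c2) ^+ 2 + (a' * s2) ^+ 2).
  by rewrite planarC (@planarE _ _ c2 s2)//; congr (Num.sqrt (_ + _)); ring.
have P3 : planar a b D3 = Num.sqrt (a ^+ 2 + b ^+ 2 - 2 * a * b * c3).
  by rewrite /planar; congr Num.sqrt; rewrite /c3; field.
have [c12|c12] := leP 0 (c1 + c2); last first.
  have h1 : a - t * c1 <= planar a t D1.
    rewrite P1; apply: le_trans (ler_norm _) _; rewrite -sqrtr_sqr ler_sqrt; last first.
      by rewrite addr_ge0 ?sqr_ge0.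
    rewrite -subr_ge0; have -> : (a * c1 - t) ^+ 2 + (a * s1) ^+ 2 - (a - t * c1) ^+ 2 =
      a ^+ 2 * (c1 ^+ 2 + s1 ^+ 2) - a ^+ 2 + t ^+ 2 * (1 - c1 ^+ 2) by ring.
    rewrite cs1 mulr1 subrr add0r mulr_ge0 ?sqr_ge0//.
    by rewrite -cs1 addrC addKr sqr_ge0.
  have h2 : b - t * c2 <= planar t b D2.
    rewrite P2; apply: le_trans (ler_norm _) _; rewrite -sqrtr_sqr ler_sqrt; last first.
      by rewrite addr_ge0 ?sqr_ge0.
    rewrite -subr_ge0; have -> : (t - b * c2) ^+ 2 + (b * s2) ^+ 2 - (b - t * c2) ^+ 2 =
      b ^+ 2 * (c2 ^+ 2 + s2 ^+ 2) - b ^+ 2 + t ^+ 2 * (1 - c2 ^+ 2) by ring.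
    rewrite cs2 mulr1 subrr add0r mulr_ge0 ?sqr_ge0//.
    by rewrite -cs2 addrC addKr sqr_ge0.
  apply: le_trans (lerD h1 h2).
  have : t * (c1 + c2) <= 0 by rewrite mulr_ge0_le0// ltW.
  move=> h3; apply: (@le_trans _ _ (a + b)); last by lra.
  rewrite -(@ler_pXn2r _ 2) ?nnegrE ?planar_ge0 ?addr_ge0// planar_sqr//.
  have : D3 ^+ 2 <= 2 ^+ 2 by have /andP[? ?] := D3b; rewrite ler_pXn2r ?nnegrE//; lra.
  by have := mulr_ge0 a0 b0; nra.
have s1_le : c1 ^+ 2 <= 1 by rewrite -cs1 lerDl sqr_ge0.
have s2_le : c2 ^+ 2 <= 1 by rewrite -cs2 lerDl sqr_ge0.
have c3_ge : c1 * c2 - s1 * s2 <= c3.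
  have [s12|s12] := eqVneq (s1 + s2) 0.
    have s1_0 : s1 = 0 by lra.
    have s2_0 : s2 = 0 by lra.
    have := H 1 ler01; rewrite P1 P2 s1_0 s2_0 !mul1r !expr0n/= !addr0 !sqrtr_sqr.
    have c1_1 : c1 ^+ 2 = 1 by rewrite -cs1 s1_0 expr0n addr0.
    have c2_1 : c2 ^+ 2 = 1 by rewrite -cs2 s2_0 expr0n addr0.
    have : (c1 - 1) * (c1 + 1) = 0 by rewrite -subr_sqr_1 c1_1 subrr.
    have : (c2 - 1) * (c2 + 1) = 0 by rewrite -subr_sqr_1 c2_1 subrr.
    move=> /eqP; rewrite mulf_eq0 subr_eq0 addr_eq0 => /orP[] /eqP e2;
    move=> /eqP; rewrite mulf_eq0 subr_eq0 addr_eq0 => /orP[] /eqP e1; rewrite e1 e2.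
    - rewrite !subrr normr0 addr0 => D30; have -> : c3 = 1; last by lra.
      by rewrite /c3 (_ : D3 = 0) ?expr0n ?mul0r ?subr0//; have /andP[] := D3b; lra.
    - by move=> _; rewrite /c3; have /andP[? ?] := D3b; nra.
    - by move=> _; rewrite /c3; have /andP[? ?] := D3b; nra.
    - by move: c12; rewrite e1 e2; lra.
  have s12p : 0 < s1 + s2 by rewrite lt_neqAle eq_sym s12 addr_ge0.
  have num : 0 <= s2 * c1 + s1 * c2.
    have cmp (u u' v v' : R) : 0 <= v -> 0 <= v' -> u ^+ 2 + v ^+ 2 = 1 -> u' ^+ 2 + v' ^+ 2 = 1 ->
        0 <= u -> - u <= u' -> u' <= 0 -> 0 <= v' * u + v * u'.
      move=> v0 v'0 e e' u0 uu' u'0.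
      have vv' : v <= v'.
        rewrite -(@ler_pXn2r _ 2) ?nnegrE//.
        have : u' ^+ 2 <= u ^+ 2 by rewrite -sqrrN ler_pXn2r ?nnegrE//; lra.
        by lra.
      have : 0 <= (v' - v) * u + v * (u + u') by rewrite addr_ge0// mulr_ge0//; lra.
      by lra.
    have [c1p|c1n] := leP 0 c1; last by rewrite addrC; apply: (cmp c2 c1) => //; lra.
    have [c2p|c2n] := leP 0 c2; last by apply: (cmp c1 c2) => //; lra.
    by rewrite addr_ge0// mulr_ge0.
  (* Abscissa of the point where the segment from [(c1, s1)] to [(c2, - s2)] crosses the middle
     axis. *)
  pose t' := (s2 * c1 + s1 * c2) / (s1 + s2).
  have t'0 : 0 <= t' by rewrite divr_ge0// ltW.
  have := H t' t'0; rewrite P1 P2 !mul1r.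
  set Q := (c1 - c2) ^+ 2 + (s1 + s2) ^+ 2.
  have Q0 : 0 <= Q by rewrite addr_ge0 ?sqr_ge0.
  have -> : (c1 - t') ^+ 2 + s1 ^+ 2 = (s1 / (s1 + s2)) ^+ 2 * Q by rewrite /Q /t'; field.
  have -> : (t' - c2) ^+ 2 + s2 ^+ 2 = (s2 / (s1 + s2)) ^+ 2 * Q by rewrite /Q /t'; field.
  rewrite (sqrtrM Q (sqr_ge0 (s1 / _))) (sqrtrM Q (sqr_ge0 (s2 / _))) !sqrtr_sqr.
  rewrite (ger0_norm (divr_ge0 s10 (ltW s12p))) (ger0_norm (divr_ge0 s20 (ltW s12p))).
  rewrite -mulrDl -mulrDl divff// mul1r => D3Q.
  have : D3 ^+ 2 <= Q.
    rewrite -[Q]sqr_sqrtr// ler_pXn2r ?nnegrE ?sqrtr_ge0//; by case/andP: D3b.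
  have -> : Q = (c1 ^+ 2 + s1 ^+ 2) + (c2 ^+ 2 + s2 ^+ 2) - 2 * (c1 * c2 - s1 * s2).
    by rewrite /Q; ring.
  by rewrite cs1 cs2 /c3; lra.
rewrite P3 P1 P2; apply: le_trans (minkowski2 _ _ _ _).
rewrite ler_sqrt ?addr_ge0 ?sqr_ge0//.
have -> : (a * c1 - t + (t - b * c2)) ^+ 2 + (a * s1 + b * s2) ^+ 2 =
  a ^+ 2 * (c1 ^+ 2 + s1 ^+ 2) + b ^+ 2 * (c2 ^+ 2 + s2 ^+ 2) - 2 * a * b * (c1 * c2 - s1 * s2).
  by ring.
rewrite cs1 cs2 !mulr1 lerD2l lerN2; apply: ler_wpM2l => //.
by rewrite mulr_ge0// mulr_ge0//.
Qed.

(** The model points [(0, a)], [(a, 0)], [(0, - b)], [(- b, 0)] are concyclic with both diagonals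
    [a + b], and Ptolemy's equality reads [(a + b) ^+ 2 = 2 * a * b + (a ^+ 2 + b ^+ 2)]. The sides
    [A], [B], [C] exceed the model by terms of order [sg ^+ 2] at most, so [E] falls short of it by
    a relative error of order [sg]. *)
Lemma trapezoid_estimate a b e sg A B C E : 0 <= a -> 0 <= b -> sg = a + b -> 0 < sg < 1 ->
  0 <= e <= a + sg ^+ 2 / 2 -> 0 <= A -> 0 <= B -> 0 <= C -> 0 <= E ->
  A ^+ 2 <= a ^+ 2 + (1 + a) * e ^+ 2 -> B ^+ 2 <= b ^+ 2 + (1 - b) * b ^+ 2 ->
  C ^+ 2 <= b ^+ 2 + (1 - b) * e ^+ 2 -> (a + b) * sg <= A * B + E * C ->
  (1 - 11 * sg) * planar 1 (1 + a) b <= E.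
Proof.
move=> a0 b0 sgE /andP[sg0 sg1] /andP[e0 e1] A0 B0 C0 E0 hA hB hC h.
have asg : a <= sg by lra.
have bsg : b <= sg by lra.
have sg2 : sg ^+ 2 <= sg by rewrite expr2 ler_piMr ?ltW.
have e2 : e ^+ 2 <= (a + sg ^+ 2 / 2) ^+ 2 by rewrite ler_pXn2r ?nnegrE// (le_trans e0).
have sgsq0 : 0 <= sg ^+ 2 := sqr_ge0 _.
have hA' : A ^+ 2 <= 2 * (a + 2 * sg ^+ 2) ^+ 2.
  apply: le_trans hA _.
  have : (1 + a) * e ^+ 2 <= (1 + sg / 2) ^+ 2 * (a + sg ^+ 2 / 2) ^+ 2.
    have q : 1 + a <= (1 + sg / 2) ^+ 2.
      have -> : (1 + sg / 2) ^+ 2 = 1 + sg + sg ^+ 2 / 4 by field.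
      lra.
    have a1 : 0 <= 1 + a by lra.
    exact: (ler_pM a1 (sqr_ge0 _) q e2).
  have : (1 + sg / 2) ^+ 2 * (a + sg ^+ 2 / 2) ^+ 2 <= (a + 2 * sg ^+ 2) ^+ 2.
    rewrite -exprMn ler_pXn2r ?nnegrE//; [|by rewrite mulr_ge0//; lra|lra].
    have -> : (1 + sg / 2) * (a + sg ^+ 2 / 2) = a + sg ^+ 2 / 2 + sg * a / 2 + sg * sg ^+ 2 / 4 by field.
    have : sg * a <= sg ^+ 2 by rewrite expr2 ler_wpM2l// ltW.
    have : sg * sg ^+ 2 <= sg ^+ 2 by rewrite (ler_piMl sgsq0 (ltW sg1)).
    by lra.
  have : a ^+ 2 <= (a + 2 * sg ^+ 2) ^+ 2 by rewrite ler_pXn2r ?nnegrE//; lra.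
  by lra.
have hB' : B ^+ 2 <= 2 * b ^+ 2.
  apply: le_trans hB _; have : 0 <= b * b ^+ 2 by rewrite mulr_ge0 ?sqr_ge0.
  by lra.
have hAB : A * B <= 2 * b * (a + 2 * sg ^+ 2).
  have r0 : 0 <= a + 2 * sg ^+ 2 by lra.
  rewrite -(@ler_pXn2r _ 2) ?nnegrE ?mulr_ge0//.
  have -> : (2 * b * (a + 2 * sg ^+ 2)) ^+ 2 = (2 * (a + 2 * sg ^+ 2) ^+ 2) * (2 * b ^+ 2) by ring.
  by rewrite exprMn; exact: (ler_pM (sqr_ge0 _) (sqr_ge0 _) hA' hB').
pose N := Num.sqrt (a ^+ 2 + b ^+ 2); have N0 : 0 <= N := sqrtr_ge0 _.
have NE : N ^+ 2 = a ^+ 2 + b ^+ 2 by rewrite sqr_sqrtr// addr_ge0 ?sqr_ge0.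
have aN : a <= N.
  by rewrite -(@ler_pXn2r _ 2) ?nnegrE// NE lerDl sqr_ge0.
have hC' : C <= N + sg ^+ 2.
  rewrite -(@ler_pXn2r _ 2) ?nnegrE ?addr_ge0//; apply: le_trans hC _.
  have : (1 - b) * e ^+ 2 <= (a + sg ^+ 2) ^+ 2.
    apply: (@le_trans _ _ (e ^+ 2)); first by rewrite ler_piMl ?sqr_ge0//; lra.
    by apply: le_trans e2 _; rewrite ler_pXn2r ?nnegrE//; lra.
  rewrite !sqrrD NE; have : a * sg ^+ 2 <= N * sg ^+ 2 by rewrite ler_wpM2r.
  by lra.
have hb3 : b * sg ^+ 2 <= sg * sg ^+ 2 by rewrite ler_wpM2r.
have hE : N ^+ 2 - 4 * (sg * sg ^+ 2) <= E * (N + sg ^+ 2).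
  apply: (@le_trans _ _ (E * C)); last by rewrite ler_wpM2l.
  by rewrite NE; move: h; rewrite {1}sgE -sgE; rewrite -expr2 {1}sgE; lra.
have sgN : sg <= 2 * N.
  rewrite -(@ler_pXn2r _ 2) ?nnegrE ?mulr_ge0 ?(ltW sg0)// exprMn NE sgE.
  by have := sqr_ge0 (a - b); have := sqr_ge0 (a + b); lra.
have sg2N : sg ^+ 2 <= 2 * N ^+ 2.
  by rewrite NE sgE; have := sqr_ge0 (a - b); lra.
(* As [sg <= 2 * N] and [sg ^+ 2 <= 2 * N ^+ 2], the error [4 * sg ^+ 3] costs 8 and the summand
   [sg ^+ 2] next to [N] costs 2. Comparing [N] with [planar] costs one more, whence 11. *)
have EN : N * (1 - 10 * sg) <= E.
  have [neg|pos] := leP (1 - 10 * sg) 0.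
    by apply: le_trans E0; rewrite mulr_ge0_le0.
  rewrite leNgt; apply/negP => EN.
  have Np : 0 < N by lra.
  have d0 : 0 < N + sg ^+ 2 by lra.
  have : E * (N + sg ^+ 2) < N * (1 - 10 * sg) * (N + sg ^+ 2) by rewrite ltr_pM2r.
  have h1 : N * sg ^+ 2 <= 2 * (N ^+ 2 * sg).
    have : N * sg * sg <= N * sg * (2 * N) by rewrite (ler_wpM2l (mulr_ge0 N0 (ltW sg0))).
    by lra.
  have h2 : sg * sg ^+ 2 <= 2 * (N ^+ 2 * sg).
    have : sg * sg ^+ 2 <= sg * (2 * N ^+ 2) by rewrite (ler_wpM2l (ltW sg0)).
    by lra.
  have h3 : 0 <= N * sg ^+ 2 * sg by rewrite !mulr_ge0 ?(ltW sg0)//.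
  by lra.
have PN : planar 1 (1 + a) b <= (1 + sg) * N.
  rewrite -(@ler_pXn2r _ 2) ?nnegrE ?planar_ge0 ?mulr_ge0//; last by lra.
  rewrite planar_sqr ?exprMn ?NE//; last by lra.
  have h1 : 0 <= sg * (a ^+ 2 + b ^+ 2) by rewrite mulr_ge0 ?addr_ge0 ?sqr_ge0 ?(ltW sg0).
  have h2 : 0 <= sg ^+ 2 * (a ^+ 2 + b ^+ 2) by rewrite mulr_ge0 ?addr_ge0 ?sqr_ge0.
  have h3 : a * b ^+ 2 <= sg * b ^+ 2 by rewrite ler_wpM2r ?sqr_ge0.
  have h4 : 0 <= sg * a ^+ 2 by rewrite mulr_ge0 ?sqr_ge0 ?(ltW sg0).
  by lra.
have [neg|pos] := leP (1 - 11 * sg) 0.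
  by apply: le_trans E0; rewrite mulr_le0_ge0// planar_ge0.
apply: le_trans (ler_wpM2l (ltW pos) PN) _; apply: le_trans EN.
have : 0 <= sg ^+ 2 * N by rewrite mulr_ge0.
by lra.
Qed.

End PlanarDistance.

(** * The Euclidean cone law *)

Section ConeLaw.
Context {R : realType} {M : metricType R} (p : M).
Implicit Types (x y z u v w : M) (s t a b c e l k r : R).
Local Notation d := (@mdist R M).
Local Notation nm := (@mdist R M p).
Hypotheses (PT : @ptolemaic R M) (HP : @has_points R M).
Hypotheses (BC : bounded_cluster p) (HO : homogeneous p).
Local Notation ray := (@ray R M p).

(** The point after [c i] is placed at ratio [1 / (N - i)] on the way to [w]. This makes the steps
    and the distances to [w] exact, and the triangle inequality then fixes the distances to [v]. *)
Lemma chain v w N : (0 < N)%N -> exists c : nat -> M, [/\ c 0%N = v, c N = w,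
  forall i, (i <= N)%N -> btw (i%:R / N%:R) v w (c i) &
  forall i, (i < N)%N -> d (c i) (c i.+1) = d v w / N%:R].
Proof.
move=> N0; have Nn0 : (N%:R : R) != 0 by rewrite pnatr_eq0 -lt0n.
have Np : (0 : R) < N%:R by rewrite ltr0n.
have /choice[f Hf] : forall q : nat * M, exists y,
    (q.1 < N)%N -> btw ((N - q.1)%:R^-1) q.2 w y.
  move=> [i x] /=; have [iN|iN] := ltnP i N; last by exists x.
  have [|y Hy] := HP x w (t := (N - i)%:R^-1); last by exists y.
  by rewrite invr_ge0 ler0n invf_le1 ?ltr0n ?subn_gt0// ler1n subn_gt0.
pose c := fix c i := if i is j.+1 then f (j, c j) else v.
have cw i : (i <= N)%N -> d (c i) w = (N - i)%:R / N%:R * d v w.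
  elim: i => [_|i IH iN] /=; first by rewrite subn0 divff// mul1r.
  have [/= _ ->] := Hf (i, c i) iN; rewrite IH ?(ltnW iN)// !mulrA; congr (_ / _ * _).
  have Ni : ((N - i)%:R : R) != 0 by rewrite pnatr_eq0 -lt0n subn_gt0.
  by rewrite mulrBl mul1r mulVf// -(subnSK iN) -natr1 addrK.
have cc i : (i < N)%N -> d (c i) (c i.+1) = d v w / N%:R.
  move=> iN; have [/= -> _] := Hf (i, c i) iN; rewrite cw ?(ltnW iN)//.
  have Ni : ((N - i)%:R : R) != 0 by rewrite pnatr_eq0 -lt0n subn_gt0.
  by rewrite !mulrA mulVf// mul1r mulrC.
have vc i : (i <= N)%N -> d v (c i) <= i%:R / N%:R * d v w.
  elim: i => [_|i IH iN] /=; first by rewrite mdistxx !mul0r.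
  apply: le_trans (metric_triangle _ (c i) _) _; rewrite [d (c i) _]cc//.
  apply: le_trans (lerD (IH (ltnW iN)) (lexx _)) _.
  by rewrite -natr1 !mulrDl mul1r (mulrC (d v w)).
have cb i : (i <= N)%N -> btw (i%:R / N%:R) v w (c i).
  move=> iN; apply: btw_le; first exact: vc.
  by rewrite cw// natrB// mulrBl divff.
exists c; split => //.
by apply: mdist_positivity; rewrite cw// subnn !mul0r.
Qed.

Definition dir v : M := xget p [set x | nm x = 1 /\ v = ray x (nm v)].

Lemma dirP v : 0 < nm v -> nm (dir v) = 1 /\ v = ray (dir v) (nm v).
Proof.
move=> /(ray_onto PT HP BC HO)[x x1 vx]; rewrite /dir; case: xgetP => [y _ //|].
by move=> /(_ x) [].
Qed.

Lemma nm_dir v : 0 < nm v -> nm (dir v) = 1. Proof. by move=> /dirP[]. Qed.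

Lemma ray_dir v : 0 < nm v -> ray (dir v) (nm v) = v. Proof. by move=> /dirP[]. Qed.

Lemma dir_ray x a : nm x = 1 -> 0 < a -> dir (ray x a) = x.
Proof.
move=> x1 a0; have na := nm_ray PT HP BC HO x1 (ltW a0).
have v0 : 0 < nm (ray x a) by rewrite na.
have [d1 d2] := dirP v0; apply: mdist_positivity; rewrite na in d2.
have := dist_ray_same PT HP BC HO d1 x1 (ltW a0); rewrite -d2 mdistxx => /esym/eqP.
by rewrite mulf_eq0 gt_eqF//= => /eqP.
Qed.

Lemma dir1 x : nm x = 1 -> dir x = x.
Proof. by move=> x1; rewrite -{1}(ray1 PT HP BC HO x1) dir_ray. Qed.

Lemma dir_lower v w : 0 < nm v -> 0 < nm w ->
  d (dir v) (dir w) * (nm v + nm w) / 2 <= d v w.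
Proof.
move=> v0 w0; have := ray_lower PT HP BC HO (nm_dir v0) (nm_dir w0) (ltW v0) (ltW w0).
by rewrite !ray_dir.
Qed.

Lemma nm_lower v w u : nm v + nm w - (d v u + d u w) <= 2 * nm u.
Proof.
have := metric_triangle p u v; have := metric_triangle p u w.
by rewrite (metric_sym u v); lra.
Qed.

Lemma btw_add t v w u : btw t v w u -> d v u + d u w = d v w.
Proof. by move=> [-> ->]; ring. Qed.

(* Directions of the points of a short segment are almost additive. *)
Lemma three_directions y y' b : nm y = 1 -> nm y' = 1 -> d y y' < 2 -> 0 <= b <= d y y' ->
  exists x, [/\ nm x = 1, d x y = b & d x y' <= d y y' * (1 + d y y' / 2) - b].
Proof.
move=> y1 y'1; set sg := d y y' => sg2 /andP[b0 bsg].
have sg0 : 0 <= sg := mdist_ge0 _ _.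
have dy u : 0 < nm u -> d (dir u) y * (nm u + 1) / 2 <= d y u.
  by move=> u0; have := @dir_lower u y u0; rewrite y1 ltr01 (dir1 y1) (metric_sym u y) => /(_ isT).
have dy' u : 0 < nm u -> d (dir u) y' * (nm u + 1) / 2 <= d u y'.
  by move=> u0; have := @dir_lower u y' u0; rewrite y'1 ltr01 (dir1 y'1) => /(_ isT).
pose K := sg / (1 - sg / 2); have den : 0 < 1 - sg / 2 by lra.
have K0 : 0 <= K by rewrite divr_ge0// ltW.
(* Along a chain from [y] to [y'] norms are at least [1 - sg / 2], so consecutive directions differ
   by at most [K / n.+1]. The first direction at distance at least [b] from [y] overshoots by no
   more than that. *)
have /choice[f Hf] : forall n : nat, exists x,
    [/\ nm x = 1, b <= d x y <= b + K * n.+1%:R^-1 & d x y + d x y' <= sg * (1 + sg / 2)].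
  move=> n; have [c [c0 cN cb cc]] := @chain y y' n.+1 isT.
  have cnm i : (i <= n.+1)%N -> 1 - sg / 2 <= nm (c i).
    by move=> /cb /btw_add cs; have := nm_lower y y' (c i); rewrite cs y1 y'1 -/sg; lra.
  have cpos i : (i <= n.+1)%N -> 0 < nm (c i) by move=> /cnm; exact: lt_le_trans.
  have csum i : (i <= n.+1)%N -> d (dir (c i)) y + d (dir (c i)) y' <= sg * (1 + sg / 2).
    move=> iN; have := dy _ (cpos _ iN); have := dy' _ (cpos _ iN).
    have := btw_add (cb _ iN); have := cnm _ iN; rewrite -/sg.
    set h := nm (c i) => h1 h2 h3 h4.
    set U := d (dir _) y in h4 *; set V := d (dir _) y' in h3 *.
    have U0 : 0 <= U := mdist_ge0 _ _. have V0 : 0 <= V := mdist_ge0 _ _.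
    have : (U + V) * (1 - sg / 4) <= sg.
      have : (U + V) * (1 - sg / 2) <= (U + V) * h by rewrite ler_wpM2l ?addr_ge0.
      by lra.
    have q : sg <= sg * (1 + sg / 2) * (1 - sg / 4).
      rewrite -mulrA ler_peMr//.
      have : 0 <= sg * (2 - sg) by rewrite mulr_ge0//; lra.
      by lra.
    move=> /le_trans /(_ q); rewrite ler_pM2r//; lra.
  have cstep i : (i < n.+1)%N -> d (dir (c i.+1)) y <= d (dir (c i)) y + K * n.+1%:R^-1.
    move=> iN; have := dir_lower (cpos _ (ltnW iN)) (cpos _ iN); rewrite cc// -/sg.
    have h1 := cnm _ (ltnW iN); have h2 := cnm _ iN.
    set D := d (dir _) _ => h3.
    have D0 : 0 <= D := mdist_ge0 _ _.
    have : D * (1 - sg / 2) <= sg / n.+1%:R.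
      apply: le_trans h3; rewrite -mulrA; apply: ler_wpM2l => //; lra.
    rewrite -ler_pdivlMr// mulrAC -/K => h4.
    apply: le_trans (metric_triangle _ (dir (c i)) _) _.
    by rewrite [leLHS]addrC lerD2l (metric_sym (dir (c i.+1))).
  have ex : exists i, (i <= n.+1)%N && (b <= d (dir (c i)) y).
    by exists n.+1; rewrite leqnn cN dir1// metric_sym.
  case: (ex_minnP ex) => i /andP[iN bi] imin.
  exists (dir (c i)); split; [exact: nm_dir (cpos _ iN)| |exact: csum].
  rewrite bi/=; case: i iN bi imin => [|i] iN bi imin.
    by rewrite c0 dir1// mdistxx; apply: addr_ge0 => //; apply: mulr_ge0.
  have bi' : d (dir (c i)) y < b.
    rewrite ltNge; apply/negP => h; have := imin i; rewrite (ltnW iN) h ltnn.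
    by move=> /(_ isT).
  by apply: le_trans (cstep _ iN) _; rewrite lerD2r ltW.
have [|x Hx] := BC (f := f); first by exists 1 => n; have [-> _ _] := Hf n.
have g0 e : 0 < e -> exists N, forall n, (N <= n)%N -> `|(fun=> 0 : R) n| < e.
  by move=> e0; exists 0%N => n _; rewrite normr0.
have gK e : 0 < e -> exists N, forall n, (N <= n)%N -> `|K * n.+1%:R^-1| < e.
  move=> e0; have K1 : 0 < K + 1 by lra.
  have [N HN] := invS_small (divr_gt0 e0 K1).
  exists N => n Nn; have := HN n Nn; rewrite normrM (ger0_norm K0) ltr_pdivlMr//.
  by have := normr_ge0 (n.+1%:R^-1 : R); move: (`|n.+1%:R^-1|) => q q0; nra.
have xy : d x y = b.
  rewrite metric_sym; apply: (cluster_dist Hx gK) => n; have [_ /andP[h1 h2] _] := Hf n.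
  by rewrite metric_sym ger0_norm ?subr_ge0// lerBlDl.
exists x; split => //.
  by apply: (cluster_dist Hx g0) => n; have [-> _ _] := Hf n; rewrite subrr normr0.
apply/ler_addgt0Pr => e e0; have [n _ hn] := Hx _ e0 0%N.
have [_ /andP[h1 h2] h3] := Hf n; have := metric_triangle x (f n) y'.
by rewrite (metric_sym x (f n)); lra.
Qed.

(** By [ray_class] only the distance between [x] and [y] matters, so they can be replaced by a
    direction [z] nearly between [y0] and [y0'], and by [y0]. Then [ray z (1 + a)], [y0'],
    [ray z (1 - b)], [y0] are in the position of [trapezoid_estimate]. *)
Lemma local_lower1 y0 y0' x y a : nm y0 = 1 -> nm y0' = 1 -> nm x = 1 -> nm y = 1 ->
  0 <= a -> 0 < a + d x y < 1 -> d y0 y0' = a + d x y ->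
  (1 - 11 * (a + d x y)) * planar 1 (1 + a) (d x y) <= d (ray x (1 + a)) y.
Proof.
move=> y01 y0'1 x1 y1 a0; set b := d x y; set sg := a + b => sgb sgE.
have b0 : 0 <= b := mdist_ge0 _ _.
have /andP[sg0 sg1] := sgb.
have [|| z [z1 zy zy']] := three_directions y01 y0'1 (b := b).
- by rewrite sgE; lra.
- by rewrite sgE b0 /sg; lra.
have a1 : 0 <= 1 + a by lra.
have b1 : 0 <= 1 - b by rewrite /sg in sg1; lra.
have -> : d (ray x (1 + a)) y = d (ray z (1 + a)) (ray y0 1).
  by rewrite -{1}(ray1 PT HP BC HO y1); apply: (ray_class PT HP BC HO).
have := PT y0' (ray z (1 + a)) (ray z (1 - b)) (ray y0 1).
have U1 := ray_upper PT HP BC HO z1 y0'1 a1 ler01.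
have U2 := ray_upper PT HP BC HO z1 y01 b1 ler01.
have U3 := ray_upper PT HP BC HO z1 y0'1 b1 ler01.
rewrite (dist_ray PT HP BC HO z1 a1 b1).
rewrite !(ray1 PT HP BC HO)// in U1 U2 U3 *.
have -> : 1 + a - (1 - b) = a + b by ring.
rewrite (ger0_norm (addr_ge0 a0 b0)) (metric_sym y0') sgE -/sg => Q.
rewrite zy in U2.
apply: (trapezoid_estimate (e := d z y0') (A := d (ray z (1 + a)) y0')
  (B := d (ray z (1 - b)) y0) (C := d (ray z (1 - b)) y0')) => //.
- rewrite mdist_ge0/=; apply: le_trans zy' _; rewrite sgE /sg; lra.
- exact: mdist_ge0.
- exact: mdist_ge0.
- exact: mdist_ge0.
- exact: mdist_ge0.
- by move: U1; rewrite mulr1; have -> : 1 + a - 1 = a by ring.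
- by move: U2; rewrite mulr1; have -> : (1 - b - 1) ^+ 2 = b ^+ 2 by ring.
- by move: U3; rewrite mulr1; have -> : (1 - b - 1) ^+ 2 = b ^+ 2 by ring.
Qed.

(** Rescaling makes the smaller norm 1, and then [a] and [b] are both at most [d v w / r0], which
    turns 11 into 22. The vectors [x0] and [y0] serve to find two unit vectors at distance exactly
    [a + b], which must therefore not exceed [d x0 y0]. *)
Lemma local_lower x0 y0 r0 v w : nm x0 = 1 -> nm y0 = 1 -> d x0 y0 < 2 ->
  0 < r0 -> r0 <= nm v -> r0 <= nm w ->
  2 * d v w / r0 < 1 -> 2 * d v w / r0 <= d x0 y0 ->
  (1 - 22 * d v w / r0) * planar (nm v) (nm w) (d (dir v) (dir w)) <= d v w.
Proof.
move=> x01 y01 D2 r00; wlog vw : v w / nm v <= nm w.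
  move=> H rv rw; have [vw|/ltW wv] := leP (nm v) (nm w); first exact: H.
  by rewrite (metric_sym v) planarC (metric_sym (dir v)); exact: H.
move=> rv rw e1 eD; have v0 : 0 < nm v by exact: lt_le_trans rv.
have w0 : 0 < nm w by exact: lt_le_trans rw.
have [dv dw] := (nm_dir v0, nm_dir w0).
pose a := nm w / nm v - 1; pose b := d (dir w) (dir v).
have aE : nm w = nm v * (1 + a) by rewrite /a; field; rewrite gt_eqF.
have a0 : 0 <= a by rewrite /a subr_ge0 ler_pdivlMr// mul1r.
have b0 : 0 <= b := mdist_ge0 _ _.
have a1 : 0 <= 1 + a by lra.
pose E := d (ray (dir w) (1 + a)) (dir v).
have vwE : d v w = nm v * E.
  have -> : d v w = d (ray (dir w) (nm v * (1 + a))) (ray (dir v) (nm v * 1)).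
    by rewrite -aE mulr1 !ray_dir// metric_sym.
  by rewrite (ray_scale PT HP BC HO dw dv (ltW v0) a1 ler01) (ray1 PT HP BC HO dv).
have E0 : 0 <= E := mdist_ge0 _ _.
have aEle : a <= E.
  have := metric_triangle p (dir v) (ray (dir w) (1 + a)).
  by rewrite (nm_ray PT HP BC HO dw a1) dv (metric_sym (dir v)) -/E; lra.
have bE : b <= E.
  have := ray_lower PT HP BC HO dw dv a1 ler01.
  rewrite (ray1 PT HP BC HO dv) -/E -/b; have := mulr_ge0 b0 a0; lra.
have Er : E <= d v w / r0.
  by rewrite ler_pdivlMr// vwE mulrC ler_wpM2r.
have Er' : 2 * E <= 2 * d v w / r0 by rewrite -mulrA; lra.
have PE : planar (nm v) (nm w) (d (dir v) (dir w)) = nm v * planar 1 (1 + a) b.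
  by rewrite (metric_sym (dir v)) aE -{1}(mulr1 (nm v)) planar_scale// ltW.
rewrite PE; have P0 : 0 <= planar 1 (1 + a) b := planar_ge0 _ _ _.
suff : (1 - 11 * (a + b)) * planar 1 (1 + a) b <= E.
  move=> h; rewrite {2}vwE mulrCA ler_pM2l//; apply: le_trans h.
  by apply: ler_wpM2r => //; rewrite -mulrA; lra.
have := mulr_ge0 a0 b0; have [sg0|sg0] := leP (a + b) 0.
  have a_0 : a = 0 by lra.
  have b_0 : b = 0 by lra.
  have -> : planar 1 (1 + a) b = 0; last by rewrite mulr0.
  by rewrite a_0 b_0 /planar (addr0 1) subrr !expr0n/= mulr0 addr0 sqrtr0.
move=> _; have [|z [z1 zx zy]] := three_directions x01 y01 (b := a + b) D2.
  by rewrite ltW//=; lra.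
have H := @local_lower1 z x0 (dir w) (dir v) a z1 x01 dw dv a0.
rewrite -/b in H; apply: H => //.
by rewrite sg0; lra.
Qed.

(** [planar_triangle] asks only for unit outer radii; there the true triangle inequality and
    [ray_upper] suffice. *)
Lemma planar_dist_triangle v u w : 0 < nm v -> 0 < nm u -> 0 < nm w ->
  planar (nm v) (nm w) (d (dir v) (dir w)) <=
  planar (nm v) (nm u) (d (dir v) (dir u)) + planar (nm u) (nm w) (d (dir u) (dir w)).
Proof.
move=> v0 u0 w0; have [dv du dw] := And3 (nm_dir v0) (nm_dir u0) (nm_dir w0).
apply: planar_triangle; rewrite ?mdist_ge0 ?(ltW v0) ?(ltW u0) ?(ltW w0)//=.
- exact: sphere_diam dv du.
- exact: sphere_diam du dw.
- exact: sphere_diam dv dw.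
move=> t t0; have ub a b x y : nm x = 1 -> nm y = 1 -> 0 <= a -> 0 <= b ->
    d (ray x a) (ray y b) <= planar a b (d x y).
  move=> x1 y1 a0 b0; rewrite -(@ler_pXn2r _ 2) ?nnegrE ?mdist_ge0 ?planar_ge0//.
  by rewrite planar_sqr//; exact: ray_upper.
have := metric_triangle (dir v) (ray (dir u) t) (dir w).
have := ub 1 t _ _ dv du ler01 t0; have := ub t 1 _ _ du dw t0 ler01.
rewrite !(ray1 PT HP BC HO)//; lra.
Qed.

(** If [L < P], a chain between the two points stays away from [p], so [local_lower] holds for its
    short steps with a uniform error. Adding them up gives [(1 - h / N) * P <= L], which fails for
    large [N]. *)
Theorem cone_law x y a b : nm x = 1 -> nm y = 1 -> 0 <= a -> 0 <= b ->
  d (ray x a) (ray y b) ^+ 2 = (a - b) ^+ 2 + a * b * d x y ^+ 2.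
Proof.
move=> x1 y1 a0 b0; rewrite -planar_sqr//; congr (_ ^+ 2).
set L := d _ _; set P := planar _ _ _; set D := d x y.
have L0 : 0 <= L := mdist_ge0 _ _.
have D0 : 0 <= D := mdist_ge0 _ _.
have LP : L <= P.
  rewrite -(@ler_pXn2r _ 2) ?nnegrE ?planar_ge0//.
  by rewrite planar_sqr//; exact: ray_upper.
apply/eqP; rewrite eq_le LP/= leNgt; apply/negP => {}LP.
have low : D * (a + b) / 2 <= L := ray_lower PT HP BC HO x1 y1 a0 b0.
have D2 : D <= 2 by exact: sphere_diam x1 y1.
have dif : `|a - b| <= L.
  have := metric_triangle p (ray x a) (ray y b); have := metric_triangle p (ray y b) (ray x a).
  rewrite !(nm_ray PT HP BC HO)// (metric_sym (ray y b)) -/L => h1 h2.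
  by rewrite ler_norml; apply/andP; split; lra.
have Dpos : 0 < D.
  rewrite lt_neqAle D0 andbT; apply/negP => /eqP D_0.
  move: LP; rewrite /P /planar -/D -D_0 expr0n/= mulr0 addr0 sqrtr_sqr ltNge => /negP; exact.
have Pab : P <= a + b.
  rewrite -(@ler_pXn2r _ 2) ?nnegrE ?planar_ge0 ?addr_ge0// planar_sqr// -/D.
  have : D ^+ 2 <= 2 ^+ 2 by rewrite ler_pXn2r ?nnegrE.
  by have := mulr_ge0 a0 b0; nra.
have D2' : D < 2.
  rewrite lt_neqAle D2 andbT; apply/negP => /eqP DE.
  by move: low; rewrite DE; lra.
have Pp : 0 < P by lra.
have ap : 0 < a.
  rewrite lt_neqAle a0 andbT; apply/negP => /eqP aE; move: dif LP.
  by rewrite -aE sub0r normrN ger0_norm// /P /planar -aE sub0r !mul0r addr0 sqrtr_sqr normrN ger0_norm//; lra.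
have bp : 0 < b.
  rewrite lt_neqAle b0 andbT; apply/negP => /eqP bE; move: dif LP.
  by rewrite -bE subr0 ger0_norm// /P /planar -bE subr0 mulr0 mul0r addr0 sqrtr_sqr ger0_norm//; lra.
pose r0 := (a + b - L) / 2; have r00 : 0 < r0 by rewrite /r0; lra.
(* With [h = 22 * L / r0], the three summands make [h / N] less than 1, less than [(P - L) / P] and
   at most [D], as soon as [N > K]. *)
pose K := 22 * L / r0 * (1 + P / (P - L) + 1 / D).
have PL : 0 < P - L by lra.
have K0 : 0 <= K.
  have k1 : 0 <= 22 * L / r0 by apply: divr_ge0; [exact: mulr_ge0|exact: ltW].
  have k2 : 0 <= P / (P - L) by apply: divr_ge0; exact: ltW.
  have k3 : 0 <= 1 / D by exact: divr_ge0.
  by rewrite /K mulr_ge0//; lra.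
pose N := (Num.truncn K).+1.
have NK : K < N%:R by exact: truncnS_gt.
have N0 : (0 : R) < N%:R by rewrite ltr0n.
have [c [c0 cN cb cc]] := @chain (ray x a) (ray y b) N isT.
rewrite -/L in cc.
have cnm i : (i <= N)%N -> r0 <= nm (c i).
  move=> /cb /btw_add cs; have := nm_lower (ray x a) (ray y b) (c i); rewrite cs -/L.
  by rewrite !(nm_ray PT HP BC HO)// /r0; lra.
have cpos i : (i <= N)%N -> 0 < nm (c i) by move=> /cnm; exact: lt_le_trans.
pose h := 22 * L / r0; have h0 : 0 <= h by apply: divr_ge0; [exact: mulr_ge0|exact: ltW].
have KE : K = h + h * (P / (P - L)) + h * (1 / D) by rewrite /K -/h; ring.
have hN t : 0 < t -> h * (1 / t) <= K -> h / N%:R <= t.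
  move=> t0 ht; rewrite ler_pdivrMr// mulrC -ler_pdivrMr//.
  by apply: le_trans (ltW NK); rewrite mul1r in ht.
have hP0 : 0 <= h * (P / (P - L)) by apply: mulr_ge0 => //; apply: divr_ge0; exact: ltW.
have hD0 : 0 <= h * (1 / D) by apply: mulr_ge0 => //; exact: divr_ge0.
have hlt1 : h / N%:R < 1 by rewrite ltr_pdivrMr// mul1r; lra.
have hD : h / N%:R <= D by apply: hN => //; lra.
have hPL : h / N%:R * P < P - L.
  have q : h * (P / (P - L)) < N%:R by lra.
  rewrite mulrAC ltr_pdivrMr//; move: q; rewrite mulrA ltr_pdivrMr// => q.
  by rewrite (mulrC (P - L)).
pose pl i := planar (nm (c i)) (nm (c i.+1)) (d (dir (c i)) (dir (c i.+1))).
have step i : (i < N)%N -> (1 - h / N%:R) * pl i <= L / N%:R.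
  move=> iN; have e22 : 22 * (L / N%:R) / r0 = h / N%:R by rewrite /h; ring.
  have e2 : 2 * (L / N%:R) / r0 <= h / N%:R.
    rewrite -e22 ler_pM2r ?invr_gt0//.
    have : 0 <= L / N%:R by rewrite divr_ge0// ltW.
    by move: (L / _) => q; lra.
  have := @local_lower x y r0 (c i) (c i.+1) x1 y1 D2' r00 (cnm _ (ltnW iN)) (cnm _ iN).
  rewrite cc// e22 -/(pl i); apply; first exact: le_lt_trans hlt1.
  exact: le_trans hD.
have tot i : (i <= N)%N ->
    (1 - h / N%:R) * planar a (nm (c i)) (d x (dir (c i))) <= i%:R * (L / N%:R).
  elim: i => [_|i IH iN].
    rewrite c0 dir_ray// mdistxx (nm_ray PT HP BC HO)// /planar subrr !expr0n/= mulr0 addr0.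
    by rewrite sqrtr0 mulr0 mul0r.
  have xa : 0 < nm (ray x a) by rewrite (nm_ray PT HP BC HO).
  have := planar_dist_triangle xa (cpos _ (ltnW iN)) (cpos _ iN).
  rewrite dir_ray// (nm_ray PT HP BC HO)// -/(pl i) => T.
  have h1 : 0 <= 1 - h / N%:R by lra.
  have := ler_wpM2l h1 T; have := IH (ltnW iN); have := step _ iN.
  rewrite -natr1 mulrDr mulrDl mul1r; lra.
have := tot N (leqnn N); rewrite cN dir_ray// (nm_ray PT HP BC HO)// -/P mulrC.
rewrite (mulrC N%:R) divfK ?gt_eqF//.
by move: hPL; move: (h / _) => q; lra.
Qed.

End ConeLaw.

(** * Inner products in the cone and the Bruhat-Tits inequality *)

Lemma sqrt_tangent (R : realType) (a f D : R) : 0 < a -> 0 <= f -> f ^+ 2 = a ^+ 2 + D ->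
  f <= a + D / (2 * a).
Proof.
move=> a0 f0 fE; have -> : D = f ^+ 2 - a ^+ 2 by rewrite fE addrC addKr.
rewrite -subr_ge0.
have -> : a + (f ^+ 2 - a ^+ 2) / (2 * a) - f = (a - f) ^+ 2 / (2 * a) by field; rewrite gt_eqF.
by rewrite divr_ge0 ?sqr_ge0// mulr_ge0// ltW.
Qed.

Section ConeBruhatTits.
Context {R : realType} {M : metricType R} (p : M).
Implicit Types (x y z u v w : M) (s t a b c e l k r : R).
Local Notation d := (@mdist R M).
Local Notation nm := (@mdist R M p).
Hypotheses (PT : @ptolemaic R M) (HP : @has_points R M).
Hypotheses (BC : bounded_cluster p) (HO : homogeneous p).

Definition ip z w : R := (nm z ^+ 2 + nm w ^+ 2 - d z w ^+ 2) / 2.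

Lemma ip_p w : ip p w = 0.
Proof. by rewrite /ip mdistxx; lra. Qed.

Lemma ray_far z w l : 0 < nm z -> 0 <= l ->
  d (ray p (dir p z) (l * nm z)) w ^+ 2 = (l * nm z) ^+ 2 + nm w ^+ 2 - 2 * l * ip z w.
Proof.
move=> z0 l0; have dz := nm_dir PT HP BC HO z0; have lz := mulr_ge0 l0 (ltW z0).
have := mdist_ge0 p w; rewrite le_eqVlt => /orP[/eqP w0|w0].
  rewrite (nm_eq0 (esym w0)) metric_sym (nm_ray PT HP BC HO dz lz).
  by rewrite /ip mdistxx (metric_sym z); ring.
have dw := nm_dir PT HP BC HO w0.
have E1 := cone_law PT HP BC HO dz dw lz (ltW w0).
have E2 := cone_law PT HP BC HO dz dw (ltW z0) (ltW w0).
rewrite (ray_dir PT HP BC HO z0) (ray_dir PT HP BC HO w0) in E2.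
rewrite (ray_dir PT HP BC HO w0) in E1.
by rewrite E1 /ip E2; field.
Qed.

(* The convex functions [d(l z, .) - l |z|] converge to [- ip z . / |z|] as [l] grows. *)
Lemma ip_concave z x y u t : 0 <= t <= 1 -> btw t x y u ->
  (1 - t) * ip z x + t * ip z y <= ip z u.
Proof.
move=> t01 B; have := mdist_ge0 p z; rewrite le_eqVlt => /orP[/eqP z0|z0].
  by rewrite (nm_eq0 (esym z0)) !ip_p !mulr0 addr0.
rewrite leNgt; apply/negP; rewrite -subr_gt0.
pose J : R := (1 - t) * ip z x + t * ip z y.
pose g : R := J - ip z u; rewrite -/J -/g => g0.
pose c := nm z; have c0 : 0 < c by []. have cn0 : c != 0 by rewrite gt_eqF.
pose N0 : R := (1 - t) * nm x ^+ 2 + t * nm y ^+ 2.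
have /andP[t0 t1] := t01.
have N00 : 0 <= N0 by rewrite addr_ge0// mulr_ge0 ?sqr_ge0// subr_ge0.
(* [C] bounds the terms that do not grow with [l]. The choice of [l] gives [l * g = g + C], more
   than they can compensate. *)
pose C : R := N0 + (N0 + 2 * `|J|) ^+ 2 / (4 * c ^+ 2).
have C0 : 0 <= C.
  apply: addr_ge0 => //; apply: divr_ge0; first exact: sqr_ge0.
  by apply: mulr_ge0 => //; exact: sqr_ge0.
pose l : R := 1 + C / g; have l1 : 1 <= l by rewrite lerDl divr_ge0// ltW.
have l0 : 0 < l by lra. have ln0 : l != 0 by rewrite gt_eqF.
pose Z := ray p (dir p z) (l * c); pose A : R := l * c; have A0 : 0 < A by rewrite mulr_gt0.
have F w : d Z w ^+ 2 = A ^+ 2 + (nm w ^+ 2 - 2 * l * ip z w).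
  by rewrite addrA; exact: ray_far (ltW l0).
have fx := sqrt_tangent A0 (mdist_ge0 _ _) (F x).
have fy := sqrt_tangent A0 (mdist_ge0 _ _) (F y).
pose eta : R := N0 - 2 * l * J.
have fu : d Z u <= A + eta / (2 * A).
  apply: le_trans (ptolemaic_convex PT Z t01 B) _.
  have t1' : 0 <= 1 - t by lra.
  apply: le_trans (lerD (ler_wpM2l t1' fx) (ler_wpM2l t0 fy)) _.
  by rewrite le_eqVlt; apply/orP; left; apply/eqP; rewrite /eta /N0 /J; field; rewrite gt_eqF.
have h1 : A ^+ 2 + (nm u ^+ 2 - 2 * l * ip z u) <= (A + eta / (2 * A)) ^+ 2.
  by rewrite -F ler_pXn2r ?nnegrE ?mdist_ge0// (le_trans _ fu)// mdist_ge0.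
have h2 : (A + eta / (2 * A)) ^+ 2 = A ^+ 2 + eta + (N0 / l - 2 * J) ^+ 2 / (4 * c ^+ 2).
  by rewrite /eta /A; field; rewrite ?ln0 ?cn0.
have h3 : (N0 / l - 2 * J) ^+ 2 / (4 * c ^+ 2) <= (N0 + 2 * `|J|) ^+ 2 / (4 * c ^+ 2).
  rewrite ler_pM2r ?invr_gt0 ?mulr_gt0 ?exprn_gt0//.
  have r0 : 0 <= N0 + 2 * `|J| by apply: addr_ge0 => //; exact: mulr_ge0.
  rewrite -[leLHS]real_normK ?num_real// ler_pXn2r ?nnegrE//.
  apply: le_trans (ler_normB _ _) _; rewrite (normrM 2) (@ger0_norm _ 2)// lerD2r.
  by rewrite (ger0_norm (divr_ge0 N00 (ltW l0))) ler_pdivrMr// ler_peMr.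
have h4 : l * g = g + C by rewrite /l mulrDl mul1r divfK// gt_eqF.
have h5 : 2 * l * J - 2 * l * ip z u = 2 * (l * g) by rewrite /g; ring.
have h6 := sqr_ge0 (nm u).
move: h1; rewrite h2 /eta => h1.
have CE : C = N0 + (N0 + 2 * `|J|) ^+ 2 / (4 * c ^+ 2) by [].
rewrite h4 in h5; lra.
Qed.

(* First variation of [d(x, .) + d(., y)] along the ray through [u]. *)
Lemma nm_ip x y u t : 0 < t < 1 -> 0 < d x y -> btw t x y u ->
  nm u ^+ 2 <= (1 - t) * ip u x + t * ip u y.
Proof.
move=> /andP[t0 t1] L0 [xu uy]; pose J : R := (1 - t) * ip u x + t * ip u y; rewrite -/J.
have := mdist_ge0 p u; rewrite le_eqVlt => /orP[/eqP u0|u0].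
  by rewrite -u0 /J (nm_eq0 (esym u0)) !ip_p !mulr0 addr0 expr0n.
set h := nm u; set L := d x y in L0 xu uy.
(* Here [e] is the fraction by which [u] is moved towards [p]; a sufficiently small [e] refutes
   [J < h ^+ 2]. *)
suff H e : 0 < e < 1 -> (2 - e) * h ^+ 2 <= 2 * J.
  rewrite leNgt; apply/negP => hJ.
  have hp : 0 < h ^+ 2 by rewrite exprn_gt0.
  pose e := (h ^+ 2 - J) / (h ^+ 2 + `|J|).
  have den : 0 < h ^+ 2 + `|J| by rewrite ltr_pwDl.
  have e0 : 0 < e by rewrite divr_gt0// subr_gt0.
  have e1 : e <= 1 by rewrite ler_pdivrMr// mul1r lerD2l -normrN ler_norm.
  have e2 : 0 < e / 2 < 1 by lra.
  have := H _ e2; have : e * h ^+ 2 <= h ^+ 2 - J.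
    have : e * h ^+ 2 <= e * (h ^+ 2 + `|J|) by rewrite ler_wpM2l ?(ltW e0)// lerDl.
    by rewrite /e divfK ?gt_eqF.
  by lra.
move=> /andP[e0 e1]; pose l := 1 - e; have l0 : 0 <= l by rewrite /l; lra.
pose U := ray p (dir p u) (l * h).
have F w : d U w ^+ 2 = d u w ^+ 2 + ((l ^+ 2 - 1) * h ^+ 2 - 2 * (l - 1) * ip u w).
  by rewrite ray_far// /ip -/h; field.
have tL : 0 < t * L by rewrite mulr_gt0.
have tL' : 0 < (1 - t) * L by rewrite mulr_gt0// subr_gt0.
have Fx := F x; have Fy := F y; rewrite (metric_sym u x) xu in Fx; rewrite uy in Fy.
have fx := sqrt_tangent tL (mdist_ge0 _ _) Fx.
have fy := sqrt_tangent tL' (mdist_ge0 _ _) Fy.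
have := metric_triangle x U y; rewrite (metric_sym x U) -/L => h1.
have h2 := le_trans h1 (lerD fx fy).
have h3 : 0 <= (t * (1 - t) * L * 2) * (((l ^+ 2 - 1) * h ^+ 2 - 2 * (l - 1) * ip u x) / (2 * (t * L)) +
    ((l ^+ 2 - 1) * h ^+ 2 - 2 * (l - 1) * ip u y) / (2 * ((1 - t) * L))).
  by rewrite !mulr_ge0 ?(ltW t0) ?(ltW L0)//; lra.
have h4 : 0 <= (l ^+ 2 - 1) * h ^+ 2 - 2 * (l - 1) * J.
  apply: le_trans h3 _; rewrite le_eqVlt; apply/orP; left; apply/eqP.
  by rewrite /J; field; rewrite !gt_eqF// subr_gt0.
have h5 : (l ^+ 2 - 1) * h ^+ 2 - 2 * (l - 1) * J = e * (2 * J - (2 - e) * h ^+ 2).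
  by rewrite /l; ring.
by move: h4; rewrite h5 pmulr_rge0// subr_ge0.
Qed.

(** [nm_ip] amounts to the inequality as seen from [p], and [ip_concave] transports it from [p] to
    [z]. *)
Theorem cone_bruhat_tits : @bruhat_tits R M.
Proof.
move=> x y z u t t01 B; have [xu uy] := B.
have := mdist_ge0 x y; rewrite le_eqVlt => /orP[/eqP L0|L0].
  have e1 : x = u by apply: mdist_positivity; rewrite xu -L0 mulr0.
  have e2 : u = y by apply: mdist_positivity; rewrite uy -L0 mulr0.
  by rewrite -e2 e1 mdistxx; lra.
have [t_0|tn0] := eqVneq t 0.
  have -> : u = x by apply/esym/mdist_positivity; rewrite xu t_0 mul0r.
  by rewrite t_0; lra.
have [t_1|tn1] := eqVneq t 1.
  have -> : u = y by apply: mdist_positivity; rewrite uy t_1 subrr mul0r.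
  by rewrite t_1; lra.
have /andP[t0 t1] := t01.
have t01' : 0 < t < 1 by rewrite !lt_neqAle t0 t1 eq_sym tn0 tn1.
have h1 := nm_ip t01' L0 B; have h2 := ip_concave z t01 B.
rewrite /ip (metric_sym u x) xu uy in h1; rewrite /ip in h2.
move: h1 h2; set L := d x y; set a := nm x; set b := nm y; set c := nm z; set h := nm u.
by lra.
Qed.

End ConeBruhatTits.

(** * The Bruhat-Tits inequality, the CAT(0) condition and Ptolemy's inequality *)

Section BruhatTitsCAT0.
Context {R : realType} {M : metricType R}.
Implicit Types (x y z u v w : M) (s t a b c e l k r : R).
Local Notation d := (@mdist R M).

Local Notation edist := (@Defs.edist R).

Lemma edist_sqr (u v : 'rV[R]_2) :
  edist u v ^+ 2 = (u 0 0 - v 0 0) ^+ 2 + (u 0 1 - v 0 1) ^+ 2.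
Proof.
rewrite /Defs.edist sqr_sqrtr; last by apply: sumr_ge0 => i _; exact: sqr_ge0.
by rewrite !big_ord_recl big_ord0 addr0; congr (_ + (u 0 _ - v 0 _) ^+ 2); apply/val_inj.
Qed.

Lemma edist_ge0 (u v : 'rV[R]_2) : 0 <= edist u v. Proof. exact: sqrtr_ge0. Qed.

Lemma edistC (u v : 'rV[R]_2) : edist u v = edist v u.
Proof. by rewrite /Defs.edist; congr Num.sqrt; apply: eq_bigr => i _; ring. Qed.

Lemma edist_stewart (u v w : 'rV[R]_2) l :
  edist w ((1 - l) *: u + l *: v) ^+ 2 =
  (1 - l) * edist w u ^+ 2 + l * edist w v ^+ 2 - l * (1 - l) * edist u v ^+ 2.
Proof. by rewrite !edist_sqr !mxE; ring. Qed.

Lemma edist_segment (u v : 'rV[R]_2) l : 0 <= l ->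
  edist u ((1 - l) *: u + l *: v) = l * edist u v.
Proof.
move=> l0; apply/eqP; rewrite -(@eqrXn2 _ 2)// ?edist_ge0 ?mulr_ge0 ?edist_ge0//.
by apply/eqP; rewrite edist_stewart exprMn !edist_sqr; ring.
Qed.

Lemma geodesic_btw x y (c : R -> M) l : 0 <= l <= 1 -> geodesic x y c ->
  btw l x y (c (l * d x y)).
Proof.
move=> /andP[l0 l1] [c0 c1 H]; have L0 := mdist_ge0 x y.
have i0 : 0 \in `[0, d x y] by rewrite in_itv/= lexx.
have i1 : d x y \in `[0, d x y] by rewrite in_itv/= lexx andbT.
have il : l * d x y \in `[0, d x y] by rewrite in_itv/= mulr_ge0//= ler_piMl.
split.
  by rewrite -{1}c0 H// sub0r normrN ger0_norm// mulr_ge0.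
by rewrite -{2}c1 H// ler0_norm ?opprB ?mulrBl ?mul1r// subr_le0 ler_piMl.
Qed.

(** With [u] itself as observer, the right-hand side of the Bruhat-Tits inequality becomes
    [((s - t) * d x y) ^+ 2]; the other direction is the triangle inequality. *)
Lemma bruhat_tits_segment x y u v s t : @bruhat_tits R M -> 0 <= s <= 1 -> 0 <= t <= 1 ->
  btw s x y u -> btw t x y v -> d u v = `|s - t| * d x y.
Proof.
move=> BT s01 t01 Bu Bv; have := BT _ _ u _ _ t01 Bv.
have [xu uy] := Bu; have [xv vy] := Bv; rewrite (metric_sym u x) xu uy => h.
have L0 := mdist_ge0 x y; apply/eqP; rewrite eq_le; apply/andP; split.
  rewrite -(@ler_pXn2r _ 2) ?nnegrE ?mdist_ge0 ?mulr_ge0//.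
  apply: le_trans h _; rewrite !exprMn real_normK ?num_real//.
  by rewrite le_eqVlt; apply/orP; left; apply/eqP; ring.
have h1 := metric_triangle x u v; have h2 := metric_triangle x v u.
rewrite (metric_sym v u) xu xv in h1 h2.
have [st|ts] := leP s t.
  by rewrite ler0_norm ?subr_le0//; lra.
by rewrite gtr0_norm ?subr_gt0//; lra.
Qed.

(** In the plane the inequality is an equality, Stewart's identity. It is used first with the
    vertices as observers of the point on side [i], then with that point as observer of the point on
    side [j]. *)
Lemma bruhat_tits_CAT0 : @has_points R M -> @bruhat_tits R M -> CAT0 M.
Proof.
move=> HP BT; split=> [x y|v c a gc ca i j s t q q' si tj [[l li qE] qs] [[m mi q'E] q't]].
  have /choice[f Hf] : forall s, exists u, 0 <= s <= 1 -> btw s x y u.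
    move=> s; have [s01|ns] := pselect (0 <= s <= 1); last by exists x.
    by have [u Bu] := HP x y s s01; exists u.
  exists (fun r => f (r / d x y)).
  have := mdist_ge0 x y; rewrite le_eqVlt => /orP[/eqP L0|L0].
    have f0 : f 0 = x.
      have [|h _] := Hf 0; first by rewrite lexx ler01.
      by apply/esym/mdist_positivity; rewrite h mul0r.
    have xy : x = y by apply: mdist_positivity.
    rewrite /geodesic -L0; split; [by rewrite mul0r f0|by rewrite mul0r f0|move=> s t].
    rewrite !in_itv/= => /andP[s0 s1] /andP[t0 t1].
    have -> : s = 0 by apply/eqP; rewrite eq_le s0 s1.
    have -> : t = 0 by apply/eqP; rewrite eq_le t0 t1.
    by rewrite mdistxx subrr normr0.
  have itv r : r \in `[0, d x y] -> 0 <= r / d x y <= 1.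
    rewrite in_itv/= => /andP[r0 r1].
    by rewrite divr_ge0 ?(ltW L0)//= ler_pdivrMr// mul1r.
  split.
  - rewrite mul0r; have [|h _] := Hf 0; first by rewrite lexx ler01.
    by apply/esym/mdist_positivity; rewrite h mul0r.
  - rewrite divff ?gt_eqF//; have [|_ h] := Hf 1; first by rewrite lexx ler01.
    by apply/mdist_positivity; rewrite h subrr mul0r.
  - move=> s t /itv s01 /itv t01.
    rewrite (bruhat_tits_segment BT s01 t01 (Hf _ s01) (Hf _ t01)) -mulrBl normrM.
    by rewrite (gtr0_norm (_ : 0 < (d x y)^-1)) ?invr_gt0// divfK// gt_eqF.
have l01 : 0 <= l <= 1 by move: li; rewrite in_itv.
have m01 : 0 <= m <= 1 by move: mi; rewrite in_itv.
have /andP[l0 l1] := l01; have /andP[m0 m1] := m01.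
have sE : s = l * d (v i) (v (ordS i)) by rewrite -qs qE edist_segment// ca.
have tE : t = m * d (v j) (v (ordS j)) by rewrite -q't q'E edist_segment// ca.
have BP := geodesic_btw l01 (gc i); have BQ := geodesic_btw m01 (gc j).
rewrite -sE in BP; rewrite -tE in BQ.
have H (n : 'I_3) : d (c i s) (v n) ^+ 2 <= edist q (a n) ^+ 2.
  rewrite edistC qE edist_stewart !ca metric_sym.
  exact: BT l01 BP.
rewrite -(@ler_pXn2r _ 2) ?nnegrE ?mdist_ge0 ?edist_ge0//.
apply: le_trans (BT _ _ _ _ _ m01 BQ) _; rewrite q'E edist_stewart !ca.
rewrite lerD2r; apply: lerD; apply: ler_wpM2l => //; lra.
Qed.

Lemma CAT0_has_points : CAT0 M -> @has_points R M.
Proof.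
move=> [G _] x y t t01; have [c gc] := G x y.
by exists (c (t * d x y)); exact: geodesic_btw.
Qed.

Lemma comparison_triangle (A B L : R) : 0 <= A -> 0 <= B -> 0 <= L ->
  A <= L + B -> B <= L + A -> L <= A + B -> exists a0 a1 a2 : 'rV[R]_2,
  [/\ edist a0 a1 = L, edist a0 a2 = A & edist a1 a2 = B].
Proof.
move=> A0 B0 L0 h1 h2 h3.
pose vec (u v : R) : 'rV[R]_2 := \row_(i < 2) if i == 0 then u else v.
have eE (u v u' v' : R) : edist (vec u v) (vec u' v') = Num.sqrt ((u - u') ^+ 2 + (v - v') ^+ 2).
  by rewrite -[LHS]ger0_norm ?edist_ge0// -sqrtr_sqr edist_sqr !mxE.
move: L0; rewrite le_eqVlt => /orP[/eqP L0|L0].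
  exists (vec 0 0), (vec 0 0), (vec A 0); rewrite !eE !subrr !expr0n/= !addr0 sub0r sqrrN.
  by rewrite sqrtr_sqr sqrtr0 ger0_norm//; split => //; lra.
(* Abscissa of the third vertex; the square of its height is nonnegative by Heron's
   factorization. *)
pose al := (A ^+ 2 + L ^+ 2 - B ^+ 2) / (2 * L).
have be0 : 0 <= A ^+ 2 - al ^+ 2.
  have -> : A ^+ 2 - al ^+ 2 =
     ((L + B - A) * (A + B - L)) * ((A + L - B) * (A + B + L)) / (4 * L ^+ 2).
    by rewrite /al; field; rewrite gt_eqF.
  rewrite divr_ge0 ?mulr_ge0 ?sqr_ge0//; lra.
exists (vec 0 0), (vec L 0), (vec al (Num.sqrt (A ^+ 2 - al ^+ 2))); rewrite !eE !sub0r !sqrrN.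
rewrite !sqr_sqrtr// !expr0n/= !addr0 sqrtr_sqr gtr0_norm//.
rewrite addrC subrK sqrtr_sqr ger0_norm//; split => //.
have -> : (L - al) ^+ 2 + (A ^+ 2 - al ^+ 2) = B ^+ 2 by rewrite /al; field; rewrite gt_eqF.
by rewrite sqrtr_sqr ger0_norm.
Qed.

Lemma CAT0_bruhat_tits : CAT0 M -> @bruhat_tits R M.
Proof.
move=> [G C].
have BTg x y z (c : R -> M) l : 0 <= l <= 1 -> geodesic x y c ->
  d z (c (l * d x y)) ^+ 2 <=
    (1 - l) * d z x ^+ 2 + l * d z y ^+ 2 - l * (1 - l) * d x y ^+ 2.
  move=> l01 gc; have [c1 g1] := G y z; have [c2 g2] := G z x.
  have [|||||| a0 [a1 [a2 [e01 e02 e12]]]] := @comparison_triangle (d x z) (d y z) (d x y).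
  - exact: mdist_ge0.
  - exact: mdist_ge0.
  - exact: mdist_ge0.
  - exact: metric_triangle.
  - by rewrite (metric_sym x y) metric_triangle.
  - by rewrite (metric_sym y z) metric_triangle.
  pose v (i : 'I_3) := nth x [:: x; y; z] i.
  pose cc (i : 'I_3) := nth c [:: c; c1; c2] i.
  pose aa (i : 'I_3) := nth a0 [:: a0; a1; a2] i.
  have edistxx (u : 'rV[R]_2) : edist u u = 0.
    by apply/eqP; rewrite -sqrf_eq0 edist_sqr !subrr expr0n addr0.
  have gcc i : geodesic (v i) (v (ordS i)) (cc i).
    by case: i => [[|[|[|//]]]] ?; rewrite /v /cc /=.
  have eaa i j : edist (aa i) (aa j) = d (v i) (v j).
    case: i j => [[|[|[|//]]]] ? [[|[|[|//]]]] ?; rewrite /aa /v /= ?edistxx ?mdistxx//.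
    - by rewrite edistC e01 metric_sym.
    - by rewrite edistC e02 metric_sym.
    - by rewrite edistC e12 metric_sym.
  have /andP[l0 l1] := l01.
  pose q := (1 - l) *: a0 + l *: a1.
  pose i0 : 'I_3 := @Ordinal 3 0 isT; pose i2 : 'I_3 := @Ordinal 3 2 isT.
  (* The vertex [z] enters as the point at parameter 0 of the third side. *)
  have := C v cc aa gcc eaa i0 i2 (l * d x y) 0 q a2.
  have -> : cc i2 0 = z by rewrite /cc /=; case: g2.
  have vi0 : v i0 = x by []. have vi1 : v (ordS i0) = y by [].
  have ai0 : aa i0 = a0 by []. have ai1 : aa (ordS i0) = a1 by [].
  have ci0 : cc i0 = c by []. have ai2 : aa i2 = a2 by [].
  rewrite vi0 vi1 ai0 ai1 ci0 ai2 => H.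
  have {}H : d (c (l * d x y)) z <= edist q a2.
    apply: H.
    - by rewrite in_itv/= mulr_ge0 ?mdist_ge0//= ler_piMl ?mdist_ge0.
    - by rewrite in_itv/= lexx mdist_ge0.
    - split; first by exists l; rewrite // in_itv.
      by rewrite edist_segment// e01.
    - split; last exact: edistxx.
      by exists 0; rewrite ?in_itv/= ?lexx ?ler01// subr0 scale1r scale0r addr0.
  rewrite metric_sym; apply: (@le_trans _ _ (edist q a2 ^+ 2)).
    by rewrite ler_pXn2r ?nnegrE ?mdist_ge0 ?edist_ge0.
  by rewrite edistC edist_stewart (edistC a2) e02 (edistC a2) e12 e01 (metric_sym z x) (metric_sym z y).
move=> x y z u t t01 [xu uy]; have [c gc] := G x y.
(* The observer [u] sees the geodesic point at the same ratio at distance 0, so no other point has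
   this ratio. *)
suff -> : u = c (t * d x y) by exact: BTg.
apply: mdist_positivity; apply/eqP; rewrite -sqrf_eq0 eq_le sqr_ge0 andbT.
apply: le_trans (BTg _ _ u _ _ t01 gc) _; rewrite (metric_sym u x) xu uy.
by rewrite le_eqVlt; apply/orP; left; apply/eqP; ring.
Qed.

(* For the Euclidean comparison quadrilateral to be cyclic, the diagonal [cd] has to divide
   [ab] in the ratio [|ac| |ad| : |bc| |bd|]. *)
Lemma bruhat_tits_ptolemaic : @has_points R M -> @bruhat_tits R M -> @ptolemaic R M.
Proof.
move=> HP BT.
suff H (a b c e : M) : d a b * d c e <= d a c * d b e + d a e * d b c by move=> *; exact: H.
have [->|ac] := eqVneq c a; first by rewrite mdistxx mul0r add0r mulrC (metric_sym b).
have [->|ae] := eqVneq e a; first by rewrite mdistxx mul0r addr0 mulrC (metric_sym b) (metric_sym c).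
have [->|bc] := eqVneq c b; first by rewrite mdistxx mulr0 addr0.
have [->|be] := eqVneq e b; first by rewrite mdistxx mulr0 add0r (metric_sym b).
have := mdist_ge0 a b; rewrite le_eqVlt => /orP[/eqP <-|L0].
  by rewrite mul0r addr_ge0// mulr_ge0 ?mdist_ge0.
have A0 : 0 < d a c by rewrite mdist_gt0 eq_sym.
have A'0 : 0 < d a e by rewrite mdist_gt0 eq_sym.
have B0 : 0 < d b c by rewrite mdist_gt0 eq_sym.
have B'0 : 0 < d b e by rewrite mdist_gt0 eq_sym.
set A := d a c in A0 *; set A' := d a e in A'0 *; set B := d b c in B0 *.
set B' := d b e in B'0 *; set L := d a b in L0 *.
pose W := A * A' + B * B'; have W0 : 0 < W by rewrite addr_gt0 ?mulr_gt0.
have Wn0 : W != 0 by rewrite gt_eqF.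
pose t := A * A' / W; have t01 : 0 <= t <= 1.
  have X0 := ltW (mulr_gt0 A0 A'0); have Y0 := ltW (mulr_gt0 B0 B'0).
  by rewrite /t (divr_ge0 X0 (ltW W0))/= ler_pdivrMr// mul1r /W lerDl.
have [u Bu] := HP a b t t01.
have := BT _ _ c _ _ t01 Bu; have := BT _ _ e _ _ t01 Bu.
rewrite !(metric_sym c) !(metric_sym e) -/A -/A' -/B -/B' -/L.
have := metric_triangle c u e; rewrite (metric_sym c u).
set F := d u c; set G := d u e => h1.
have F0 : 0 <= F := mdist_ge0 _ _. have G0 : 0 <= G := mdist_ge0 _ _.
(* For this ratio [t], the Bruhat-Tits inequality gives [(L * W * F) ^+ 2 <= al * (k - be')] and
   [(L * W * G) ^+ 2 <= be' * (k - al)]. The two bounds by arithmetic means add up to [k]. *)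
pose k := (A * B' + A' * B) * W; pose al := A * B * L ^+ 2; pose be' := A' * B' * L ^+ 2.
have al0 : 0 < al by rewrite !mulr_gt0.
have be0 : 0 < be' by rewrite !mulr_gt0.
have amgm (f x y : R) : 0 <= f -> 0 < x -> f ^+ 2 <= x * (k - y) -> f <= (x + (k - y)) / 2.
  move=> f0 x0 h; have ky : 0 <= k - y by rewrite -(pmulr_rge0 _ x0) (le_trans _ h)// sqr_ge0.
  rewrite -(@ler_pXn2r _ 2) ?nnegrE//; last by lra.
  by apply: le_trans h _; have := sqr_ge0 (x - (k - y)); lra.
move=> hG hF.
have LW0 : 0 <= L * W := ltW (mulr_gt0 L0 W0).
have fk : L * W * F <= (al + (k - be')) / 2.
  apply: amgm => //; first exact: mulr_ge0.
  rewrite exprMn; apply: le_trans (ler_wpM2l (sqr_ge0 _) hF) _.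
  rewrite le_eqVlt; apply/orP; left; apply/eqP; rewrite /al /be' /k /t.
  have -> : 1 - A * A' / W = B * B' / W by rewrite /W; field.
  by rewrite /W; field.
have gk : L * W * G <= (be' + (k - al)) / 2.
  apply: amgm => //; first exact: mulr_ge0.
  rewrite exprMn; apply: le_trans (ler_wpM2l (sqr_ge0 _) hG) _.
  rewrite le_eqVlt; apply/orP; left; apply/eqP; rewrite /al /be' /k /t.
  have -> : 1 - A * A' / W = B * B' / W by rewrite /W; field.
  by rewrite /W; field.
rewrite -(ler_pM2r W0) -/k.
have : L * W * d c e <= L * W * (F + G) by rewrite ler_wpM2l.
by lra.
Qed.

End BruhatTitsCAT0.

(** * Limits of real sequences and diagonal extraction *)

Lemma fmap_ultra (T S : Type) (f : T -> S) (U : set_system T) :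
  UltraFilter U -> UltraFilter (f @ U).
Proof.
move=> UU; have UF : ProperFilter U by exact: ultra_proper.
split; first exact: fmap_proper_filter.
move=> G GF sG; apply/seteqP; split => [A GA|]; last exact: sG.
have [//|UA] := in_ultra_setVsetC (f @^-1` A) UU.
have GF' : Filter G by exact: filter_filter.
have : G (A `&` ~` A) by apply: filterI => //; exact: sG.
by rewrite setICr => G0; case: (@filter_not_empty _ G GF G0).
Qed.

Section RealSequences.
Context {R : realType}.
Implicit Types (u v w : nat -> R) (l m e : R) (k : nat -> nat).

Definition tends u l : Prop :=
  forall e, 0 < e -> exists N, forall n, (N <= n)%N -> `|u n - l| < e.

Lemma tendsP u l : tends u l <-> u n @[n --> \oo] --> l.
Proof.
split=> [H|/cvgrPdist_lt H e e0].
  apply/cvgrPdist_lt => e e0; have [N HN] := H _ e0.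
  by exists N => // n /= Nn; rewrite distrC; exact: HN.
have [N _ HN] := H _ e0; exists N => n Nn.
by rewrite distrC; exact: HN.
Qed.

Lemma tends_cst l : tends (fun=> l) l.
Proof. by apply/tendsP; exact: cvg_cst. Qed.

Lemma tends_unique u l m : tends u l -> tends u m -> l = m.
Proof. by move=> /tendsP h1 /tendsP h2; exact: (cvg_unique _ h1 h2). Qed.

Lemma tendsD u v l m : tends u l -> tends v m -> tends (fun n => u n + v n) (l + m).
Proof. by move=> /tendsP h1 /tendsP h2; apply/tendsP; exact: cvgD. Qed.

Lemma tendsM u v l m : tends u l -> tends v m -> tends (fun n => u n * v n) (l * m).
Proof. by move=> /tendsP h1 /tendsP h2; apply/tendsP; exact: cvgM. Qed.

Lemma tendsB u v l m : tends u l -> tends v m -> tends (fun n => u n - v n) (l - m).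
Proof. by move=> /tendsP h1 /tendsP h2; apply/tendsP; exact: cvgB. Qed.

Lemma tends_eventually u v l N : (forall n, (N <= n)%N -> u n = v n) -> tends u l -> tends v l.
Proof.
move=> uv H e e0; have [N' HN'] := H _ e0; exists (maxn N N') => n.
by rewrite geq_max => /andP[Nn N'n]; rewrite -uv// HN'.
Qed.

Lemma eq_tends u v l : u =1 v -> tends u l -> tends v l.
Proof. by move=> uv; apply: (@tends_eventually _ _ _ 0%N) => n _; exact: uv. Qed.

Lemma incr_ge k : {homo k : m n / (m < n)%N} -> forall n, (n <= k n)%N.
Proof. by move=> kI; elim=> // n IH; apply: leq_ltn_trans IH _; exact: kI. Qed.

Lemma tends_sub u l k : {homo k : m n / (m < n)%N} -> tends u l -> tends (u \o k) l.
Proof.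
move=> kI H e e0; have [N HN] := H _ e0; exists N => n Nn /=.
by apply: HN; apply: leq_trans Nn (incr_ge kI n).
Qed.

Lemma tends_le u v l m N : (forall n, (N <= n)%N -> u n <= v n) ->
  tends u l -> tends v m -> l <= m.
Proof.
move=> uv hu hv; apply/ler_addgt0Pr => e e0; have e2 : 0 < e / 2 by rewrite divr_gt0.
have [N1 H1] := hu _ e2; have [N2 H2] := hv _ e2.
have := H1 (maxn N (maxn N1 N2)); have := H2 (maxn N (maxn N1 N2)).
have := uv (maxn N (maxn N1 N2)); rewrite !leq_max !leqnn !orbT /= => /(_ isT) h.
by move=> /(_ isT) /ltr_distlDr h1 /(_ isT); rewrite distrC => /ltr_distlDr h2; lra.
Qed.

Lemma tends_near u v w l N : (forall n, (N <= n)%N -> `|v n - u n| <= w n) ->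
  tends w 0 -> tends u l -> tends v l.
Proof.
move=> vu hw hu e e0; have e2 : 0 < e / 2 by rewrite divr_gt0.
have [N1 H1] := hw _ e2; have [N2 H2] := hu _ e2.
exists (maxn N (maxn N1 N2)) => n; rewrite !geq_max => /and3P[Nn N1n N2n].
have := H1 n N1n; rewrite subr0 => /(le_lt_trans (ler_norm _)) h1.
have := H2 n N2n; have := vu n Nn; have := ler_normD (v n - u n) (u n - l).
by rewrite addrA subrK => *; lra.
Qed.

Lemma tends_bounded u l : tends u l -> exists B N, forall n, (N <= n)%N -> `|u n| <= B.
Proof.
move=> /(_ 1 ltr01)[N HN]; exists (`|l| + 1), N => n /HN h.
by have := ler_normD (u n - l) l; rewrite subrK => *; lra.
Qed.

Lemma tends_cauchy u : (forall e, 0 < e -> exists N, forall i j, (N <= i)%N -> (N <= j)%N ->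
  `|u i - u j| < e) -> exists l, tends u l.
Proof.
move=> H; suff /cvg_ex[l /tendsP ul] : cvgn u by exists l.
apply/cauchy_cvgP/cauchy_ballP => e e0; have [N HN] := H _ e0.
pose A : set R := [set u n | n in [set n | (N <= n)%N]].
have uA : (u @ \oo) A by exists N => // n /= Nn; exists n.
by exists (A, A) => // -[_ _] [/= [i iN <-] [j jN <-]]; apply: HN.
Qed.

Lemma tends_invS : tends (fun n => n.+1%:R^-1) 0.
Proof. by move=> e e0; have [N HN] := invS_small e0; exists N => n /HN; rewrite subr0. Qed.

Lemma subseq_of (P : nat -> Prop) : (forall N, exists2 n, (N <= n)%N & P n) ->
  exists k, {homo k : m n / (m < n)%N} /\ forall n, P (k n).
Proof.
move=> H; have /choice[f Hf] : forall N, exists n, (N <= n)%N /\ P n.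
  by move=> N; have [n] := H N; exists n.
pose k := fix k n := if n is m.+1 then f (k m).+1 else f 0%N.
exists k; split; last by move=> [|n]; [case: (Hf 0%N)|case: (Hf (k n).+1)].
apply: homo_ltn => [b a c|n]; first exact: ltn_trans.
by case: (Hf (k n).+1).
Qed.

Lemma subseq_of_dep (P : nat -> nat -> Prop) : (forall j N, exists2 n, (N <= n)%N & P j n) ->
  exists k, {homo k : m n / (m < n)%N} /\ forall n, P n (k n).
Proof.
move=> H; have /choice[f Hf] : forall q : nat * nat, exists n, (q.2 <= n)%N /\ P q.1 n.
  by move=> [j N]; have [n] := H j N; exists n.
pose k := fix k n := if n is m.+1 then f (m.+1, (k m).+1) else f (0%N, 0%N).
exists k; split; last by move=> [|n]; [case: (Hf (0%N, 0%N))|case: (Hf (n.+1, (k n).+1))].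
apply: homo_ltn => [b a c|n]; first exact: ltn_trans.
by case: (Hf (n.+1, (k n).+1)).
Qed.

(* Diagonal extraction: an ultrafilter on the indices picks all the limits at once. *)
Lemma extract (f : nat -> nat -> R) :
  (forall j, exists B N, forall n, (N <= n)%N -> `|f j n| <= B) ->
  exists k, {homo k : m n / (m < n)%N} /\ forall j, exists l, tends (f j \o k) l.
Proof.
move=> fB; have [U [UU sU]] := @ultraFilterLemma _ (\oo : set_system nat) _.
have UF : ProperFilter U by exact: ultra_proper.
have UF' : Filter U by exact: filter_filter.
have /choice[l Hl] : forall j, exists l, f j @ U --> l.
  move=> j; have [B [N HB]] := fB j.
  have := @segment_compact R (- B) B; rewrite compact_ultra => /(_ (f j @ U) _)[].
  - exact: fmap_ultra.
  - by apply: sU; exists N => // n /= Nn; rewrite in_itv/= -ler_norml; exact: HB.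
  by move=> l [_ hl]; exists l.
(* The [i]-th index serves the sequences [0] to [i] at once, a finite intersection of members of
   [U]. *)
have [|k [kI Hk]] := @subseq_of_dep
    (fun i n => forall j, (j <= i)%N -> `|f j n - l j| < i.+1%:R^-1).
  move=> i N.
  have : U [set n | (N <= n)%N /\ forall j, (j <= i)%N -> `|f j n - l j| < i.+1%:R^-1].
    apply: filterI; first by apply: sU; exists N.
    suff : forall i', (i' <= i)%N -> U [set n | forall j, (j <= i')%N -> `|f j n - l j| < i.+1%:R^-1].
      exact.
    elim=> [_|i' IH i'i].
      have /cvgrPdist_lt/(_ i.+1%:R^-1) := Hl 0%N.
      rewrite invr_gt0 ltr0n => /(_ isT); apply: filterS => n /= h j.
      by rewrite leqn0 => /eqP ->; rewrite distrC.
    have /cvgrPdist_lt/(_ i.+1%:R^-1) := Hl i'.+1.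
    rewrite invr_gt0 ltr0n => /(_ isT) h; have {}h := @filterI _ U UF' _ _ h (IH (ltnW i'i)).
    apply: (@filterS _ U UF' _ _ _ h) => n /= [h1 h2] j; rewrite leq_eqVlt => /predU1P[->|ji]; last by apply: h2; rewrite -ltnS.
    by rewrite distrC.
  by move=> /filter_ex[n [Nn Pn]]; exists n.
exists k; split => // j; exists (l j) => e e0; have [N HN] := tends_invS e0.
exists (maxn j N) => n; rewrite geq_max => /andP[jn Nn]; apply: lt_trans (Hk n j jn) _.
by have := HN n Nn; rewrite subr0 => /(le_lt_trans (ler_norm _)).
Qed.

End RealSequences.

(** * Self-stable families and their maximal extensions *)

Section StableFamilies.
Context {R : realType} {X : metricType R} (p : X).
Implicit Types (x y z : nat -> X) (k : nat -> nat).
Local Notation d := (@mdist R X).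

Lemma mutually_stableP (r : nat -> R) x y :
  mutually_stable r x y <-> exists l, tends (fun n => d (x n) (y n) / r n) l.
Proof.
split; first by move=> /cvg_ex[l /tendsP ul]; exists l.
by move=> [l /tendsP ul]; apply/cvg_ex; exists l.
Qed.

Lemma mutually_stableC (r : nat -> R) x y : mutually_stable r x y -> mutually_stable r y x.
Proof.
move=> /mutually_stableP[l h]; apply/mutually_stableP; exists l.
by apply: eq_tends h => n; rewrite metric_sym.
Qed.

Lemma mutually_stablexx (r : nat -> R) x : mutually_stable r x x.
Proof.
apply/mutually_stableP; exists 0; apply: eq_tends (tends_cst 0) => n.
by rewrite mdistxx mul0r.
Qed.

Lemma extend_stable (r : normalizing R) (G : set (nat -> X)) : self_stable r G ->
  G (fun=> p) -> exists F : stable_family p r, G `<=` F.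
Proof.
(* Zorn's lemma is applied to the sets added to [G], so that the empty chain has an admissible union
   too. *)
move=> Gs Gp; pose P (A : set (nat -> X)) := self_stable r (G `|` A).
have [|A [PA Amax]] := @Zorn_bigcup _ P.
  move=> C CP Ctot x y [Gx|[A CA Ax]] [Gy|[B CB By]].
  - exact: Gs.
  - by apply: (CP _ CB); [left|right].
  - by apply: (CP _ CA); [right|left].
  - have [AB|BA] := Ctot _ _ CA CB.
      by apply: (CP _ CB); right => //; exact: AB.
    by apply: (CP _ CA); right => //; exact: BA.
have Fmax : maximal_self_stable r (G `|` A).
  split=> // z nz; apply: contrapT => /forall2NP H.
  have zs x : (G `|` A) x -> mutually_stable r x z.
    by move=> Gx; have [//|/contrapT] := H x.
  apply: (Amax (A `|` [set z])).
    split; first by move=> x Ax; left.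
    by move=> /(_ z (or_intror erefl)) Az; apply: nz; right.
  rewrite /P setUA => x y [Gx|->] [Gy|->].
  - exact: PA.
  - exact: zs.
  - by apply: mutually_stableC; exact: zs.
  - exact: mutually_stablexx.
have Fp : (G `|` A) (fun=> p) by left.
by exists (StableFamily Fmax Fp); left.
Qed.

Lemma tends_ptP x : tends (fun n => d (x n) p) 0 <-> x n @[n --> \oo] --> p.
Proof.
split=> [H|/metricType_numDomainType.cvgr_dist_lt H e e0].
  apply/metricType_numDomainType.cvgrPdist_lt => e e0; have [N HN] := H _ e0.
  exists N => // n /= /HN; rewrite subr0 metric_sym; exact: le_lt_trans (ler_norm _).
have [N _ HN] := H _ e0; exists N => n Nn; rewrite subr0 ger0_norm ?mdist_ge0//.
by rewrite metric_sym; exact: HN.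
Qed.

Lemma nseqr_tends (r : normalizing R) : tends r 0.
Proof. by apply/tendsP; exact: nseqr_cvg. Qed.

Definition bounded_by (r : nat -> R) x : Prop :=
  exists B N, forall n, (N <= n)%N -> d (x n) p / r n <= B.

Lemma bounded_by_cvg (r : normalizing R) x : bounded_by r x -> x n @[n --> \oo] --> p.
Proof.
move=> [B [N H]]; apply/tends_ptP.
have h : tends (fun n => r n * B) 0.
  by rewrite -[X in tends _ X](mul0r B); apply: tendsM (nseqr_tends r) (tends_cst B).
apply: (tends_near (N := N) _ h (tends_cst 0)) => n Nn.
rewrite subr0 ger0_norm ?mdist_ge0// mulrC -ler_pdivrMr ?nseqr_gt0//; exact: H.
Qed.

Lemma tends_bounded_by (r : nat -> R) x l : tends (fun n => d (x n) p / r n) l -> bounded_by r x.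
Proof.
move=> /tends_bounded[B [N H]]; exists B, N => n /H; exact: le_trans (ler_norm _).
Qed.

(** Boundedness at scale [r] bounds all pairwise quotients, and one extraction over encoded pairs of
    indices makes them all converge. The constant sequence [p] is put in front of the list. *)
Lemma stable_subsequence (r : normalizing R) (s : nat -> nat -> X) :
  (forall j, bounded_by r (s j)) ->
  exists k (kI : {homo k : m n / (m < n)%N}) (F : stable_family p (subnormalizing r kI)),
    forall j, sfam F (s j \o k).
Proof.
move=> sB.
pose s' j := if j is i.+1 then s i else fun=> p.
have s'B j : bounded_by r (s' j).
  case: j => [|j]; last exact: sB.
  by apply: (tends_bounded_by (l := 0)); apply: eq_tends (tends_cst 0) => n; rewrite mdistxx mul0r.
pose f m n := if choice.unpickle m is Some (i, j) then d (s' i n) (s' j n) / r n else 0.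
have [|k [kI Hk]] := @extract R f.
  move=> m; rewrite /f; case: choice.unpickle => [[i j]|]; last first.
    by exists 0, 0%N => n _; rewrite normr0.
  have [B [N HB]] := s'B i; have [B' [N' HB']] := s'B j.
  exists (B + B'), (maxn N N') => n; rewrite geq_max => /andP[Nn N'n].
  have r0 := nseqr_gt0 r n; rewrite ger0_norm ?divr_ge0 ?mdist_ge0 ?(ltW r0)//.
  apply: le_trans (lerD (HB _ Nn) (HB' _ N'n)); rewrite -mulrDl ler_pM2r ?invr_gt0//.
  by rewrite (metric_sym (s' j n)) metric_triangle.
have [||F GF] := @extend_stable (subnormalizing r kI) [set y | exists j, y = s' j \o k].
- move=> _ _ [i ->] [j ->]; apply/mutually_stableP.
  by have [l] := Hk (choice.pickle (i, j)); rewrite /f choice.pickleK; exists l.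
- by exists 0%N.
exists k, kI, F => j; apply: GF; by exists j.+1.
Qed.

End StableFamilies.

Local Open Scope quotient_scope.

(** * Pretangent spaces through representing sequences *)

Section PretangentSpace.
Context {R : realType} {X : metricType R} {p : X} {r : normalizing R}.
Variable F : stable_family p r.
Local Notation d := (@mdist R X).
Local Notation T := (pretangent F).
Implicit Types (a b c : T).

Definition rep a : nat -> X := val (repr a).

Lemma rep_in a : sfam F (rep a).
Proof. by have := valP (repr a); rewrite inE. Qed.

Lemma mdist_rep a b : tends (fun n => d (rep a n) (rep b n) / r n) (mdist a b).
Proof.
apply/tendsP; have h : d (val (repr a) n) (val (repr b) n) / r n @[n --> \oo] --> sdist (repr a) (repr b).
  exact: sfam_cvg.
exact: h.
Qed.

Lemma class_of x : sfam F x -> exists a, tends (fun n => d (rep a n) (x n) / r n) 0.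
Proof.
move=> Fx; have xF : x \in (F : set (nat -> X)) by rewrite inE.
pose x' : set_type F := SigSub xF; exists (\pi_T x').
have h : d (val (repr (\pi_T x')) n) (val x' n) / r n @[n --> \oo] --> sdist (repr (\pi_T x')) x'.
  exact: sfam_cvg.
by move: h; rewrite repr_pi_sdist => h; apply/tendsP; exact: h.
Qed.

Lemma dist_limit (x y z : nat -> X) l : tends (fun n => d (x n) (y n) / r n) 0 ->
  tends (fun n => d (x n) (z n) / r n) l -> tends (fun n => d (y n) (z n) / r n) l.
Proof.
move=> h0 h; apply: (tends_near (N := 0%N) _ h0 h) => n _; have r0 := nseqr_gt0 r n.
rewrite -mulrBl normrM (gtr0_norm (_ : 0 < (r n)^-1)) ?invr_gt0// ler_pM2r ?invr_gt0//.
rewrite ler_norml; have := metric_triangle (x n) (y n) (z n).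
have := metric_triangle (y n) (x n) (z n); rewrite (metric_sym (y n) (x n)).
by move=> *; apply/andP; split; lra.
Qed.

Lemma origin_ex : exists o : T, tends (fun n => d (rep o n) p / r n) 0.
Proof. exact: (class_of (sfam_pt F)). Qed.

Definition origin : T := projT1 (cid origin_ex).

Lemma originP : tends (fun n => d (rep origin n) p / r n) 0.
Proof. exact: (projT2 (cid origin_ex)). Qed.

Lemma mdist_origin a : tends (fun n => d (rep a n) p / r n) (mdist origin a).
Proof.
apply: (@eq_tends _ (fun n => d p (rep a n) / r n)); first by move=> n; rewrite metric_sym.
exact: dist_limit originP (mdist_rep _ _).
Qed.

Lemma rep_bounded a : bounded_by p r (rep a).
Proof. exact: tends_bounded_by (mdist_origin a). Qed.

Lemma dense_sequence : separable T -> exists q : nat -> T, forall a e, 0 < e ->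
  exists i, mdist a (q i) < e.
Proof.
move=> [A /countable_injP[f finj] Ad].
have /choice[q Hq] : forall n, exists b, forall a, A a -> f a = n -> b = a.
  move=> n; have [[b [Ab fb]]|no] := pselect (exists b, A b /\ f b = n).
    by exists b => a Aa fa; apply: finj; rewrite ?inE// fa.
  by exists origin => a Aa fa; exfalso; apply: no; exists a.
exists q => a e e0; have [||b [/interior_subset ab Ab]] := Ad (interior (ball a e)).
- by exists a; exact: nbhsx_ballx.
- exact: open_interior.
exists (f b); rewrite (Hq _ _ Ab erefl).
by move: ab; rewrite ballEmdist.
Qed.

End PretangentSpace.

(** Repeated halving reaches a ratio within [2 ^- n] of any [s]; a cluster point has the ratio [s]
    itself. *)
Lemma midpoints_has_points (R : realType) (M : metricType R) (p : M) :
  bounded_cluster p -> (forall x y : M, exists m, btw (1 / 2) x y m) -> @has_points R M.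
Proof.
move=> BC MID; have approx (x y : M) n (s : R) : 0 <= s <= 1 ->
    exists a u, [/\ `|a - s| <= (2 ^+ n)^-1, 0 <= a <= 1 & btw a x y u].
  elim: n x y s => [|n IH] x y s /andP[s0 s1].
    exists 0, x; rewrite expr0 invr1 sub0r normrN ger0_norm//; split => //.
      by rewrite lexx ler01.
    by split; rewrite ?mdistxx ?mul0r// subr0 mul1r.
  have pn : (2 ^+ n.+1)^-1 = (2 ^+ n)^-1 / 2 :> R by rewrite exprS invfM mulrC.
  have [sh|sh] := leP s (1 / 2).
    have [|a [u [h1 /andP[a0 a1] [xu uy]]]] := IH x y (2 * s); first lra.
    have [m [xm mu]] := MID x u; exists (a / 2), m; rewrite pn; split; last 1 first.
    - apply: btw_le; first by rewrite xm xu; lra.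
      by apply: le_trans (metric_triangle _ u _) _; rewrite mu uy xu; lra.
    - have -> : a / 2 - s = (a - 2 * s) / 2 by field.
      by rewrite normrM (@ger0_norm _ 2^-1)// ler_pM2r.
    - by lra.
  have [|a [u [h1 /andP[a0 a1] [xu uy]]]] := IH x y (2 * s - 1); first lra.
  have [m [um my]] := MID u y; exists ((1 + a) / 2), m; rewrite pn; split; last 1 first.
  - apply: btw_le; last by rewrite my uy; lra.
    by apply: le_trans (metric_triangle _ u _) _; rewrite um uy xu; lra.
  - have -> : (1 + a) / 2 - s = (a - (2 * s - 1)) / 2 by field.
    by rewrite normrM (@ger0_norm _ 2^-1)// ler_pM2r.
  - by lra.
move=> x y s s01; pose L := mdist x y.
have L0 : 0 <= L := mdist_ge0 _ _.
have /choice[f Hf] : forall n, exists u,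
    `|mdist x u - s * L| <= L * (2 ^+ n)^-1 /\ `|mdist y u - (1 - s) * L| <= L * (2 ^+ n)^-1.
  move=> n; have [a [u [h1 a01 [xu uy]]]] := approx x y n s s01.
  exists u; rewrite (metric_sym y) xu uy -/L -!mulrBl !normrM !(ger0_norm L0).
  have -> : 1 - a - (1 - s) = - (a - s) by ring.
  by rewrite normrN !(mulrC _ L) !ler_wpM2l.
have g0 e : 0 < e -> exists N, forall n, (N <= n)%N -> `|L * (2 ^+ n)^-1| < e.
  move=> e0; have e1 : 0 < e / (L + 1) by rewrite divr_gt0//; lra.
  have [N HN] := invS_small e1; exists N => n /HN h.
  rewrite ger0_norm ?mulr_ge0 ?invr_ge0 ?exprn_ge0//.
  have : (2 ^+ n)^-1 <= n.+1%:R^-1 :> R.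
    rewrite lef_pV2 ?posrE ?ltr0n ?exprn_gt0//.
    by rewrite -natrX ler_nat ltn_expl.
  move: h; rewrite ger0_norm ?invr_ge0//.
  rewrite ltr_pdivlMr; last lra.
  have : 0 <= (2 ^+ n)^-1 :> R by rewrite invr_ge0 exprn_ge0.
  by move: (2 ^+ n)^-1 (n.+1%:R^-1 : R) => q q'; nra.
have [|z Hz] := BC f.
  exists (mdist p x + (L + L)) => n; have [h _] := Hf n.
  have := metric_triangle p x (f n); have := ler_norm (mdist x (f n) - s * L).
  have : L * (2 ^+ n)^-1 <= L by rewrite ler_piMr// invf_le1 ?exprn_gt0// exprn_ege1// ler1n.
  have : s * L <= L by rewrite ler_piMl//; case/andP: s01.
  by lra.
exists z; split; first by apply: (cluster_dist Hz g0) => n; case: (Hf n).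
by rewrite metric_sym; apply: (cluster_dist Hz g0) => n; case: (Hf n).
Qed.

(** * Properness and homogeneity of pretangent spaces *)

Section TangentHypothesis.
Context {R : realType} {X : metricType R} (p : X).
Local Notation d := (@mdist R X).
Hypothesis ST : forall (r : normalizing R) (F : stable_family p r),
  separable (pretangent F) /\ tangent F.

Lemma incr_comp (k k' : nat -> nat) : {homo k : m n / (m < n)%N} ->
  {homo k' : m n / (m < n)%N} -> {homo k \o k' : m n / (m < n)%N}.
Proof. by move=> kI k'I m n mn /=; apply: kI; exact: k'I. Qed.

(* Separability lets a subsequence of [z] be mutually stable with the whole family;
   since the space is tangent, the resulting new point is not new. *)
Lemma realize (r : normalizing R) (F : stable_family p r) (k0 : nat -> nat) (z : nat -> X) :
  {homo k0 : m n / (m < n)%N} -> bounded_by p (r \o k0) z ->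
  exists2 k : nat -> nat, {homo k : m n / (m < n)%N} & exists a : pretangent F,
    tends (fun n => d (z (k n)) (rep a (k0 (k n))) / r (k0 (k n))) 0.
Proof.
move=> k0I [B [N zB]]; have [sep tan] := ST F; have [q Hq] := dense_sequence sep.
have [|k [kI Hk]] := @extract R (fun j n => d (z n) (rep (q j) (k0 n)) / r (k0 n)).
  move=> j; have [B' [N' HB']] := rep_bounded (q j).
  exists (B + B'), (maxn N N') => n; rewrite geq_max => /andP[Nn N'n].
  have r0 := nseqr_gt0 r (k0 n); rewrite ger0_norm ?divr_ge0 ?mdist_ge0 ?(ltW r0)//.
  have N'n' := leq_trans N'n (incr_ge k0I n).
  apply: le_trans (lerD (zB _ Nn) (HB' _ N'n')); rewrite /= -mulrDl ler_pM2r ?invr_gt0//.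
  by rewrite (metric_sym (rep _ _)) metric_triangle.
pose kk := k0 \o k; have kkI : {homo kk : m n / (m < n)%N} by exact: incr_comp.
(* At scale [r], [x] is eventually close to some [q i], whose quotients with [z] converge along [k];
   hence the quotients with [x] are Cauchy. *)
have C x : sfam F x -> exists l, tends (fun n => d (z (k n)) (x (kk n)) / r (kk n)) l.
  move=> Fx; have [a ax] := class_of Fx; apply: tends_cauchy => e e0.
  have e3 : 0 < e / 3 by rewrite divr_gt0.
  have e6 : 0 < e / 6 by rewrite divr_gt0.
  have [i hi] := Hq a _ e6.
  have [N1 H1] := tends_sub kkI (dist_limit ax (mdist_rep a (q i))) e6.
  have [l hl] := Hk i; have [N2 H2] := hl _ e6.
  exists (maxn N1 N2) => m n; rewrite !geq_max => /andP[N1m N2m] /andP[N1n N2n].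
  have key n' : (N1 <= n')%N ->
      `|d (z (k n')) (x (kk n')) / r (kk n') - d (z (k n')) (rep (q i) (kk n')) / r (kk n')| < e / 3.
    move=> /H1 /=; set D := d (x _) _ / _ => h.
    have hD : D < e / 3 by have := ler_norm (D - mdist a (q i)); lra.
    apply: le_lt_trans hD; have r0 := nseqr_gt0 r (kk n').
    rewrite -mulrBl normrM (gtr0_norm (_ : 0 < (r (kk n'))^-1)) ?invr_gt0//.
    rewrite ler_pM2r ?invr_gt0// ler_norml.
    have := metric_triangle (z (k n')) (x (kk n')) (rep (q i) (kk n')).
    have := metric_triangle (z (k n')) (rep (q i) (kk n')) (x (kk n')).
    by rewrite (metric_sym (rep _ _)) => *; apply/andP; split; lra.
  have := key _ N1m; have := key _ N1n; have := H2 _ N2m; have := H2 _ N2n => /=.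
  rewrite /kk /= !ltr_norml => /andP[? ?] /andP[? ?] /andP[? ?] /andP[? ?].
  by apply/andP; split; lra.
pose G : set (nat -> X) := [set x \o kk | x in F] `|` [set z \o k].
have Cz x : sfam F x -> mutually_stable (subnormalizing r kkI) (z \o k) (x \o kk).
  by move=> Fx; apply/mutually_stableP; exact: C.
have [||F' GF'] := @extend_stable _ _ p (subnormalizing r kkI) G.
- move=> _ _ [[x Fx <-]|->] [[y Fy <-]|->].
  + have /mutually_stableP[l hl] := (sfam_max F).1 _ _ Fx Fy.
    by apply/mutually_stableP; exists l; exact: (tends_sub kkI hl).
  + by apply: mutually_stableC; exact: Cz.
  + exact: Cz.
  + exact: mutually_stablexx.
- by left; exists (fun=> p) => //; exact: (sfam_pt F).
have FF' : [set x \o kk | x in F] `<=` F' by move=> y Fy; apply: GF'; left.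
have [g _ gK] := tan kk kkI F' FF'.
have zF' : z \o k \in (F' : set (nat -> X)) by rewrite inE; apply: GF'; right.
pose Z : set_type F' := SigSub zF'.
exists k => //; exists (g (\pi_(pretangent F') Z)).
have /esym/pi_pretangentP/eqP := gK (\pi_(pretangent F') Z).
set W := subseq_fam _ _.
have h : d (val Z n) (val W n) / subnormalizing r kkI n @[n --> \oo] --> sdist Z W.
  exact: sfam_cvg.
by move=> h0; rewrite h0 in h; apply/tendsP; exact: h.
Qed.

Variables (r : normalizing R) (F : stable_family p r).
Local Notation T := (pretangent F).
Local Notation o := (origin F).

(** Each [f j] is replaced by its representative at one late index [M j], where the distances to
    [q 0], ..., [q j] are already nearly right. A point [a] realizing a subsequence of the result is
    a cluster point, as one sees by comparing through a [q i] close to [a]. *)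
Lemma pretangent_bounded_cluster : bounded_cluster o.
Proof.
move=> f [B fB]; have [q Hq] := dense_sequence (ST F).1.
have [|M [MI HM]] := @subseq_of_dep (fun j n =>
   (forall i, (i <= j)%N -> `|d (rep (f j) n) (rep (q i) n) / r n - mdist (f j) (q i)| < j.+1%:R^-1)
   /\ d (rep (f j) n) p / r n <= B + 1).
  move=> j N.
  have [N1 H1] := mdist_origin (f j) ltr01.
  have [N2 H2] : exists N2, forall n, (N2 <= n)%N -> forall i, (i <= j)%N ->
      `|d (rep (f j) n) (rep (q i) n) / r n - mdist (f j) (q i)| < j.+1%:R^-1.
    suff : forall j', exists N2, forall n, (N2 <= n)%N -> forall i, (i <= j')%N ->
      `|d (rep (f j) n) (rep (q i) n) / r n - mdist (f j) (q i)| < j.+1%:R^-1 by exact.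
    have j0 : 0 < (j.+1%:R^-1 : R) by rewrite invr_gt0.
    elim=> [|j' [N' H']].
      have [N' H'] := mdist_rep (f j) (q 0%N) j0.
      by exists N' => n Nn i; rewrite leqn0 => /eqP ->; exact: H'.
    have [N'' H''] := mdist_rep (f j) (q j'.+1) j0.
    exists (maxn N' N'') => n; rewrite geq_max => /andP[N'n N''n] i.
    by rewrite leq_eqVlt => /predU1P[->|ij]; [exact: H''|exact: H'].
  exists (maxn N (maxn N1 N2)); first by rewrite leq_max leqnn.
  have l1 : (N1 <= maxn N (maxn N1 N2))%N by rewrite !leq_max leqnn orbT.
  have l2 : (N2 <= maxn N (maxn N1 N2))%N by rewrite !leq_max leqnn !orbT.
  split; first exact: H2.
  have := H1 _ l1; have := fB j; set D := d _ _ / _ => h1 h2.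
  by have := ler_norm (D - mdist o (f j)); lra.
pose z j := rep (f j) (M j).
have [|k kI [a ha]] := @realize r F M z MI.
  by exists (B + 1), 0%N => n _; exact: (HM n).2.
exists a => e e0 N.
have e4 : 0 < e / 4 by rewrite divr_gt0.
have e8 : 0 < e / 8 by rewrite divr_gt0.
have [i hi] := Hq a _ e4.
have [N1 H1] := ha _ e8.
have MkI := incr_comp MI kI.
have [N2 H2] := tends_sub MkI (mdist_rep a (q i)) e8.
have [N3 H3] := invS_small e8.
pose n := maxn (maxn N i) (maxn N1 (maxn N2 N3)).
have [nN ni n1 n2 n3] : [/\ (N <= n)%N, (i <= n)%N, (N1 <= n)%N, (N2 <= n)%N & (N3 <= n)%N].
  by rewrite /n; split; rewrite !leq_max leqnn ?orbT.
have kn := incr_ge kI n.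
exists (k n); first exact: leq_trans nN kn.
have h1 := H1 _ n1; have h2 := H2 _ n2; have h3 := H3 _ (leq_trans n3 kn).
have [/(_ i (leq_trans ni kn)) h4 _] := HM (k n).
rewrite subr0 ger0_norm ?divr_ge0 ?mdist_ge0 ?(ltW (nseqr_gt0 _ _))// in h1.
rewrite ger0_norm ?invr_ge0// in h3; rewrite /= in h2.
have h4' := lt_trans h4 h3; move: h1 h2 h4'; rewrite /z.
set D1 := d _ _ / _; set D2 := d _ _ / _; set D3 := d _ _ / _ => h1 h2 h4'.
have tri : D3 <= D1 + D2.
  by rewrite -mulrDl ler_pM2r ?invr_gt0 ?nseqr_gt0// metric_triangle.
move: h2 h4'; rewrite !ltr_norml => /andP[? ?] /andP[? ?].
have := metric_triangle (f (k n)) (q i) a; rewrite (metric_sym (q i)); lra.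
Qed.

(** Even terms of [r'] are the scales [r], odd ones the scales [l * r]. The sequences [w f]
    alternate the two ends of the pairs in [q], and [psim l q] makes them mutually stable. A point
    [b] at the scales [r'] realizes [x] along even indices; its odd terms, measured at scale [r],
    realize [y]. *)
Lemma pretangent_homogeneous : homogeneous o.
Proof.
move=> l q x l0 oq ql.
have r'0 n : 0 < (if odd n then l * r n./2 else r n./2).
  by case: ifP => _; rewrite ?mulr_gt0 ?nseqr_gt0.
have r't : (if odd n then l * r n./2 else r n./2) @[n --> \oo] --> 0.
  apply/tendsP => e e0.
  have e1 : 0 < e / (l + 1) by rewrite divr_gt0//; lra.
  have [N HN] := nseqr_tends r e1; exists N.*2 => n Nn.
  have /HN : (N <= n./2)%N by rewrite -(doubleK N) half_leq.
  have rn := nseqr_gt0 r n./2.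
  rewrite !subr0 !gtr0_norm// ltr_pdivlMr; last lra.
  by case: ifP => _; nra.
pose r' := Normalizing r'0 r't.
have evI : {homo (fun n => n.*2) : m n / (m < n)%N} by move=> m n; rewrite ltn_double.
have odI : {homo (fun n => n.*2.+1) : m n / (m < n)%N} by move=> m n; rewrite ltnS ltn_double.
have r'ev n : r' n.*2 = r n by rewrite /= odd_double doubleK.
have r'od n : r' n.*2.+1 = l * r n by rewrite /= odd_double /= uphalf_double.
pose w (f : T * T) n := if odd n then rep f.2 n./2 else rep f.1 n./2.
have wev f n : w f n.*2 = rep f.1 n by rewrite /w odd_double doubleK.
have wod f n : w f n.*2.+1 = rep f.2 n by rewrite /w /= odd_double /= uphalf_double.
have merge (u : nat -> R) c : tends (fun n => u n.*2) c -> tends (fun n => u n.*2.+1) c -> tends u c.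
  move=> h1 h2 e e0; have [N1 H1] := h1 _ e0; have [N2 H2] := h2 _ e0.
  exists (maxn N1 N2).*2.+1 => n Nn; rewrite -(odd_double_half n).
  have := half_leq Nn; rewrite /= uphalf_double geq_max => /andP[N1n N2n].
  by case: (odd n); [exact: H2|exact: H1].
have ww f g : f \in q -> g \in q -> tends (fun n => d (w f n) (w g n) / r' n) (mdist f.1 g.1).
  move=> fq gq; apply: merge.
    by apply: eq_tends (mdist_rep f.1 g.1) => n; rewrite !wev r'ev.
  have h := tendsM (tends_cst l^-1) (mdist_rep f.2 g.2).
  rewrite (ql _ _ fq gq) mulKf ?gt_eqF// in h.
  by apply: eq_tends h => n; rewrite !wod r'od invfM; ring.
have wp f : f \in q -> tends (fun n => d (w f n) p / r' n) (mdist o f.1).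
  move=> fq; apply: merge.
    by apply: eq_tends (mdist_origin f.1) => n; rewrite !wev r'ev.
  have h := tendsM (tends_cst l^-1) (mdist_origin f.2).
  have E : mdist o f.2 = l * mdist o f.1 := ql (o, o) f oq fq.
  rewrite E mulKf ?gt_eqF// in h.
  by apply: eq_tends h => n; rewrite !wod r'od invfM; ring.
have [||F' GF'] := @extend_stable _ _ p r' [set y | y = (fun=> p) \/ exists2 f, f \in q & y = w f].
- move=> y z [->|[f fq ->]] [->|[g gq ->]].
  + exact: mutually_stablexx.
  + by apply: mutually_stableC; apply/mutually_stableP; exists (mdist o g.1); exact: wp.
  + by apply/mutually_stableP; exists (mdist o f.1); exact: wp.
  + by apply/mutually_stableP; exists (mdist f.1 g.1); exact: ww.
- by left.
have wF' f : f \in q -> sfam F' (w f) by move=> fq; apply: GF'; right; exists f.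
have [|k kI [b hb]] := @realize r' F' (fun n => n.*2) (rep x) evI.
  have [B [N HB]] := rep_bounded x; exists B, N => n Nn.
  by have := HB n Nn; rewrite -(r'ev n).
(* The full limit exists because both sequences belong to [F'], and a subsequence of even indices
   gives its value. *)
have bw f : f \in q -> tends (fun n => d (rep b n) (w f n) / r' n) (mdist x f.1).
  move=> fq; have /mutually_stableP[c hc] := (sfam_max F').1 _ _ (rep_in b) (wF' f fq).
  suff : mdist x f.1 = c by move=> ->.
  have kk := incr_comp evI kI.
  apply: (tends_unique _ (tends_sub kk hc)).
  have h0 : tends (fun n => d (rep x (k n)) (rep b (k n).*2) / (subnormalizing r kI) n) 0.
    by apply: eq_tends hb => n; rewrite (r'ev (k n)).
  have h1 := dist_limit h0 (tends_sub kI (mdist_rep x f.1)).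
  by apply: eq_tends h1 => n; rewrite /= wev; congr (_ / _); exact: (esym (r'ev (k n))).
have bw' f : f \in q -> tends (fun n => d (rep b n.*2.+1) (rep f.2 n) / r n) (l * mdist x f.1).
  move=> fq; have h := tendsM (tends_cst l) (tends_sub odI (bw f fq)).
  apply: eq_tends h => n; rewrite /comp wod (_ : r' _ = l * r n) ?r'od// invfM mulrCA mulVKf ?gt_eqF//.
have idI : {homo id : m n / (m < n)%N} by [].
have [|k2 k2I [y hy]] := @realize r F id (fun n => rep b n.*2.+1) idI.
  have h := bw' _ oq; apply: (tends_bounded_by (l := l * mdist x o)).
  have h0 : tends (fun n => d (rep o n) p / r n) 0 := originP F.
  have h1 : tends (fun n => d (rep o n) (rep b n.*2.+1) / r n) (l * mdist x o).
    by apply: eq_tends h => n; rewrite metric_sym.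
  by apply: eq_tends (dist_limit h0 h1) => n; rewrite metric_sym.
exists y; apply: psim_cons => // f fq.
have h0 : tends (fun n => d (rep b (k2 n).*2.+1) (rep y (k2 n)) / (subnormalizing r k2I) n) 0.
  exact: hy.
have h1 := dist_limit h0 (tends_sub k2I (bw' f fq)).
exact: (tends_unique (tends_sub k2I (mdist_rep y f.2)) h1).
Qed.

End TangentHypothesis.

(** * Infinitesimal midpoints without quotients *)

Section Midpoints.
Context {R : realType} {X : metricType R} (p : X).
Local Notation d := (@mdist R X).
Implicit Types (x y z : nat -> X).

Lemma delta2_gt0 (x y : X) : ~~ ((x == p) && (y == p)) -> 0 < delta2 p x y.
Proof. by rewrite /delta2 lt_max !mdist_gt0 negb_and. Qed.

(** The inequality absorbs the conventions of the quotient: where [x n = y n = p] it forces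
    [z n = p], just as a quotient below a finite bound does. *)
Lemma midpoint_quotient_cvg x y z (a : nat -> X) : (forall n, a n = x n \/ a n = y n) ->
  (midpoint_quotient p (x n) (y n) (z n) (a n) @[n --> \oo] --> 0%E) <->
  (forall e, 0 < e -> exists N, forall n, (N <= n)%N ->
    `|d (a n) (z n) - d (x n) (y n) / 2| <= e * delta2 p (x n) (y n)).
Proof.
move=> axy; have ap n : x n = p -> y n = p -> a n = p by move=> xp yp; case: (axy n) => ->.
split=> [hq e e0|H].
  have [N _ HN] : \forall n \near \oo, (midpoint_quotient p (x n) (y n) (z n) (a n) < e%:E)%E.
    apply: (hq [set t | (t < e%:E)%E]).
    by apply: open_nbhs_nbhs; split; [exact: open_ereal_lt_ereal|rewrite /= lte_fin].
  exists N => n /HN /=; rewrite /midpoint_quotient; case: ifPn => [/andP[/eqP xp /eqP yp]|ab].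
    case: eqP => [->|//] _; rewrite (ap n xp yp) xp yp !mdistxx mul0r subr0 normr0.
    by rewrite mulr_ge0 ?(ltW e0)// le_max mdist_ge0.
  by rewrite lte_fin ltr_pdivrMr ?delta2_gt0// => /ltW.
apply: cvg_EFin.
  have [N HN] := H _ ltr01; exists N => // n /= Nn; rewrite /midpoint_quotient.
  case: ifPn => [/andP[/eqP xp /eqP yp]|//]; have := HN n Nn.
  rewrite (ap n xp yp) xp yp /delta2 !mdistxx maxxx mulr0 mul0r subr0 ger0_norm ?mdist_ge0//.
  by rewrite leNgt mdist_gt0 negbK eq_sym => ->.
apply/tendsP => e e0 /=.
have e2 : 0 < e / 2 by rewrite divr_gt0.
have [N HN] := H _ e2; exists N => n Nn; have := HN n Nn.
rewrite subr0 /midpoint_quotient; case: ifPn => [_|ab] h.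
  by case: ifP => _; rewrite /= normr0.
have D := delta2_gt0 ab.
rewrite /= ger0_norm ?divr_ge0 ?(ltW D)// ltr_pdivrMr//; apply: le_lt_trans h _.
by rewrite ltr_pM2r//; lra.
Qed.

Lemma delta2_bounded (r : normalizing R) x y : bounded_by p r x -> bounded_by p r y ->
  exists B N, 0 < B /\ forall n, (N <= n)%N -> delta2 p (x n) (y n) <= B * r n.
Proof.
move=> [B1 [N1 H1]] [B2 [N2 H2]].
exists (Num.max 1 (Num.max B1 B2)), (maxn N1 N2); split; first by rewrite lt_max ltr01.
move=> n; rewrite geq_max => /andP[/H1 h1 /H2 h2]; move: h1 h2.
rewrite !ler_pdivrMr ?nseqr_gt0// => h1 h2; rewrite ge_max; apply/andP; split.
  by apply: le_trans h1 _; rewrite ler_pM2r ?nseqr_gt0// !le_max lexx orbT.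
by apply: le_trans h2 _; rewrite ler_pM2r ?nseqr_gt0// !le_max lexx !orbT.
Qed.

Lemma midpoint_quotient_tends (r : normalizing R) x y z (a : nat -> X) l :
  (forall n, a n = x n \/ a n = y n) -> bounded_by p r x -> bounded_by p r y ->
  midpoint_quotient p (x n) (y n) (z n) (a n) @[n --> \oo] --> 0%E ->
  tends (fun n => d (x n) (y n) / r n) l -> tends (fun n => d (a n) (z n) / r n) (l / 2).
Proof.
move=> axy xb yb /(midpoint_quotient_cvg _ axy) H hl.
have [B [N1 [B0 HB]]] := delta2_bounded xb yb.
have hl2 := tendsM hl (tends_cst 2^-1).
apply: (tends_near (N := 0%N) _ _ hl2) => [n _|]; first exact: lexx.
move=> e e0; have e2 : 0 < e / 2 / B by rewrite !divr_gt0.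
have [N2 H2] := H _ e2; exists (maxn N1 N2) => n; rewrite geq_max => /andP[/HB h1 /H2 h2].
have r0 := nseqr_gt0 r n.
have -> : d (a n) (z n) / r n - d (x n) (y n) / r n / 2 =
  (d (a n) (z n) - d (x n) (y n) / 2) / r n by field; rewrite gt_eqF.
rewrite subr0 normr_id normrM (gtr0_norm (_ : 0 < (r n)^-1)) ?invr_gt0// ltr_pdivrMr//.
apply: le_lt_trans h2 _; apply: le_lt_trans (ler_wpM2l (ltW e2) h1) _.
by rewrite mulrA divfK ?gt_eqF// ltr_pM2r//; lra.
Qed.

End Midpoints.

(** * The lower limit of [A3] as an approximate Ptolemy inequality *)

Section Ptolemy.
Context {R : realType} {X : metricType R} (p : X).
Local Notation d := (@mdist R X).
Implicit Types (w x y z : X).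

Definition delta4 w x y z : R :=
  Num.max (Num.max (d w p) (d x p)) (Num.max (d y p) (d z p)).

Lemma delta4_le w x y z c :
  (delta4 w x y z <= c) = [&& d w p <= c, d x p <= c, d y p <= c & d z p <= c].
Proof. by rewrite /delta4 !ge_max -andbA. Qed.

Lemma delta4_lt w x y z c :
  (delta4 w x y z < c) = [&& d w p < c, d x p < c, d y p < c & d z p < c].
Proof. by rewrite /delta4 !gt_max -andbA. Qed.

Lemma A3_ge e w x y z : 0 <= e -> (- e <= A3 p (w, x, y, z)) =
  (d x y * d w z <= d x w * d y z + d x z * d y w + e * delta4 w x y z ^+ 2).
Proof.
move=> e0; rewrite /A3; case: eqP => [[-> -> -> ->]|ne].
  by rewrite !mdistxx !mul0r !add0r oppr_le0 e0 mulr_ge0// sqr_ge0.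
have D : 0 < delta4 w x y z.
  rewrite ltNge delta4_le; apply/negP => /and4P[].
  by rewrite !leNgt !mdist_gt0 !negbK => /eqP wp /eqP xp /eqP yp /eqP zp; apply: ne; rewrite wp xp yp zp.
rewrite -/(delta4 w x y z) ler_pdivlMr ?exprn_gt0//.
by apply/idP/idP => h; lra.
Qed.

(** The error is quadratic in the size of the quadruple, as the products are, so this form survives
    rescaling. *)
Lemma A3_liminf :
  (0 <= limf_einf (fun u : X * X * X * X => (A3 p u)%:E) (nbhs (p, p, p, p)))%E <->
  forall e, 0 < e -> exists2 c, 0 < c & forall w x y z, delta4 w x y z < c ->
    d x y * d w z <= d x w * d y z + d x z * d y w + e * delta4 w x y z ^+ 2.
Proof.
rewrite limf_einfE; split=> [h e e0|H].
  have {}h := lt_le_trans (_ : ((- e)%:E < 0)%E) h.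
  have [|_ [V Vp <-] hV] := ereal_sup_gt (h _); first by rewrite lte_fin oppr_lt0.
  have /nbhs_ballP[c c0 cV] := Vp; exists c => // w x y z.
  rewrite delta4_lt => /and4P[wc xc yc zc]; rewrite -A3_ge ?(ltW e0)// -lee_fin.
  apply: le_trans (ltW hV) _; apply: ereal_inf_lbound; exists (w, x, y, z) => //.
  by apply: cV; split; [split; [split|]|]; rewrite /= ballEmdist/= metric_sym.
apply/lee_subgt0Pr => e e0; have [c c0 Hc] := H _ e0; rewrite sub0e.
apply: le_trans (ereal_sup_ubound _); last first.
  by exists (ball (p, p, p, p) c) => //; exact: nbhsx_ballx.
apply: le_ereal_inf_tmp => _ [[[[w x] y] z] [[[wc xc] yc] zc] <-].
rewrite -EFinN lee_fin A3_ge ?(ltW e0)//; apply: Hc; rewrite delta4_lt.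
move: wc xc yc zc; rewrite /= !ballEmdist/= !(metric_sym p).
by move=> -> -> -> ->.
Qed.

End Ptolemy.

(** * Midpoints and Ptolemy's inequality in pretangent spaces *)

Section TangentHypothesis.
Context {R : realType} {X : metricType R} (p : X).
Local Notation d := (@mdist R X).
Hypothesis ST : forall (r : normalizing R) (F : stable_family p r),
  separable (pretangent F) /\ tangent F.
Variables (r : normalizing R) (F : stable_family p r).

(** An infinitesimal midpoint of two representatives is bounded at scale [r], so along a subsequence
    it is realized by a point of the space. *)
Lemma pretangent_midpoints : midpoint_convex p ->
  forall a b : pretangent F, exists m, btw (1 / 2) a b m.
Proof.
move=> MC a b.
have [||z [hz1 hz2]] := MC (rep a) (rep b).
- exact: bounded_by_cvg (rep_bounded a).
- exact: bounded_by_cvg (rep_bounded b).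
have rl n : rep a n = rep a n \/ rep a n = rep b n by left.
have rr n : rep b n = rep a n \/ rep b n = rep b n by right.
have za := midpoint_quotient_tends rl (rep_bounded a) (rep_bounded b) hz1 (mdist_rep a b).
have zb := midpoint_quotient_tends rr (rep_bounded a) (rep_bounded b) hz2 (mdist_rep a b).
have zB : bounded_by p r z.
  have [B1 [N1 H1]] := rep_bounded a; have [B2 [N2 H2]] := tends_bounded za.
  exists (B2 + B1), (maxn N1 N2) => n; rewrite geq_max => /andP[/H1 h1 /H2 h2].
  have r0 := nseqr_gt0 r n.
  apply: le_trans (lerD (le_trans (ler_norm _) h2) h1).
  by rewrite -mulrDl ler_pM2r ?invr_gt0// (metric_sym (rep a n)) metric_triangle.
have idI : {homo id : m n / (m < n)%N} by [].
have [k kI [m hm]] := realize ST F idI zB.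
have half c : tends (fun n => d (rep c n) (z n) / r n) (mdist a b / 2) -> mdist m c = mdist a b / 2.
  move=> h.
  have h0 : tends (fun n => d (z (k n)) (rep m (k n)) / (subnormalizing r kI) n) 0 by exact: hm.
  have h1 : tends (fun n => d (z (k n)) (rep c (k n)) / (subnormalizing r kI) n) (mdist a b / 2).
    by apply: eq_tends (tends_sub kI h) => n /=; rewrite metric_sym.
  exact: tends_unique (tends_sub kI (mdist_rep m c)) (dist_limit h0 h1).
by exists m; split; rewrite ?(metric_sym a m) ?half//; lra.
Qed.

End TangentHypothesis.

Lemma pretangent_ptolemaic (R : realType) (X : metricType R) (p : X) (r : normalizing R)
    (F : stable_family p r) :
  (0 <= limf_einf (fun u : X * X * X * X => (A3 p u)%:E) (nbhs (p, p, p, p)))%E ->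
  @ptolemaic R (pretangent F).
Proof.
move=> /A3_liminf H w x y z.
have [B [N [B0 HB]]] : exists B N, 0 < B /\ forall n, (N <= n)%N ->
    delta4 p (rep w n) (rep x n) (rep y n) (rep z n) <= B * r n.
  have [B1 [N1 [B10 H1]]] := delta2_bounded (rep_bounded w) (rep_bounded x).
  have [B2 [N2 [B20 H2]]] := delta2_bounded (rep_bounded y) (rep_bounded z).
  exists (B1 + B2), (maxn N1 N2); split; first exact: addr_gt0.
  move=> n; rewrite geq_max => /andP[/H1 h1 /H2 h2]; have r0 := nseqr_gt0 r n.
  rewrite /delta4 ge_max; apply/andP; split.
    by apply: le_trans h1 _; rewrite ler_pM2r// lerDl ltW.
  by apply: le_trans h2 _; rewrite ler_pM2r// lerDr ltW.
apply/ler_addgt0Pr => e e0.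
(* The representatives stay within [B * r n] of [p], so after division by [r n ^+ 2] the error is at
   most [e]. *)
have eB : 0 < e / B ^+ 2 by rewrite divr_gt0// exprn_gt0.
have [c c0 Hc] := H _ eB.
have [N' HN'] := nseqr_tends r (divr_gt0 c0 B0).
have L := tendsM (mdist_rep x y) (mdist_rep w z).
have Rt := tendsD (tendsM (mdist_rep x w) (mdist_rep y z)) (tendsM (mdist_rep x z) (mdist_rep y w)).
apply: (tends_le (N := maxn N N') _ L (tendsD Rt (tends_cst e))) => n.
rewrite geq_max => /andP[/HB hB /HN']; have r0 := nseqr_gt0 r n.
rewrite subr0 gtr0_norm// ltr_pdivlMr// (mulrC _ B) => hc.
have := Hc _ _ _ _ (le_lt_trans hB hc).
have D0 : 0 <= delta4 p (rep w n) (rep x n) (rep y n) (rep z n) by rewrite !le_max mdist_ge0.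
have : delta4 p (rep w n) (rep x n) (rep y n) (rep z n) ^+ 2 <= B ^+ 2 * r n ^+ 2.
  by rewrite -exprMn ler_pXn2r// nnegrE ltW// mulr_gt0.
move=> /(ler_wpM2l (ltW eB)); rewrite [X in _ <= X]mulrA divfK ?gt_eqF ?exprn_gt0// => h1 h2.
have {h1}h2 := le_trans h2 (lerD (lexx _) h1).
rewrite !mulf_div -expr2 -mulrDl -[X in _ + X](mulfK (_ : r n ^+ 2 != 0)) ?gt_eqF ?exprn_gt0//.
by rewrite -mulrDl ler_pM2r ?invr_gt0 ?exprn_gt0.
Qed.

(** * Blow-up: from CAT(0) pretangent spaces back to [X] *)

Section BlowUp.
Context {R : realType} {X : metricType R} (p : X).
Local Notation d := (@mdist R X).

(** The size [D] itself is the normalizing sequence, so countably many sequences of order [D]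
    acquire limits in one pretangent space, along a subsequence. *)
Lemma blow_up (D : nat -> R) (s : nat -> nat -> X) : (forall n, 0 < D n) -> tends D 0 ->
  (forall j, exists B, forall n, d (s j n) p <= B * D n) ->
  exists2 k : nat -> nat, {homo k : m n / (m < n)%N} &
  exists (r : normalizing R) (F : stable_family p r) (a : nat -> pretangent F),
    [/\ forall n, r n = D (k n),
        forall j, tends (fun n => d (rep (a j) n) (s j (k n)) / r n) 0 &
        forall i j, tends (fun n => d (s i (k n)) (s j (k n)) / r n) (mdist (a i) (a j))].
Proof.
move=> D0 Dt sB; pose r := Normalizing D0 ((tendsP _ _).1 Dt).
have [|k [kI [F sF]]] := @stable_subsequence _ _ p r s.
  by move=> j; have [B HB] := sB j; exists B, 0%N => n _; rewrite ler_pdivrMr.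
have /choice[a Ha] := fun j => class_of (sF j).
exists k => //; exists (subnormalizing r kI), F, a; split=> // i j.
have h := dist_limit (Ha i) (mdist_rep (a i) (a j)).
have hC : tends (fun n => d (rep (a j) n) (s i (k n)) / subnormalizing r kI n) (mdist (a i) (a j)).
  by apply: eq_tends h => n; rewrite metric_sym.
by apply: eq_tends (dist_limit (Ha j) hC) => n; rewrite metric_sym.
Qed.

Hypothesis C0 : forall (r : normalizing R) (F : stable_family p r), CAT0 (pretangent F).

Lemma CAT0_ptolemaic (M : metricType R) : CAT0 M -> @ptolemaic R M.
Proof.
by move=> C; apply: bruhat_tits_ptolemaic; [exact: CAT0_has_points|exact: CAT0_bruhat_tits].
Qed.

Lemma CAT0_A3 :
  (0 <= limf_einf (fun u : X * X * X * X => (A3 p u)%:E) (nbhs (p, p, p, p)))%E.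
Proof.
apply/A3_liminf => e e0; apply: contrapT => no.
have /choice[f Hf] : forall n : nat, exists q : X * X * X * X, let: (w, x, y, z) := q in
    delta4 p w x y z < n.+1%:R^-1 /\
    d x w * d y z + d x z * d y w + e * delta4 p w x y z ^+ 2 < d x y * d w z.
  move=> n; apply: contrapT => no'; apply: no; exists n.+1%:R^-1; first by rewrite invr_gt0.
  move=> w x y z h; rewrite leNgt; apply/negP => h'.
  by apply: no'; exists (w, x, y, z).
pose w n := (f n).1.1.1; pose x n := (f n).1.1.2; pose y n := (f n).1.2; pose z n := (f n).2.
pose D n := delta4 p (w n) (x n) (y n) (z n).
have {}Hf n : D n < n.+1%:R^-1 /\
    d (x n) (w n) * d (y n) (z n) + d (x n) (z n) * d (y n) (w n) + e * D n ^+ 2 <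
    d (x n) (y n) * d (w n) (z n).
  by have := Hf n; rewrite /D /w /x /y /z; case: (f n) => [[[w' x'] y'] z'].
have DB n : [/\ d (w n) p <= D n, d (x n) p <= D n, d (y n) p <= D n & d (z n) p <= D n].
  by have := lexx (D n); rewrite {1}/D delta4_le => /and4P.
have D0 n : 0 < D n.
  rewrite ltNge; apply/negP => Dn; have [_] := Hf n; apply/negP; rewrite -leNgt.
  have eqp v : d v p <= D n -> v = p.
    by move=> /le_trans/(_ Dn); rewrite leNgt mdist_gt0 negbK => /eqP.
  have [/eqp -> /eqp -> /eqp -> /eqp ->] := DB n.
  by rewrite !mdistxx !mul0r !add0r mulr_ge0 ?(ltW e0)// sqr_ge0.
have Dt : tends D 0.
  move=> e' e'0; have [N HN] := invS_small e'0; exists N => n /HN.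
  rewrite subr0 !ger0_norm ?invr_ge0 ?(ltW (D0 n))//; exact: lt_trans (Hf n).1.
have [|k kI [r [F [a [rD ha hd]]]]] :=
    blow_up (s := fun j => nth w [:: w; x; y; z] j) D0 Dt.
  move=> j; exists 1 => n; rewrite mul1r; have [? ? ? ?] := DB n.
  by case: j => [|[|[|[|j]]]] //=; rewrite nth_nil.
have PT := CAT0_ptolemaic (C0 F).
have L := tendsM (hd 1%N 2%N) (hd 0%N 3%N).
have Rt := tendsD (tendsM (hd 1%N 0%N) (hd 2%N 3%N)) (tendsM (hd 1%N 3%N) (hd 2%N 0%N)).
have : mdist (a 1%N) (a 0%N) * mdist (a 2%N) (a 3%N) + mdist (a 1%N) (a 3%N) * mdist (a 2%N) (a 0%N) + e
    <= mdist (a 1%N) (a 2%N) * mdist (a 0%N) (a 3%N).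
  apply: (tends_le (N := 0%N) _ (tendsD Rt (tends_cst e)) L) => n _ /=.
  have [_ /ltW h] := Hf (k n); have r0 := nseqr_gt0 r n; rewrite -rD in h.
  rewrite !mulf_div -expr2 -mulrDl -[X in _ + X](mulfK (_ : r n ^+ 2 != 0)) ?gt_eqF ?exprn_gt0//.
  by rewrite -mulrDl ler_pM2r ?invr_gt0 ?exprn_gt0.
by have := PT (a 0%N) (a 1%N) (a 2%N) (a 3%N); lra.
Qed.

Lemma near_minimizer (T : Type) (c : T -> R) e (t0 : T) : 0 < e -> (forall t, 0 <= c t) ->
  exists t, forall t', c t <= c t' + e.
Proof.
move=> e0 c0; have ne : has_inf (range c).
  by split; [exists (c t0), t0|exists 0 => _ [t _ <-]].
have [_ [t _ <-] ht] := inf_adherent e0 ne; exists t => t'; apply: le_trans (ltW ht) _.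
by rewrite lerD2r; apply: (ge_inf ne.2); exists t'.
Qed.

(** A blow-up yields midpoints only along a subsequence. Hence [z n] is chosen to nearly minimize
    the error [c n]: if the errors were large infinitely often, a blow-up along those indices would
    contain better candidates. *)
Lemma CAT0_midpoint_convex : midpoint_convex p.
Proof.
move=> x y xp yp; pose D n := delta2 p (x n) (y n).
pose c n z := Num.max `|d (x n) z - d (x n) (y n) / 2| `|d (y n) z - d (x n) (y n) / 2|.
have c0 n z : 0 <= c n z by rewrite le_max normr_ge0.
(* Where [x n = y n = p] the tolerance is 0, and [p] is an exact minimizer. *)
have /choice[z Hz] : forall n, exists z, forall z', c n z <= c n z' + n.+1%:R^-1 * D n.
  move=> n; have [xyp|xyp] := boolP ((x n == p) && (y n == p)).
    exists p => z'; move: xyp => /andP[/eqP Ex /eqP Ey].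
    have -> : c n p = 0 by rewrite /c Ex Ey mdistxx mul0r subrr normr0 maxxx.
    by rewrite addr_ge0// mulr_ge0 ?invr_ge0// le_max mdist_ge0.
  by apply: near_minimizer p _ (c0 n); rewrite mulr_gt0 ?invr_gt0// delta2_gt0.
suff H : forall e, 0 < e -> exists N, forall n, (N <= n)%N -> c n (z n) <= e * D n.
  exists z; split; apply/midpoint_quotient_cvg.
  - by left.
  - move=> e /H[N HN]; exists N => n /HN; apply: le_trans; by rewrite le_max lexx.
  - by right.
  - move=> e /H[N HN]; exists N => n /HN; apply: le_trans; by rewrite le_max lexx orbT.
move=> e e0; apply: contrapT => no.
have [|k0 [k0I Hk0]] := @subseq_of (fun n => e * D n < c n (z n)).
  move=> N; apply: contrapT => no'; apply: no; exists N => n Nn; rewrite leNgt.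
  by apply/negP => h; apply: no'; exists n.
have DB n : d (x n) p <= D n /\ d (y n) p <= D n by rewrite !le_max !lexx orbT.
have D0 n : 0 < D (k0 n).
  rewrite ltNge; apply/negP => Dn; have := Hk0 n; apply/negP; rewrite -leNgt.
  have D00 : 0 <= D (k0 n) by rewrite le_max mdist_ge0.
  have {D00}DE : D (k0 n) = 0 by apply/le_anti/andP.
  apply: le_trans (Hz (k0 n) p) _; rewrite DE !mulr0 addr0.
  have eqp v : d v p <= D (k0 n) -> v = p.
    by rewrite DE leNgt mdist_gt0 negbK => /eqP.
  have [/eqp Ex /eqp Ey] := DB (k0 n).
  by rewrite /c Ex Ey mdistxx mul0r subrr normr0 maxxx.
have Dt : tends D 0.
  apply: (tends_near (N := 0%N) (u := fun=> 0) _ _ (tends_cst 0)); last first.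
    by have := tendsD ((tends_ptP p x).2 xp) ((tends_ptP p y).2 yp); rewrite addr0; exact.
  move=> n _; rewrite subr0 ger0_norm; last by rewrite le_max mdist_ge0.
  by rewrite ge_max lerDl lerDr !mdist_ge0.
have [|k kI [r [F [a [rD ha hd]]]]] :=
    blow_up (s := fun j => nth (x \o k0) [:: x \o k0; y \o k0] j) D0 (tends_sub k0I Dt).
  move=> j; exists 1 => n; rewrite mul1r /=; have [? ?] := DB (k0 n).
  by case: j => [|[|j]] //=; rewrite nth_nil.
have h01 : 0 <= (1 / 2 : R) <= 1 by apply/andP; split; lra.
have [m [xm my]] := CAT0_has_points (C0 F) (a 0%N) (a 1%N) h01.
have lim j : mdist (a j) m = mdist (a 0%N) (a 1%N) / 2 ->
    tends (fun n => `|d (nth (x \o k0) [:: x \o k0; y \o k0] j (k n)) (rep m n)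
      - d (x (k0 (k n))) (y (k0 (k n))) / 2| / r n) 0.
  move=> E; have h1 := dist_limit (ha j) (mdist_rep (a j) m).
  have h2 := tendsM (hd 0%N 1%N) (tends_cst 2^-1); rewrite E in h1.
  have := tendsB h1 h2; rewrite subrr => h3 e' e'0; have [N HN] := h3 _ e'0.
  exists N => n /HN; have r0 := nseqr_gt0 r n.
  rewrite !subr0 [in X in _ -> X]normrM normr_id (gtr0_norm (_ : 0 < (r n)^-1)) ?invr_gt0//.
  by rewrite (mulrAC _ _ 2^-1) -mulrBl normrM (gtr0_norm (_ : 0 < (r n)^-1)) ?invr_gt0.
have e2 : 0 < e / 2 by rewrite divr_gt0.
have [|N0 H0] := lim 0%N _ _ e2; first by rewrite xm; lra.
have [|N1 H1] := lim 1%N _ _ e2; first by rewrite metric_sym my; lra.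
have [N2 H2] := invS_small e2.
pose n := maxn N0 (maxn N1 N2).
have [n0 n1 n2] : [/\ (N0 <= n)%N, (N1 <= n)%N & (N2 <= n)%N].
  by rewrite /n; split; rewrite !leq_max leqnn ?orbT.
have r0 := nseqr_gt0 r n.
have cm : c (k0 (k n)) (rep m n) <= e / 2 * D (k0 (k n)).
  have := H0 _ n0; have := H1 _ n1; rewrite !subr0 !(ger0_norm (divr_ge0 (normr_ge0 _) (ltW r0))).
  rewrite !ltr_pdivrMr// rD /= => h1 h0.
  by rewrite ge_max (ltW h0) (ltW h1).
have := Hz (k0 (k n)) (rep m n); apply/negP; rewrite -ltNge; apply: le_lt_trans (Hk0 (k n)).
have := H2 _ (leq_trans n2 (incr_ge (incr_comp k0I kI) n)).
rewrite ger0_norm ?invr_ge0//; move: (_^-1) => q /= hq.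
have := ler_wpM2r (ltW (D0 (k n))) (ltW hq); lra.
Qed.

Lemma CAT0_Busemann_convex : Busemann_convex p.
Proof.
split; first exact: CAT0_midpoint_convex.
move=> x0 x1 y m x0p x1p yp [hm0 hm1].
have m0 n : x0 n = x0 n \/ x0 n = x1 n by left.
have m1 n : x1 n = x0 n \/ x1 n = x1 n by right.
have {}hm0 := (midpoint_quotient_cvg p _ m0).1 hm0.
have {}hm1 := (midpoint_quotient_cvg p _ m1).1 hm1.
pose D n := delta3 p (x0 n) (y n) (x1 n).
pose f n := d (m n) (y n) - (d (x0 n) (y n) + d (x1 n) (y n)) / 2.
have DB n : [/\ d (x0 n) p <= D n, d (y n) p <= D n & d (x1 n) p <= D n].
  by rewrite !le_max !lexx !orbT.
have D00 n : 0 <= D n by rewrite !le_max mdist_ge0.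
have D2 n : delta2 p (x0 n) (x1 n) <= D n by have [? ? ?] := DB n; rewrite ge_max; apply/andP.
apply/eqoP => e e0; apply: contrapT => no.
have [N1 H1] := hm0 _ ltr01.
(* The second conjunct keeps [m] within [3 * D] of [p], so that it too has a limit in the
   blow-up. *)
have [|k0 [k0I Hk0]] := @subseq_of (fun n => e * D n < f n /\
    `|d (x0 n) (m n) - d (x0 n) (x1 n) / 2| <= delta2 p (x0 n) (x1 n)).
  move=> N; apply: contrapT => no'; apply: no; exists (maxn N N1) => // n /=.
  rewrite geq_max => /andP[Nn N1n]; rewrite leNgt; apply/negP => h; apply: no'; exists n => //.
  split; last by have := H1 n N1n; rewrite mul1r.
  move: h; rewrite (ger0_norm (D00 n)) -/(f n) /pospart => h.
  have eD : 0 <= e * D n by rewrite mulr_ge0// ltW.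
  have [f0|f0] := leP 0 (f n); move: h.
    by rewrite (ger0_norm f0) ger0_norm; lra.
  by rewrite (ltr0_norm f0) addNr mul0r normr0; lra.
have mB n : d (m (k0 n)) p <= 3 * D (k0 n).
  have [_] := Hk0 n => /le_trans/(_ (D2 _)); have [? ? ?] := DB (k0 n).
  rewrite ler_norml => /andP[_ ?].
  have := metric_triangle (m (k0 n)) (x0 (k0 n)) p.
  have := metric_triangle (x0 (k0 n)) p (x1 (k0 n)).
  by rewrite (metric_sym (m _) (x0 _)) (metric_sym p (x1 _)) => *; lra.
have D0 n : 0 < D (k0 n).
  rewrite ltNge; apply/negP => Dn; have DE : D (k0 n) = 0 by apply/le_anti/andP.
  have [h _] := Hk0 n; move: h; apply/negP; rewrite -leNgt.
  have eqp v : d v p <= 0 -> v = p by rewrite leNgt mdist_gt0 negbK => /eqP.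
  have := DB (k0 n); have := mB n; rewrite DE !mulr0 /f => /eqp -> [/eqp -> /eqp -> /eqp ->].
  by rewrite !mdistxx addr0 mul0r subr0.
have Dt : tends D 0.
  apply: (tends_near (N := 0%N) (u := fun=> 0) _ _ (tends_cst 0)); last first.
    have := tendsD (tendsD ((tends_ptP p x0).2 x0p) ((tends_ptP p y).2 yp)) ((tends_ptP p x1).2 x1p).
    by rewrite !addr0; exact.
  move=> n _; rewrite subr0 ger0_norm//.
  have := mdist_ge0 (x0 n) p; have := mdist_ge0 (x1 n) p; have := mdist_ge0 (y n) p.
  by move=> *; rewrite !ge_max; apply/andP; split; [apply/andP; split|]; lra.
pose s j := nth (x0 \o k0) [:: x0 \o k0; x1 \o k0; y \o k0; m \o k0] j.
have [|k kI [r [F [a [rD ha hd]]]]] := blow_up (s := s) D0 (tends_sub k0I Dt).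
  move=> j; exists 3 => n; have [? ? ?] := DB (k0 n); have := mB n; have := D0 n.
  by rewrite /s; case: j => [|[|[|[|j]]]] /=; rewrite ?nth_nil /=; lra.
have kkI := incr_comp k0I kI.
have half j : (forall e', 0 < e' -> exists N, forall n, (N <= n)%N ->
     `|d (s j (k n)) (s 3%N (k n)) - d (s 0%N (k n)) (s 1%N (k n)) / 2| <= e' * D (k0 (k n))) ->
   mdist (a j) (a 3%N) = mdist (a 0%N) (a 1%N) / 2.
  move=> H; apply: (tends_unique (hd j 3%N)).
  have h := tendsM (hd 0%N 1%N) (tends_cst 2^-1).
  apply: (tends_near (N := 0%N) _ _ h) => [n _|]; first exact: lexx.
  move=> e' e'0; have e2 : 0 < e' / 2 by rewrite divr_gt0.
  have [N HN] := H _ e2; exists N => n /HN; have r0 := nseqr_gt0 r n; rewrite -rD => h1.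
  rewrite subr0 normr_id (mulrAC _ _ 2^-1) -mulrBl normrM (gtr0_norm (_ : 0 < (r n)^-1)) ?invr_gt0//.
  by rewrite ltr_pdivrMr//; apply: le_lt_trans h1 _; rewrite ltr_pM2r//; lra.
have E0 : mdist (a 0%N) (a 3%N) = mdist (a 0%N) (a 1%N) / 2.
  apply: half => e' e'0; have [N HN] := hm0 _ e'0; exists N => n Nn.
  apply: le_trans (HN _ (leq_trans Nn (incr_ge kkI n))) _.
  by rewrite ler_pM2l// D2.
have E1 : mdist (a 1%N) (a 3%N) = mdist (a 0%N) (a 1%N) / 2.
  apply: half => e' e'0; have [N HN] := hm1 _ e'0; exists N => n Nn.
  apply: le_trans (HN _ (leq_trans Nn (incr_ge kkI n))) _.
  by rewrite ler_pM2l// D2.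
(* In the blow-up [m] becomes an exact midpoint, and the excess [e] contradicts convexity of the
   distance. *)
have mid : btw (1 / 2) (a 0%N) (a 1%N) (a 3%N).
  by split; rewrite ?E0 ?(metric_sym (a 3%N)) ?E1; lra.
have h01 : 0 <= (1 / 2 : R) <= 1 by apply/andP; split; lra.
have := ptolemaic_convex (CAT0_ptolemaic (C0 F)) (a 2%N) h01 mid.
have L := tendsB (hd 3%N 2%N) (tendsM (tendsD (hd 0%N 2%N) (hd 1%N 2%N)) (tends_cst 2^-1)).
have : e <= mdist (a 3%N) (a 2%N) - (mdist (a 0%N) (a 2%N) + mdist (a 1%N) (a 2%N)) / 2.
  apply: (tends_le (N := 0%N) _ (tends_cst e) L) => n _ /=.
  have [/ltW h _] := Hk0 (k n); have r0 := nseqr_gt0 r n; rewrite -rD in h.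
  rewrite -mulrDl (mulrAC _ _ 2^-1) -mulrBl ler_pdivlMr//; exact: h.
rewrite !(metric_sym (a 2%N)); lra.
Qed.

End BlowUp.

Theorem mainTheorem7 (R : realType) (X : metricType R) (p : X)
  (pretangent_separable_tangent :
    forall (r : normalizing R) (F : stable_family p r),
      separable (pretangent F) /\ tangent F) :
  (forall (r : normalizing R) (F : stable_family p r), CAT0 (pretangent F))
  <->
  (Busemann_convex p /\
   (0 <= limf_einf (fun u : X * X * X * X => (A3 p u)%:E)
           (nbhs (p, p, p, p)))%E).
Proof.
split=> [C0|[[MC _] A3p] r F].
  by split; [exact: CAT0_Busemann_convex|exact: CAT0_A3].
have ST := pretangent_separable_tangent.
have BC : bounded_cluster (origin F) by exact: pretangent_bounded_cluster.
have HO : homogeneous (origin F) by exact: pretangent_homogeneous.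
have HP : @has_points R (pretangent F).
  by apply: (midpoints_has_points BC); exact: pretangent_midpoints.
have PT : @ptolemaic R (pretangent F) by exact: pretangent_ptolemaic.
by apply: bruhat_tits_CAT0 => //; exact: (cone_bruhat_tits PT HP BC HO).
Qed.
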